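(* Let $(M,c)$ be a conformal manifold of signature $(p,q)$, $n=p+q\ge 3$, with standard tractor bundle $(\mathcal{T}(M),\langle\cdot,\cdot\rangle_{\mathcal{T}},\nabla^{nc})$, and let $k\ge 1$. (1) Suppose there exists a totally lightlike subbundle $\mathcal{H}\subset\mathcal{T}(M)$ of rank $k$ which is parallel with respect to $\nabla^{nc}$. Then there is an open and dense subset $\widetilde{M}\subset M$ on which the totally lightlike distribution $L:=\mathrm{pr}_{TM}(\mathcal{H}\cap\mathcal{I}_-^{\perp})\subset TM$ is of constant rank $k-1$ and integrable. Moreover, every point $x\in\widetilde{M}$ admits an open neighbourhood $U=U_x\subset\widetilde{M}$ and a metric $g\in c_U$ such that on $U$: $$Ric^g(TU)\subset L,\qquad\text{and}\qquad L\text{ is parallel with respect to }\nabla^g \ (\text{i.e. } Hol_x(U,g)L_x\subset L_x).$$ (2) Conversely, let $(U,c)$ be a conformal manifold of dimension $\geq 3$, and suppose that there are a metric $g\in c$ and a totally lightlike distribution $L\subset TU$ of rank $k-1$ such that $Ric^g(TU)\subset L$ and $L$ is parallel with respect to $\nabla^g$. Then, with respect to the splitting $\Phi^g:\mathcal{T}(U)\cong\underline{\mathbb{R}}\oplus TU\oplus\underline{\mathbb{R}}$ induced by $g$, $$\mathcal{H}\stackrel{\Phi^g}{=}\begin{pmatrix}0\\ L\\ 0\end{pmatrix}\oplus\mathrm{span}\begin{pmatrix}0\\ 0\\ 1\end{pmatrix}$$ is a totally lightlike, $\nabla^{nc}$-parallel distribution of rank $k$ in $\mathcal{T}(U)$.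
   Context: Everything is smooth. A conformal manifold $(M,c)$ of signature $(p,q)$ is a manifold $M$ of dimension $n=p+q\ge 3$ with an equivalence class $c=[g]$ of pseudo-Riemannian metrics of signature $(p,q)$ differing by multiplication by positive functions. For $U\subset M$ open, $c_U$ is the conformal class on $U$ obtained by restricting $c$. $\nabla^g$ is the Levi-Civita connection; $Ric^g$ and $scal^g$ are the Ricci tensor and scalar curvature, and $Ric^g(TU)\subset L$ refers to the Ricci endomorphism $Ric^g:TU\to TU$. The Schouten tensor is $K^g:=\frac{1}{n-2}\left(\frac{scal^g}{2(n-1)}g-Ric^g\right)$, and $K^g(X)^\sharp$ is the vector dual to $K^g(X,\cdot)$. Standard tractor bundle. $\mathcal{T}(M)$ is the rank $n+2$ vector bundle associated to the normal conformal Cartan geometry of $(M,c)$ and the standard representation of $O(p+1,q+1)$ on $\mathbb{R}^{p+1,q+1}$, with its induced bundle metric $\langle\cdot,\cdot\rangle_{\mathcal{T}}$ of signature $(p+1,q+1)$ and metric connection $\nabla^{nc}$. Concretely, each $g\in c$ gives an isomorphism $\Phi^g:\mathcal{T}(M)\cong\underline{\mathbb{R}}\oplus TM\oplus\underline{\mathbb{R}}=:\mathcal{I}_-\oplus TM\oplus\mathcal{I}_+$ under which tractors are triples $(\alpha,Y,\beta)$ (written as columns), with $$\langle(\alpha_1,Y_1,\beta_1),(\alpha_2,Y_2,\beta_2)\rangle_{\mathcal{T}}=\alpha_1\beta_2+\alpha_2\beta_1+g(Y_1,Y_2),$$ $$\nabla^{nc}_X\begin{pmatrix}\alpha\\ Y\\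 \beta\end{pmatrix}=\begin{pmatrix}X(\alpha)+K^g(X,Y)\\ \nabla^g_XY+\alpha X-\beta K^g(X)^\sharp\\ X(\beta)-g(X,Y)\end{pmatrix},$$ and for $\widetilde{g}=e^{2\sigma}g$ the map $\Phi^{\widetilde{g}}\circ(\Phi^g)^{-1}$ is $$(\alpha,Y,\beta)\mapsto\left(e^{-\sigma}\left(\alpha-Y(\sigma)-\tfrac12\beta\|\mathrm{grad}^g\sigma\|_g^2\right),\ e^{-\sigma}(Y+\beta\,\mathrm{grad}^g\sigma),\ e^{\sigma}\beta\right).$$ The line bundle $\mathcal{I}_-=\{(\alpha,0,0)\}\subset\mathcal{T}(M)$ does not depend on $g\in c$; $\mathcal{I}_-^\perp=\{(\alpha,Y,0)\}$ is its orthogonal complement with respect to $\langle\cdot,\cdot\rangle_{\mathcal{T}}$. $\mathrm{pr}_{TM}$ is the projection $(\alpha,Y,\beta)\mapsto Y$ with respect to some $g\in c$; for a subset of $\mathcal{I}_-^\perp$ consisting of linear subspaces of the fibres its image in $TM$ is independent of $g$. A distribution (subbundle) is totally lightlike if the relevant metric vanishes identically on it; it is parallel if covariant derivatives of its sections in all directions are again sections of it. $Hol_x(U,g)$ is the holonomy group of $\nabla^g$ on $U$ at $x$. *)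

(* Defs.v *)
From HB Require Import structures.
From mathcomp Require Import all_boot all_order all_algebra.
From mathcomp Require Import all_classical all_reals all_analysis.

Set Implicit Arguments.
Unset Strict Implicit.
Unset Printing Implicit Defensive.

Import Order.TTheory GRing.Theory Num.Theory numFieldNormedType.Exports.

Local Open Scope classical_set_scope.
Local Open Scope ring_scope.

(* Conventions. Vectors are row vectors, linear maps act on the right, and a
   linear subspace is the row space of a square matrix.  A field on a manifold
   is the family of its component functions in the charts of the atlas; its
   values outside the domain of the chart are irrelevant. *)

Section Smoothness.
Context {R : realType}.

Definition basis_vec {n} (i : 'I_n) : 'rV[R]_n := delta_mx 0 i.

Fixpoint Ck_on {n} (k : nat) (V : set 'rV[R]_n) (f : 'rV[R]_n -> R) : Prop :=
  (forall x, V x -> {for x, continuous f}) /\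
  if k is k'.+1 then
    forall i : 'I_n,
      (forall x, V x -> derivable f x (basis_vec i)) /\
      Ck_on k' V (fun x => 'D_(basis_vec i) f x)
  else True.

Definition smooth_on {n} (V : set 'rV[R]_n) (f : 'rV[R]_n -> R) : Prop :=
  forall k, Ck_on k V f.

End Smoothness.

Record chart (R : realType) (n : nat) (M : topologicalType) := Chart {
  dom : set M;
  coo : M -> 'rV[R]_n;
  param : 'rV[R]_n -> M;
  dom_open : open dom;
  img_open : open (coo @` dom);
  cooK : forall x, dom x -> param (coo x) = x;
  coo_continuous : forall x, dom x -> {for x, continuous coo};
  param_continuous : forall y, (coo @` dom) y -> {for y, continuous param} }.

Record smoothManifold (R : realType) (n : nat) := SmoothManifold {
  points :> topologicalType;
  points_hausdorff : hausdorff_space points;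
  points_second_countable : @second_countable points;
  chart_index : Type;
  atlas : chart_index -> chart R n points;
  atlas_cover : forall x, exists a, dom (atlas a) x;
  atlas_smooth : forall (a b : chart_index) (j : 'I_n),
    smooth_on (coo (atlas a) @` (dom (atlas a) `&` dom (atlas b)))
      (fun y => coo (atlas b) (param (atlas a) y) 0 j) }.

Section Fields.
Context {R : realType} {n : nat} {M : smoothManifold R n}.
Implicit Types (a b : chart_index M) (x : M) (U W : set M) (v : 'rV[R]_n).

Definition cdom a : set M := dom (atlas a).
Definition ccoo a : M -> 'rV[R]_n := coo (atlas a).
Definition cparam a : 'rV[R]_n -> M := param (atlas a).

Definition smooth_in a W (f : M -> R) : Prop :=
  smooth_on (ccoo a @` W) (f \o cparam a).

Definition smooth_fun U (f : M -> R) : Prop :=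
  forall a, smooth_in a (U `&` cdom a) f.

Definition smooth_mx {r m} a W (F : M -> 'M[R]_(r, m)) : Prop :=
  forall i j, smooth_in a W (fun x => F x i j).

Definition dir a v (f : M -> R) x : R := 'D_v (f \o cparam a) (ccoo a x).

Definition pd a (i : 'I_n) (f : M -> R) x : R := dir a (basis_vec i) f x.

(* If v is a tangent vector at x in the chart a, then v *m jac a b x is the
   same tangent vector in the chart b. *)
Definition jac a b x : 'M[R]_n :=
  \matrix_(i, j) pd a i (fun y => ccoo b y 0 j) x.

(* A family S of subspaces of the fibres, in a bundle which is trivialised
   over the chart a with fibre 'rV_m, is a smooth subbundle of rank r. *)
Definition smooth_rank {m} a U (r : nat) (S : M -> 'M[R]_m) : Prop :=
  forall x, (U `&` cdom a) x ->
    exists W (F : M -> 'M[R]_(r, m)),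
      [/\ open W, W x, W `<=` U `&` cdom a, smooth_mx a W F &
          forall y, W y -> row_free (F y) /\ (F y :=: S y)%MS].

Definition parallel_in {m} a U (S : M -> 'M[R]_m)
    (nab : 'rV[R]_n -> (M -> 'rV[R]_m) -> M -> 'rV[R]_m) : Prop :=
  forall W (s : M -> 'rV[R]_m),
    open W -> W `<=` U `&` cdom a -> smooth_mx a W s ->
    (forall y, W y -> (s y <= S y)%MS) ->
    forall x v, W x -> (nab v s x <= S x)%MS.

(* Bilinear forms and subspace fields of TM, in components. *)
Definition tensor2 : Type := chart_index M -> M -> 'M[R]_n.

Definition tangent_distribution U (r : nat) (L : tensor2) : Prop :=
  (forall a b x, U x -> cdom a x -> cdom b x ->
     (L b x :=: L a x *m jac a b x)%MS) /\
  (forall a, smooth_rank a U r (L a)).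

(* Through every point of U passes an integral manifold, parametrised by an
   open neighbourhood of 0 in R^r. *)
Definition integrable_dist U (r : nat) (L : tensor2) : Prop :=
  forall x, U x ->
    exists a (D : set 'rV[R]_r) (f : 'rV[R]_r -> M),
      [/\ open D, D 0, f 0 = x,
          forall u, D u -> U (f u) /\ cdom a (f u) &
          (forall j, smooth_on D (fun u => ccoo a (f u) 0 j)) /\
          forall u, D u ->
            (\matrix_(i < r, j < n)
               'D_(basis_vec i) (fun w => ccoo a (f w) 0 j : R) u
             :=: L a (f u))%MS].

End Fields.

Arguments tensor2 {R n} M.

Section PseudoRiemannian.
Context {R : realType} {n : nat} {M : smoothManifold R n}.
Implicit Types (g h : tensor2 M) (a b : chart_index M) (x : M) (U : set M).

(* p is the number of negative directions. *)
Definition has_signature (p q : nat) (G : 'M[R]_n) : Prop :=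
  (p + q)%N = n /\
  exists2 P : 'M[R]_n, P \in unitmx &
    P *m G *m P^T = diag_mx (\row_i (if (i < p)%N then -1 else 1)).

Definition is_metric (p q : nat) U g : Prop :=
  [/\ forall a b x, U x -> cdom a x -> cdom b x ->
        g a x = jac a b x *m g b x *m (jac a b x)^T,
      forall a, smooth_mx a (U `&` cdom a) (g a),
      forall a x, U x -> cdom a x -> (g a x)^T = g a x &
      forall a x, U x -> cdom a x -> has_signature p q (g a x)].

Definition bform (G : 'M[R]_n) (v w : 'rV[R]_n) : R := (v *m G *m w^T) 0 0.

Definition lightlike (G L : 'M[R]_n) : Prop :=
  forall v w : 'rV[R]_n, (v <= L)%MS -> (w <= L)%MS -> bform G v w = 0.

Definition christoffel g a (i j l : 'I_n) x : R :=
  2^-1 * \sum_m invmx (g a x) l m *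
    (pd a i (fun y => g a y j m) x + pd a j (fun y => g a y i m) x
     - pd a m (fun y => g a y i j) x).

Definition nabla g a (v : 'rV[R]_n) (Y : M -> 'rV[R]_n) x : 'rV[R]_n :=
  \row_l (dir a v (fun y => Y y 0 l) x
          + \sum_i \sum_j v 0 i * Y x 0 j * christoffel g a i j l x).

(* riemann g a i j k l x is the l-th component of R(e_i, e_j) e_k, where
   R(X, Y) = [nabla_X, nabla_Y] - nabla_[X, Y]. *)
Definition riemann g a (i j k l : 'I_n) x : R :=
  pd a i (christoffel g a j k l) x - pd a j (christoffel g a i k l) x
  + \sum_m (christoffel g a j k m x * christoffel g a i m l x
            - christoffel g a i k m x * christoffel g a j m l x).

(* Ric(X, Y) = tr (Z |-> R(Z, X) Y), positive on round spheres. *)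
Definition ricci g a x : 'M[R]_n := \matrix_(i, j) \sum_l riemann g a l i j l x.

Definition scal g a x : R := \tr (invmx (g a x) *m ricci g a x).

Definition sharp g a x (w : 'rV[R]_n) : 'rV[R]_n := w *m invmx (g a x).

Definition ricci_endo g a x : 'M[R]_n := ricci g a x *m invmx (g a x).

Definition schouten g a x : 'M[R]_n :=
  (n%:R - 2)^-1 *: ((scal g a x / (2 * (n%:R - 1))) *: g a x - ricci g a x).

Definition grad g a (s : M -> R) x : 'rV[R]_n :=
  sharp g a x (\row_i pd a i s x).

Definition conf_class U g : set (tensor2 M) :=
  [set h | exists f : M -> R,
     [/\ smooth_fun U f, forall x, U x -> 0 < f x &
         forall a x, U x -> cdom a x -> h a x = f x *: g a x]].

Definition conformal_structure (p q : nat) (c : set (tensor2 M)) : Prop :=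
  exists2 g, is_metric p q setT g & c = conf_class setT g.

Definition restrict_class (c : set (tensor2 M)) U : set (tensor2 M) :=
  [set h | exists2 g, c g & conf_class U g h].

End PseudoRiemannian.

Section Tractors.
Context {R : realType} {n : nat}.

Definition tractor (al : R) (Y : 'rV[R]_n) (be : R) : 'rV[R]_(1 + n + 1) :=
  row_mx (row_mx al%:M Y) be%:M.

Definition tal (t : 'rV[R]_(1 + n + 1)) : R := lsubmx (lsubmx t) 0 0.
Definition tvec (t : 'rV[R]_(1 + n + 1)) : 'rV[R]_n := rsubmx (lsubmx t).
Definition tbe (t : 'rV[R]_(1 + n + 1)) : R := rsubmx t 0 0.

Definition tform (G : 'M[R]_n) (t1 t2 : 'rV[R]_(1 + n + 1)) : R :=
  tal t1 * tbe t2 + tal t2 * tbe t1 + bform G (tvec t1) (tvec t2).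

Definition tlightlike (G : 'M[R]_n) (H : 'M[R]_(1 + n + 1)) : Prop :=
  forall t1 t2 : 'rV[R]_(1 + n + 1),
    (t1 <= H)%MS -> (t2 <= H)%MS -> tform G t1 t2 = 0.

Definition I_minus : 'rV[R]_(1 + n + 1) := tractor 1 0 0.

Definition I_minus_perp (G : 'M[R]_n) : 'M[R]_(1 + n + 1) :=
  kermx (lin1_mx (fun t => (tform G t I_minus)%:M : 'rV[R]_1)).

Definition chart_change (J : 'M[R]_n) (t : 'rV[R]_(1 + n + 1)) :=
  tractor (tal t) (tvec t *m J) (tbe t).

Context {M : smoothManifold R n}.
Implicit Types (g : tensor2 M) (c : set (tensor2 M)) (a b : chart_index M) (x : M).

(* The transition from the splitting given by g to the one given by
   e^(2 s) g. *)
Definition gauge_change g a (s : M -> R) x (t : 'rV[R]_(1 + n + 1)) :=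
  let ds := grad g a s x in
  tractor
    (expR (- s x) * (tal t - dir a (tvec t) s x
                     - 2^-1 * tbe t * bform (g a x) ds ds))
    (expR (- s x) *: (tvec t + tbe t *: ds))
    (expR (s x) * tbe t).

Definition nabla_nc g a (v : 'rV[R]_n) (t : M -> 'rV[R]_(1 + n + 1)) x :=
  tractor
    (dir a v (tal \o t) x + bform (schouten g a x) v (tvec (t x)))
    (nabla g a v (tvec \o t) x + tal (t x) *: v
     - tbe (t x) *: sharp g a x (v *m schouten g a x))
    (dir a v (tbe \o t) x - bform (g a x) v (tvec (t x))).

(* The standard tractor bundle of c is glued from the bundles
   R (+) TM (+) R, one for every metric in c; accordingly, a subset of it
   which is a linear subspace in every fibre is a family H g a x of subspaces
   (g in c, x in the domain of the chart a) compatible with the transitions. *)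
Definition tractor_field : Type :=
  tensor2 M -> chart_index M -> M -> 'M[R]_(1 + n + 1).

Definition tractor_subspaces c (H : tractor_field) : Prop :=
  (forall g a b x, c g -> cdom a x -> cdom b x ->
     (H g b x :=: H g a x *m lin1_mx (chart_change (jac a b x)))%MS) /\
  (forall g h s, c g -> c h -> smooth_fun setT s ->
     (forall a x, cdom a x -> h a x = expR (2 * s x) *: g a x) ->
     forall a x, cdom a x ->
       (H h a x :=: H g a x *m lin1_mx (gauge_change g a s x))%MS).

Definition tractor_subbundle c (r : nat) (H : tractor_field) : Prop :=
  tractor_subspaces c H /\
  forall g a, c g -> smooth_rank a setT r (H g a).

Definition tractor_lightlike c (H : tractor_field) : Prop :=
  forall g a x, c g -> cdom a x -> tlightlike (g a x) (H g a x).

Definition tractor_parallel c (H : tractor_field) : Prop :=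
  forall g a, c g -> parallel_in a setT (H g a) (nabla_nc g a).

Definition pr_TM (H : tractor_field) g : tensor2 M :=
  fun a x => <<(H g a x :&: I_minus_perp (g a x))%MS *m lin1_mx tvec>>%MS.

End Tractors.

Arguments tractor_field {R n} M.

(* Main.v *)
(* Let H be totally lightlike and parallel of rank k.  On an open set where H
   lies in the orthogonal complement of I_-, the third and the second component
   of the parallelity equation kill every section of H, so the set where H has a
   section t = (alpha, Y, 1) is dense.  Near a point of that set the one-form
   -g(Y, .) is closed along the involutive distribution L^perp; a function s
   with ds = -g(Y, .) on L^perp makes Y + grad s a section of L, so that
   (0, 0, 1) lies in H in the splitting given by h = e^(2 s) g.
   Differentiating (0, 0, 1) and the sections (0, Z, 0) with nabla^nc shows that
   the Schouten endomorphism of h takes values in L and that L is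
   nabla^h-parallel.  That endomorphism is self-adjoint with lightlike
   image, hence nilpotent, so its trace vanishes; thus scal^h = 0 and Ric^h takes
   values in L.  A parallel distribution is involutive because nabla^h is torsion
   free.  Conversely, in the splitting of g the same nilpotency makes
   (0, L, 0) + (0, 0, 1) parallel, and nabla^nc is covariant under changes of the
   splitting.  Potentials and integral manifolds are produced by flowing along
   commuting fields x |-> w Pi(x), Pi being a projection onto the distribution
   along a fixed complement. *)
From HB Require Import structures.
Require Import Defs.
From mathcomp Require Import all_boot all_order all_algebra.
From mathcomp Require Import ring lra.
From mathcomp Require Import all_classical all_reals all_analysis.

Set Implicit Arguments.
Unset Strict Implicit.
Unset Printing Implicit Defensive.

Import Order.TTheory GRing.Theory Num.Theory numFieldNormedType.Exports.

Local Open Scope classical_set_scope.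
Local Open Scope ring_scope.

(** * Calculus on R^n *)

(** Every solution of a differential equation comes from one construction, the time-one flow near an
    equilibrium. The coefficient vector w of a field w Pi is made part of the state, with w' = 0:
    then (u0, 0) is an equilibrium, nearby solutions exist for the whole unit of time, and small w
    replaces short time. Differentiating such a flow doubles the dimension, which yields all orders
    of smoothness. A complement that does not vary with the point makes the fields w Pi commute:
    derivatives of Pi take values in the complement, while involutivity puts the bracket into the
    distribution. The linearised equation then has an explicit solution, from which both leaves and
    potentials are read off. Tractor subspaces are given in the splittings of all metrics of the
    class, so both directions need the covariance of nabla^nc, hence the transformation of the
    Schouten tensor and of the full Ricci tensor under e^(2 s). The rank of L drops by exactly one
    because an element (alpha, 0, 0) of H pairs to alpha with a section whose third component is
    1. *)

Section RowVectors.
Context {R : realType}.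

Lemma normv_le n (v : 'rV[R]_n) (c : R) :
  0 <= c -> (forall i, `|v 0 i| <= c) -> `|v| <= c.
Proof.
move=> c0 vc; rewrite [leLHS]/Num.norm /= mx_normrE; apply/bigmax_leP; split=> //.
by move=> [i j] _ /=; rewrite ord1.
Qed.

Lemma coord_le n (v : 'rV[R]_n) i : `|v 0 i| <= `|v|.
Proof.
rewrite [leRHS]/Num.norm /= mx_normrE.
by apply: (le_trans _ (le_bigmax _ _ (0, i))).
Qed.

Lemma normv_lt n (v : 'rV[R]_n) (c : R) :
  0 < c -> (forall i, `|v 0 i| < c) -> `|v| < c.
Proof.
move=> c0 vc; rewrite [ltLHS]/Num.norm /= mx_normrE; apply/bigmax_ltP; split=> //.
by move=> [i j] _ /=; rewrite ord1.
Qed.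

Lemma norm_basis_vec n (i : 'I_n) : `|basis_vec i : 'rV[R]_n| <= 1.
Proof.
apply: normv_le => // j; rewrite mxE eqxx /=.
by case: (j == i); rewrite ?normr1 ?normr0.
Qed.

Lemma cvg_coord (T : Type) (F : set_system T) n (f : T -> 'rV[R]_n) (l : 'rV[R]_n) :
  Filter F -> (forall i, (fun x => f x 0 i) @ F --> l 0 i) -> f @ F --> l.
Proof.
move=> FF fl; apply/cvgrPdist_lt => e e0.
suff: \forall x \near F, forall i, `|l 0 i - f x 0 i| < e.
  apply: filterS => x h; apply: normv_lt => // i; rewrite !mxE; exact: h.
apply: filter_forall => i.
by have /cvgrPdist_lt := fl i; exact.
Qed.

Lemma coord_cvg (T : Type) (F : set_system T) n (f : T -> 'rV[R]_n) (l : 'rV[R]_n) i :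
  Filter F -> f @ F --> l -> (fun x => f x 0 i) @ F --> l 0 i.
Proof.
move=> FF fl; apply: (cvg_comp (G := nbhs l) f (fun v : 'rV[R]_n => v 0 i)) => //.
exact: coord_continuous.
Qed.

Lemma cvg_sumr (T I : Type) (F : set_system T) (r : seq I) (P : pred I)
    (f : I -> T -> R) (l : I -> R) :
  Filter F -> (forall i, P i -> f i @ F --> l i) ->
  (fun x => \sum_(i <- r | P i) f i x) @ F --> \sum_(i <- r | P i) l i.
Proof.
move=> FF fl; elim: r => [|i r IH].
  under eq_fun do rewrite big_nil.
  by rewrite big_nil; exact: cvg_cst.
under eq_fun do rewrite big_cons.
rewrite big_cons; case: ifP => // Pi; apply: cvgD => //; exact: fl.
Qed.

Section Line.
Context {V W : normedModType R}.

Lemma is_derive_line (f : V -> W) (p v : V) (t : R) :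
  derivable f (p + t *: v) v ->
  is_derive t 1 (fun s : R => f (p + s *: v)) ('D_v f (p + t *: v)).
Proof.
have E : (fun h : R => h^-1 *: (((fun s : R => f (p + s *: v)) \o shift t) (h *: 1)
   - f (p + t *: v))) =
   (fun h : R => h^-1 *: ((f \o shift (p + t *: v)) (h *: v) - f (p + t *: v))).
  apply/funext => h /=; congr (_ *: (f _ - _)).
  by rewrite -[h%:A]/(h * 1) mulr1 scalerDl addrCA.
by move=> df; apply: DeriveDef; rewrite /derivable /derive E.
Qed.

End Line.

(** Differentiability is asked for on both sides of p, so that callers need not distinguish the sign
    of d. *)
Lemma MVT_line (V : normedModType R) (f : V -> R) (p v : V) (d : R) :
  (forall t : R, `|t| <= `|d| -> derivable f (p + t *: v) v) ->
  exists2 t : R, `|t| <= `|d| & f (p + d *: v) - f p = d * 'D_v f (p + t *: v).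
Proof.
move=> df.
pose g (s : R) := f (p + s *: v).
have dg (t : R) : `|t| <= `|d| -> is_derive t 1 g ('D_v f (p + t *: v)).
  by move=> td; exact: is_derive_line (df _ td).
have cg a b : (forall t, t \in `[a, b] -> `|t| <= `|d|) -> {within `[a, b], continuous g}.
  move=> h; apply: derivable_within_continuous => t /h td.
  by have /@ex_derive := dg _ td.
have g0 : g 0 = f p by rewrite /g scale0r addr0.
case: (ltrgtP d 0) => [dn|dp|d0].
- have h t : t \in `[d, 0] -> `|t| <= `|d|.
    by rewrite in_itv /= => /andP[t1 t2]; rewrite !ler0_norm // ?lerN2 // ltW.
  have [||t td E] := @MVT R g (fun t => 'D_v f (p + t *: v)) d 0 dn.
  + move=> x xd; apply: dg; apply: h; apply: subset_itv_oo_cc xd.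
  + exact: cg.
  exists t; first by apply: h; apply: subset_itv_oo_cc td.
  by move: E; rewrite g0 -/(g d) => E; rewrite -opprB E sub0r mulrN opprK mulrC.
- have h t : t \in `[0, d] -> `|t| <= `|d|.
    by rewrite in_itv /= => /andP[t1 t2]; rewrite !ger0_norm // ltW.
  have [||t td E] := @MVT R g (fun t => 'D_v f (p + t *: v)) 0 d dp.
  + move=> x xd; apply: dg; apply: h; apply: subset_itv_oo_cc xd.
  + exact: cg.
  exists t; first by apply: h; apply: subset_itv_oo_cc td.
  by move: E; rewrite g0 subr0 mulrC.
- by exists 0; rewrite ?normr0 // d0 scale0r addr0 subrr mul0r.
Qed.

End RowVectors.

(** * Continuous partial derivatives: the Frechet estimate and the chain rule *)

Section Frechet.
Context {R : realType}.

(** The corners of a path from x to y that changes one coordinate at a time. *)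
Definition hyb n (x y : 'rV[R]_n) (j : nat) : 'rV[R]_n :=
  \row_i (if (i < j)%N then y 0 i else x 0 i).

Lemma hybS n (x y : 'rV[R]_n) (j : 'I_n) :
  hyb x y j.+1 = hyb x y j + (y 0 j - x 0 j) *: basis_vec j.
Proof.
apply/rowP => i; rewrite !mxE eqxx /= ltnS leq_eqVlt.
have [->|ij] := eqVneq i j; first by rewrite eqxx ltnn /= mulr1 addrC subrK.
by rewrite -val_eqE in ij; rewrite (negbTE ij) /= mulr0 addr0.
Qed.

Lemma hyb_dist n (x y : 'rV[R]_n) (j : 'I_n) (t : R) : `|t| <= `|y 0 j - x 0 j| ->
  `|hyb x y j + t *: basis_vec j - x| <= `|y - x|.
Proof.
move=> tj; apply: normv_le => // i; rewrite !mxE eqxx /=.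
have [->|ij] := eqVneq i j.
  rewrite ltnn mulr1 addrAC subrr add0r (le_trans tj) //.
  by have := coord_le (y - x) j; rewrite !mxE.
rewrite mulr0 addr0; case: ifP => _.
  by have := coord_le (y - x) i; rewrite !mxE.
by rewrite subrr normr0.
Qed.

(* Telescoping along the coordinate directions. *)
Lemma C1_increment n (V : set 'rV[R]_n) (f : 'rV[R]_n -> R) (x : 'rV[R]_n) (r : R) :
  ball x r `<=` V ->
  (forall i y, V y -> derivable f y (basis_vec i)) ->
  forall y, `|y - x| < r ->
  exists xi : 'I_n -> 'rV[R]_n, (forall i, `|xi i - x| <= `|y - x|) /\
    f y - f x = \sum_i (y 0 i - x 0 i) * 'D_(basis_vec i) f (xi i).
Proof.
move=> bV df y yr.
have key (j : 'I_n) : exists z, `|z - x| <= `|y - x| /\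
    f (hyb x y j.+1) - f (hyb x y j) = (y 0 j - x 0 j) * 'D_(basis_vec j) f z.
  have [|t tj E] := @MVT_line R _ f (hyb x y j) (basis_vec j) (y 0 j - x 0 j).
    move=> t tj; apply: df; apply: bV; rewrite -ball_normE /ball_ /= distrC.
    exact: le_lt_trans (hyb_dist tj) yr.
  exists (hyb x y j + t *: basis_vec j); split; first exact: hyb_dist.
  by rewrite hybS E.
have [xi xiP] := @choice _ _ _ key.
exists xi; split=> [i|]; first by have [] := xiP i.
have -> : f y - f x = f (hyb x y n) - f (hyb x y 0).
  by congr (f _ - f _); apply/rowP => i; rewrite !mxE ?ltn_ord.
rewrite -(@telescope_sumr _ 0 n (fun j => f (hyb x y j))) // big_mkord; apply: eq_bigr => i _.
by have [] := xiP i.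
Qed.

Lemma C1_frechet n (V : set 'rV[R]_n) (f : 'rV[R]_n -> R) (x : 'rV[R]_n) :
  open V -> V x ->
  (forall i y, V y -> derivable f y (basis_vec i)) ->
  (forall i, {for x, continuous (fun y => 'D_(basis_vec i) f y)}) ->
  forall e : R, 0 < e -> \forall y \near x,
    `|f y - f x - \sum_i (y 0 i - x 0 i) * 'D_(basis_vec i) f x| <= e * `|y - x|.
Proof.
move=> oV Vx df cf e e0.
(* Each of the n coordinates gets the share e / (n + 1); the successor keeps the denominator nonzero
   when n = 0. *)
pose e' := e / (n.+1)%:R.
have e'0 : 0 < e' by rewrite divr_gt0.
have /nbhs_ballP[r r0 rV] : nbhs x V by exact: open_nbhs_nbhs.
have /nbhs_ballP[d d0 dD] : \forall y \near x,
    forall i, `|'D_(basis_vec i) f x - 'D_(basis_vec i) f y| < e'.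
  have FF := nbhs_filter x.
  apply: (@filter_forall _ _ (fun i y => `|'D_(basis_vec i) f x - 'D_(basis_vec i) f y| < e') _ FF) => i.
  by have /cvgrPdist_lt := cf i; exact.
near=> y.
have yr : `|y - x| < r.
  by near: y; apply: cvgr_distC_lt => //.
have yd : `|y - x| < d.
  by near: y; apply: cvgr_distC_lt => //.
have [xi [xi1 ->]] := C1_increment rV df yr.
rewrite -sumrB; apply: le_trans (ler_norm_sum _ _ _) _.
apply: (@le_trans _ _ (\sum_(i < n) e' * `|y - x|)).
  apply: ler_sum => i _; rewrite -mulrBr normrM mulrC.
  apply: ler_pM => //; last by have := coord_le (y - x) i; rewrite !mxE.
  rewrite distrC ltW //; apply: dD; rewrite -ball_normE /ball_ /= distrC.
  exact: le_lt_trans (xi1 i) yd.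
rewrite sumr_const card_ord -mulrnAl ler_wpM2r // /e' -mulr_natr -mulrA.
rewrite ler_piMr ?(ltW e0) // mulrC ler_pdivrMr // mul1r ler_nat //.
Unshelve. all: by end_near. Qed.

(** The inner map enters only through its difference quotient [q] in the direction v: phi (h v + x)
    = phi x + h q h with q h tending to dphi, and the Frechet estimate for f controls the
    remainder. *)
Lemma chain_rule (W : normedModType R) n (V : set 'rV[R]_n) (f : 'rV[R]_n -> R)
    (phi : W -> 'rV[R]_n) (x v : W) (dphi : 'rV[R]_n) :
  open V -> V (phi x) ->
  (forall i y, V y -> derivable f y (basis_vec i)) ->
  (forall i, {for phi x, continuous (fun y => 'D_(basis_vec i) f y)}) ->
  (forall i, is_derive x v (fun y => phi y 0 i) (dphi 0 i)) ->
  is_derive x v (f \o phi) (\sum_i dphi 0 i * 'D_(basis_vec i) f (phi x)).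
Proof.
move=> oV Vx df cf dp.
pose q (h : R) : 'rV[R]_n := h^-1 *: (phi (h *: v + x) - phi x).
have qcv : q @ 0^' --> dphi.
  apply: cvg_coord => i.
  have [d1 d2] := dp i.
  have : (fun h : R => h^-1 *: (((fun y => phi y 0 i) \o shift x) (h *: v) - phi x 0 i)) @ 0^'
     --> dphi 0 i.
    by rewrite -d2; exact: d1.
  apply: cvg_trans; apply: near_eq_cvg; near=> h.
  by rewrite /q !mxE.
have pcv : (fun h : R => phi (h *: v + x)) @ 0^' --> phi x.
  have -> : phi x = 0 *: dphi + phi x by rewrite scale0r add0r.
  have : (fun h : R => h *: q h + phi x) @ 0^' --> 0 *: dphi + phi x.
    apply: cvgD; last exact: cvg_cst.
    apply: cvgZ => //; exact: nbhs_dnbhs.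
  apply: cvg_trans; apply: near_eq_cvg; near=> h.
  have h0 : h != 0 by near: h; exact: nbhs_dnbhs_neq.
  by rewrite /q scalerA divff // scale1r subrK.
suff main : (fun h : R => h^-1 *: (((f \o phi) \o shift x) (h *: v) - (f \o phi) x)) @ 0^'
    --> \sum_i dphi 0 i * 'D_(basis_vec i) f (phi x).
  apply: DeriveDef; first by apply/cvg_ex; eexists; exact: main.
  exact: cvg_lim main.
apply: (@cvg_sub0 _ _ _ _ _ _ (fun h : R => \sum_i q h 0 i * 'D_(basis_vec i) f (phi x))); last first.
  apply: cvg_sumr => i _; apply: cvgM; last exact: cvg_cst.
  exact: coord_cvg.
apply/cvgr0Pnorm_le => e e0.
(* [q h] is eventually bounded by C, so a Frechet error of e / C times the increment stays below e
   after division by h. *)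
pose C := `|dphi| + 1.
have C0 : 0 < C by rewrite ltr_wpDl.
have eC0 : 0 < e / C by rewrite divr_gt0.
have fr := C1_frechet oV Vx df cf eC0.
near=> h.
have h0 : h != 0 by near: h; exact: nbhs_dnbhs_neq.
have qC : `|q h| <= C.
  near: h; apply: cvgr_norm_le qcv _ _; rewrite /C ltrDl //.
have := near fr; move=> /(_ (phi (h *: v + x))) H.
have {}H : `|f (phi (h *: v + x)) - f (phi x) -
   \sum_i (phi (h *: v + x) 0 i - phi x 0 i) * 'D_(basis_vec i) f (phi x)|
     <= e / C * `|phi (h *: v + x) - phi x|.
  near: h; exact: pcv fr.
have E : h^-1 *: (f (phi (h *: v + x)) - f (phi x)) -
   \sum_i q h 0 i * 'D_(basis_vec i) f (phi x) =
   h^-1 * (f (phi (h *: v + x)) - f (phi x) -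
   \sum_i (phi (h *: v + x) 0 i - phi x 0 i) * 'D_(basis_vec i) f (phi x)).
  rewrite mulrBr; congr (_ - _); rewrite mulr_sumr; apply: eq_bigr => i _.
  by rewrite /q !mxE mulrA.
rewrite -[X in `|X|]/(h^-1 *: (f (phi (h *: v + x)) - f (phi x)) -
   \sum_i q h 0 i * 'D_(basis_vec i) f (phi x)) E normrM.
have : `|h^-1| * (e / C * `|phi (h *: v + x) - phi x|) <= e.
  rewrite mulrCA -normrZ -/(q h) -mulrA ler_piMr ?(ltW e0) // mulrC ler_pdivrMr //.
  by rewrite mul1r.
by apply: le_trans; rewrite ler_wpM2l.
Unshelve. all: by end_near. Qed.

End Frechet.

(** * Closure of the classes C^k under algebraic operations, exp and ln *)

Section CkTheory.
Context {R : realType} {n : nat}.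
Implicit Types (V : set 'rV[R]_n) (f g : 'rV[R]_n -> R) (x : 'rV[R]_n).

Lemma open_near V x (P : 'rV[R]_n -> Prop) :
  open V -> V x -> (forall y, V y -> P y) -> \forall y \near x, P y.
Proof. by move=> oV Vx VP; apply: filterS VP _; exact: open_nbhs_nbhs. Qed.

Lemma eq_continuous_at f g x :
  (\forall y \near x, f y = g y) -> {for x, continuous f} -> {for x, continuous g}.
Proof.
move=> fg cf; have gx := nbhs_singleton fg.
rewrite /prop_for /continuous_at -gx.
exact: cvg_trans (near_eq_cvg fg) cf.
Qed.

Lemma Ck_on_eq k V f g :
  open V -> (forall x, V x -> f x = g x) -> Ck_on k V f -> Ck_on k V g.
Proof.
move=> oV; elim: k f g => [|k IH] f g fg [cf Df].
  by split=> // x Vx; apply: eq_continuous_at (cf x Vx); apply: open_near oV Vx _.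
split=> [x Vx|i].
  by apply: eq_continuous_at (cf x Vx); apply: open_near oV Vx _.
have [df Cf] := Df i; split.
  by move=> x Vx; apply: near_eq_derivable (df x Vx); apply: open_near oV Vx _.
apply: IH Cf => x Vx; apply: near_eq_derive; exact: open_near oV Vx _.
Qed.

Lemma Ck_on_sub k V V' f : V' `<=` V -> Ck_on k V f -> Ck_on k V' f.
Proof.
move=> VV; elim: k f => [|k IH] f [cf Df]; split=> //; try by move=> x /VV /cf.
move=> i; have [df Cf] := Df i; split; first by move=> x /VV /df.
exact: IH.
Qed.

Lemma Ck_onS k V f : Ck_on k.+1 V f -> Ck_on k V f.
Proof.
elim: k f => [|k IH] f [cf Df]; split=> // i.
by have [df Cf] := Df i; split=> //; exact: IH.
Qed.

Lemma Ck_on_cont k V f x : Ck_on k V f -> V x -> {for x, continuous f}.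
Proof. by case: k => [|k] [cf _] Vx; exact: cf. Qed.

Lemma Ck_on_derivable k V f x i :
  Ck_on k.+1 V f -> V x -> derivable f x (basis_vec i).
Proof. by move=> [_ /(_ i)[df _]] Vx; exact: df. Qed.

Lemma Ck_on_derive k V f i :
  Ck_on k.+1 V f -> Ck_on k V (fun x => 'D_(basis_vec i) f x).
Proof. by move=> [_ /(_ i)[]]. Qed.

Lemma Ck_on_cst k V (c : R) : Ck_on k V (fun=> c).
Proof.
elim: k c => [|k IH] c; split=> //; try by move=> x _; exact: (@cst_continuous _ _ c).
move=> i; split; first by move=> x _; exact: derivable_cst.
have -> : (fun x : 'rV[R]_n => 'D_(basis_vec i) (fun=> c) x) = fun=> 0.
  by apply/funext => x; exact: derive_cst.
exact: IH.
Qed.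

Lemma is_derive_coord (x v : 'rV[R]_n) j : is_derive x v (fun y => y 0 j) (v 0 j).
Proof.
have E : (fun h : R => h^-1 *: (((fun y : 'rV[R]_n => y 0 j) \o shift x) (h *: v) - x 0 j))
   @ 0^' --> (v 0 j : R).
  have : (fun=> v 0 j : R) @ (0:R)^' --> v 0 j by exact: cvg_cst.
  apply: cvg_trans; apply: near_eq_cvg; near=> h.
  have h0 : h != 0 by near: h; exact: nbhs_dnbhs_neq.
  by rewrite /= !mxE addrK /GRing.scale /= mulKf.
apply: DeriveDef; first by apply/cvg_ex; exists (v 0 j).
exact: cvg_lim E.
Unshelve. all: by end_near. Qed.

Lemma Ck_on_coord k V j : Ck_on k V (fun x => x 0 j).
Proof.
case: k => [|k]; split=> //; try by move=> x _; exact: coord_continuous.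
move=> i; split; first by move=> x _; have [] := is_derive_coord x (basis_vec i) j.
have -> : (fun x : 'rV[R]_n => 'D_(basis_vec i) (fun y : 'rV[R]_n => y 0 j : R) x) =
    fun=> basis_vec i 0 j.
  by apply/funext => x; have [_ ->] := is_derive_coord x (basis_vec i) j.
exact: Ck_on_cst.
Qed.

Lemma Ck_onD k V f g : open V -> Ck_on k V f -> Ck_on k V g ->
  Ck_on k V (fun x => f x + g x).
Proof.
move=> oV; elim: k f g => [|k IH] f g [cf Df] [cg Dg]; split=> //.
- by move=> x Vx; exact: continuousD (cf x Vx) (cg x Vx).
- by move=> x Vx; exact: continuousD (cf x Vx) (cg x Vx).
move=> i; have [df Cf] := Df i; have [dg Cg] := Dg i; split.
  by move=> x Vx; apply: derivableD; [exact: df | exact: dg].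
apply: (@Ck_on_eq _ _ (fun x => 'D_(basis_vec i) f x + 'D_(basis_vec i) g x)) => //.
  by move=> x Vx; rewrite -deriveD //; [exact: df | exact: dg].
exact: IH.
Qed.

Lemma Ck_onM k V f g : open V -> Ck_on k V f -> Ck_on k V g ->
  Ck_on k V (fun x => f x * g x).
Proof.
move=> oV; elim: k f g => [|k IH] f g Hf Hg.
  by split=> // x Vx; exact: continuousM (Ck_on_cont Hf Vx) (Ck_on_cont Hg Vx).
have [cf Df] := Hf; have [cg Dg] := Hg.
split; first by move=> x Vx; exact: continuousM (cf x Vx) (cg x Vx).
move=> i; have [df Cf] := Df i; have [dg Cg] := Dg i; split.
  by move=> x Vx; apply: derivableM; [exact: df | exact: dg].
apply: (@Ck_on_eq _ _ (fun x => f x * 'D_(basis_vec i) g x + g x * 'D_(basis_vec i) f x)) => //.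
  by move=> x Vx; rewrite -[RHS]/('D_(basis_vec i) (f * g) x) deriveM //; [exact: df | exact: dg].
by apply: Ck_onD => //; apply: IH => //; exact: Ck_onS.
Qed.

Lemma Ck_onN k V f : open V -> Ck_on k V f -> Ck_on k V (fun x => - f x).
Proof.
move=> oV Cf; apply: (@Ck_on_eq _ _ (fun x => -1 * f x)) => //.
  by move=> x _; rewrite mulN1r.
by apply: Ck_onM => //; exact: Ck_on_cst.
Qed.

Lemma Ck_on_sum k V (I : Type) (r : seq I) (P : pred I) (F : I -> 'rV[R]_n -> R) :
  open V -> (forall i, P i -> Ck_on k V (F i)) ->
  Ck_on k V (fun x => \sum_(i <- r | P i) F i x).
Proof.
move=> oV CF; elim: r => [|i r IH].
  under eq_fun do rewrite big_nil.
  exact: Ck_on_cst.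
under eq_fun do rewrite big_cons.
by case: (boolP (P i)) => // Pi; apply: Ck_onD => //; exact: CF.
Qed.

Lemma Ck_on_prod k V (I : Type) (r : seq I) (P : pred I) (F : I -> 'rV[R]_n -> R) :
  open V -> (forall i, P i -> Ck_on k V (F i)) ->
  Ck_on k V (fun x => \prod_(i <- r | P i) F i x).
Proof.
move=> oV CF; elim: r => [|i r IH].
  under eq_fun do rewrite big_nil.
  exact: Ck_on_cst.
under eq_fun do rewrite big_cons.
by case: (boolP (P i)) => // Pi; apply: Ck_onM => //; exact: CF.
Qed.

Lemma Ck_onV k V f : open V -> (forall x, V x -> f x != 0) ->
  Ck_on k V f -> Ck_on k V (fun x => (f x)^-1).
Proof.
move=> oV f0; elim: k => [|k IH] Hf.
  by split=> // x Vx; exact: continuousV (f0 x Vx) (Ck_on_cont Hf Vx).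
have [cf Df] := Hf; have Cf' := IH (Ck_onS Hf).
split; first by move=> x Vx; exact: continuousV (f0 x Vx) (cf x Vx).
move=> i; have [df Cf] := Df i; split.
  by move=> x Vx; apply: derivableV; [exact: f0 | exact: df].
apply: (@Ck_on_eq _ _ (fun x => - ((f x)^-1 * (f x)^-1) * 'D_(basis_vec i) f x)) => //.
  move=> x Vx; rewrite [RHS]deriveV; [|exact: f0 | exact: df].
  by rewrite -expr2 exprVn.
by apply: Ck_onM => //; apply: Ck_onN => //; exact: Ck_onM.
Qed.

Lemma is_derive_chain1 (h : R -> R) (dh : R) (f : 'rV[R]_n -> R) (u v : 'rV[R]_n) (df : R) :
  is_derive (f u) 1 h dh -> is_derive u v f df -> is_derive u v (h \o f) (dh * df).
Proof.
move=> Dh [d1 d2].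
have F (g : 'rV[R]_n -> R) :
   (fun s : R => s^-1 *: ((g \o shift u) (s *: v) - g u)) =
   (fun s : R => s^-1 *: (((fun t : R => g (t *: v + u)) \o shift 0) (s *: 1)
      - (fun t : R => g (t *: v + u)) 0)).
  by apply/funext => s /=; rewrite addr0 scale0r add0r [_%:A]mulr1.
have Df1 : is_derive (0 : R) (1 : R) (fun t : R => f (t *: v + u)) df.
  by apply: DeriveDef; [move/derivable1P: d1 | rewrite -d2 /derive F].
have Dh1 : is_derive (f (0 *: v + u)) 1 h dh by rewrite scale0r add0r.
have [e1 e2] := @is_derive1_comp _ h (fun t : R => f (t *: v + u)) 0 _ _ Dh1 Df1.
by apply: DeriveDef; [exact/derivable1P | rewrite /derive F; exact: e2].
Qed.

(** The derivative of h o f is (h' o f) times that of f, so regularity of order k reduces to lower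
    order regularity of h' o f. For exp this is the induction hypothesis, for ln it is the
    regularity of the inverse. *)
Lemma Ck_on_comp1 (h h' : R -> R) V f : open V ->
  (forall x, V x -> is_derive (f x) (1 : R) h (h' (f x))) ->
  forall k, (forall j, (j < k)%N -> Ck_on j V f -> Ck_on j V (h' \o f)) ->
  Ck_on k V f -> Ck_on k V (h \o f).
Proof.
move=> oV dh k IH Cf.
have dhf x : V x -> differentiable h (f x).
  by move=> Vx; apply/derivable1_diffP; have [] := dh x Vx.
have ch x : V x -> {for x, continuous (h \o f)}.
  move=> Vx; apply: continuous_comp; first exact: Ck_on_cont Cf Vx.
  exact/differentiable_continuous/dhf.
case: k IH Cf => [|k] IH Cf; split=> // i.
have dhfi x : V x -> is_derive x (basis_vec i) (h \o f) (h' (f x) * 'D_(basis_vec i) f x).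
  move=> Vx; apply: is_derive_chain1 (dh x Vx) _; apply: derivableP.
  exact: Ck_on_derivable Cf Vx.
split; first by move=> x /dhfi[].
apply: (@Ck_on_eq _ _ (fun x => h' (f x) * 'D_(basis_vec i) f x)) => //.
  by move=> x /dhfi[_ ->].
apply: Ck_onM => //; last exact: Ck_on_derive.
by apply: (IH k) => //; exact: Ck_onS.
Qed.

Lemma Ck_on_exp k V f : open V -> Ck_on k V f -> Ck_on k V (fun x => expR (f x)).
Proof.
move=> oV; elim/ltn_ind: k => k IH.
apply: (@Ck_on_comp1 expR expR) => // x _; exact: is_derive_expR.
Qed.

Lemma Ck_on_ln k V f : open V -> (forall x, V x -> 0 < f x) ->
  Ck_on k V f -> Ck_on k V (fun x => ln (f x)).
Proof.
move=> oV f0; apply: (@Ck_on_comp1 (@ln R) (@GRing.inv R) _ _ oV).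
  by move=> x Vx; exact: is_derive1_ln (f0 _ Vx).
by move=> j _; apply: Ck_onV => // x Vx; rewrite gt_eqF // f0.
Qed.

End CkTheory.

(** * Composition of C^k maps and symmetry of second derivatives *)

Section CkComp.
Context {R : realType}.

Lemma is_derive_C1 n k (V : set 'rV[R]_n) (f : 'rV[R]_n -> R) (x v : 'rV[R]_n) :
  open V -> V x -> Ck_on k.+1 V f ->
  is_derive x v f (\sum_i v 0 i * 'D_(basis_vec i) f x).
Proof.
move=> oV Vx Cf.
apply: (@chain_rule _ _ _ V f id x v v oV Vx) => //.
- by move=> i y Vy; exact: Ck_on_derivable Cf Vy.
- by move=> i; exact: Ck_on_cont (Ck_on_derive i Cf) Vx.
- by move=> i; exact: is_derive_coord.
Qed.

Lemma derive_C1 n k (V : set 'rV[R]_n) (f : 'rV[R]_n -> R) (x v : 'rV[R]_n) :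
  open V -> V x -> Ck_on k.+1 V f ->
  'D_v f x = \sum_i v 0 i * 'D_(basis_vec i) f x.
Proof. by move=> oV Vx Cf; have [_ ->] := is_derive_C1 v oV Vx Cf. Qed.

Lemma is_derive_comp_C1 (W : normedModType R) n k (V : set 'rV[R]_n) (f : 'rV[R]_n -> R)
    (phi : W -> 'rV[R]_n) (x v : W) (dphi : 'rV[R]_n) :
  open V -> V (phi x) -> Ck_on k.+1 V f ->
  (forall i, is_derive x v (fun y => phi y 0 i) (dphi 0 i)) ->
  is_derive x v (f \o phi) (\sum_i dphi 0 i * 'D_(basis_vec i) f (phi x)).
Proof.
move=> oV Vx Cf dphiP; apply: (chain_rule oV Vx _ _ dphiP).
- by move=> i y Vy; exact: Ck_on_derivable Cf Vy.
- by move=> i; exact: Ck_on_cont (Ck_on_derive i Cf) Vx.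
Qed.

Lemma Ck_on_comp n m k (V : set 'rV[R]_n) (W : set 'rV[R]_m)
    (f : 'rV[R]_n -> R) (phi : 'rV[R]_m -> 'rV[R]_n) :
  open V -> open W -> (forall x, W x -> V (phi x)) ->
  (forall j, Ck_on k W (fun x => phi x 0 j)) -> Ck_on k V f -> Ck_on k W (f \o phi).
Proof.
move=> oV oW WV; elim: k f => [|k IH] f Cphi Cf.
  split=> // x Wx; apply: continuous_comp.
    by apply: (@cvg_coord _ _ _ _ _ _ (nbhs_filter x)) => j; exact: Ck_on_cont (Cphi j) Wx.
  exact: Ck_on_cont Cf (WV _ Wx).
split=> [x Wx|i].
  apply: continuous_comp.
    by apply: (@cvg_coord _ _ _ _ _ _ (nbhs_filter x)) => j; exact: Ck_on_cont (Cphi j) Wx.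
  exact: Ck_on_cont Cf (WV _ Wx).
have D x : W x -> is_derive x (basis_vec i) (f \o phi)
    (\sum_j 'D_(basis_vec i) (fun y => phi y 0 j) x * 'D_(basis_vec j) f (phi x)).
  move=> Wx.
  have := @is_derive_comp_C1 _ n k V f phi x (basis_vec i)
     (\row_j 'D_(basis_vec i) (fun y => phi y 0 j) x) oV (WV x Wx) Cf.
  under eq_bigr do rewrite mxE.
  apply=> j; rewrite mxE; apply: derivableP; exact: Ck_on_derivable (Cphi j) Wx.
split; first by move=> x /D[].
apply: (@Ck_on_eq _ _ _ _ (fun x => \sum_j 'D_(basis_vec i) (fun y => phi y 0 j) x
    * 'D_(basis_vec j) f (phi x))) => //.
  by move=> x /D[_ ->].
apply: Ck_on_sum => // j _; apply: Ck_onM => //; first exact: Ck_on_derive.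
apply: (IH (fun z => 'D_(basis_vec j) f z)); last exact: Ck_on_derive.
by move=> l; exact: Ck_onS.
Qed.

Lemma is_derive_translate (U : normedModType R) (f : U -> R) (x c v : U) :
  derivable f (x + c) v -> is_derive x v (fun y => f (y + c)) ('D_v f (x + c)).
Proof.
have E : (fun h : R => h^-1 *: (((fun y => f (y + c)) \o shift x) (h *: v) - f (x + c)))
  = (fun h : R => h^-1 *: ((f \o shift (x + c)) (h *: v) - f (x + c))).
  by apply/funext => h /=; rewrite addrA.
by move=> df; apply: DeriveDef; rewrite /derivable /derive E.
Qed.

(** The mean value theorem is applied in the direction i to the increment of f in the direction j,
    then in the direction j to the partial derivative thus obtained. *)
Lemma second_difference n (V : set 'rV[R]_n) (f : 'rV[R]_n -> R) (x : 'rV[R]_n) (r : R) i j :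
  ball x r `<=` V -> Ck_on 2 V f -> forall h : R, `|h| + `|h| < r ->
  exists2 y, `|y - x| <= `|h| + `|h| &
    f (x + h *: basis_vec i + h *: basis_vec j) - f (x + h *: basis_vec i)
    - (f (x + h *: basis_vec j) - f x)
    = h * (h * 'D_(basis_vec j) (fun z => 'D_(basis_vec i) f z) y).
Proof.
move=> rV Cf h hr.
have inV (s t : R) : `|s| <= `|h| -> `|t| <= `|h| ->
    `|x + s *: basis_vec i + t *: basis_vec j - x| <= `|h| + `|h|.
  move=> sh th; rewrite [X in `|X|](_ : _ = s *: basis_vec i + t *: basis_vec j); last first.
    by apply/rowP => l; rewrite !mxE; ring.
  apply: le_trans (ler_normD _ _) _; apply: lerD; rewrite normrZ.
    by apply: le_trans sh; rewrite ler_piMr // norm_basis_vec.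
  by apply: le_trans th; rewrite ler_piMr // norm_basis_vec.
have inV' (s t : R) : `|s| <= `|h| -> `|t| <= `|h| ->
    V (x + s *: basis_vec i + t *: basis_vec j).
  move=> sh th; apply: rV; rewrite -ball_normE /ball_ /= distrC.
  exact: le_lt_trans (inV _ _ sh th) hr.
pose g y := f (y + h *: basis_vec j) - f y.
have dg (t : R) : `|t| <= `|h| -> is_derive (x + t *: basis_vec i) (basis_vec i) g
   ('D_(basis_vec i) f (x + t *: basis_vec i + h *: basis_vec j)
     - 'D_(basis_vec i) f (x + t *: basis_vec i)).
  move=> th; apply: is_deriveB.
    by apply: is_derive_translate; apply: Ck_on_derivable Cf _; exact: inV'.
  apply: derivableP; apply: Ck_on_derivable Cf _.
  by have := inV' t 0 th; rewrite scale0r addr0 normr0; exact.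
have [t th|t th] := @MVT_line R _ g x (basis_vec i) h.
  by have [] := dg t th.
rewrite /g => ->; have [_ ->] := dg t th.
have [s sh|s sh E] := @MVT_line R _ (fun z => 'D_(basis_vec i) f z)
   (x + t *: basis_vec i) (basis_vec j) h.
  by apply: Ck_on_derivable (Ck_on_derive i Cf) _; exact: inV'.
exists (x + t *: basis_vec i + s *: basis_vec j); first exact: inV.
by rewrite E.
Qed.

Lemma common_approx_eq (a b : R) :
  (forall e : R, 0 < e -> exists c, `|a - c| < e /\ `|b - c| < e) -> a = b.
Proof.
move=> H; apply/eqP; rewrite -subr_eq0 -normr_eq0; apply/negPn/negP => ab.
have ab0 : 0 < `|a - b| / 2 by rewrite divr_gt0 // lt_def ab normr_ge0.
have [c [H1 H2]] := H _ ab0.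
have : `|a - b| < `|a - b| / 2 + `|a - b| / 2.
  by apply: le_lt_trans (ltrD H1 H2); rewrite [`|b - c|]distrC; exact: ler_distD.
by rewrite -splitr ltxx.
Qed.

(** The second difference is symmetric in i and j, so the two mixed derivatives take a common value
    at two points near x; by continuity this value approximates both derivatives at x. *)
Lemma Schwarz n (V : set 'rV[R]_n) (f : 'rV[R]_n -> R) (x : 'rV[R]_n) i j :
  open V -> V x -> Ck_on 2 V f ->
  'D_(basis_vec j) (fun z => 'D_(basis_vec i) f z) x =
  'D_(basis_vec i) (fun z => 'D_(basis_vec j) f z) x.
Proof.
move=> oV Vx Cf; apply: common_approx_eq => e e0.
have cont (l m : 'I_n) :
    {for x, continuous (fun y => 'D_(basis_vec m) (fun z => 'D_(basis_vec l) f z) y)}.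
  exact: Ck_on_cont (Ck_on_derive m (Ck_on_derive l Cf)) Vx.
have /nbhs_ballP[r /= r0 rV] : nbhs x V by exact: open_nbhs_nbhs.
have /cvgrPdist_lt/(_ _ e0)/nbhs_ballP[d1 /= d10 D1] := cont i j.
have /cvgrPdist_lt/(_ _ e0)/nbhs_ballP[d2 /= d20 D2] := cont j i.
have [m m0 [mr md1 md2]] : exists2 m : R, 0 < m & [/\ m <= r, m <= d1 & m <= d2].
  exists (Num.min r (Num.min d1 d2)); first by rewrite !lt_min r0 d10 d20.
  by rewrite !ge_min !lexx !orbT.
have [h h0 hm] : exists2 h : R, 0 < h & `|h| + `|h| < m.
  have m30 : 0 < m / 3 by rewrite divr_gt0.
  by exists (m / 3) => //; rewrite gtr0_norm //; lra.
have [y yx E1] := second_difference i j rV Cf (lt_le_trans hm mr).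
have [z zx E2] := second_difference j i rV Cf (lt_le_trans hm mr).
have E : 'D_(basis_vec j) (fun z => 'D_(basis_vec i) f z) y =
         'D_(basis_vec i) (fun z => 'D_(basis_vec j) f z) z.
  apply: (mulfI (lt0r_neq0 h0)); apply: (mulfI (lt0r_neq0 h0)).
  rewrite -E1.
  rewrite -E2.
  rewrite [x + h *: basis_vec j + _]addrAC.
  move: (f _) (f _) (f _) (f _) => A B C D.
  ring.
exists ('D_(basis_vec i) (fun z => 'D_(basis_vec j) f z) z); split; last first.
  apply: D2; rewrite -ball_normE /ball_ /= distrC (le_lt_trans zx) //.
  exact: lt_le_trans hm md2.
rewrite -E; apply: D1; rewrite -ball_normE /ball_ /= distrC (le_lt_trans yx) //.
exact: lt_le_trans hm md1.
Qed.

End CkComp.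

(** * Flows of ordinary differential equations *)

Section Clip.
Context {R : realType}.
Implicit Types (a b s t : R).

(** The retraction of the line onto [a, b]. It extends paths from the unit interval to the whole
    line by constants, and it makes a field on a box globally Lipschitz. *)
Definition clip a b t := Num.max a (Num.min t b).

Lemma clip_in a b t : a <= b -> a <= clip a b t <= b.
Proof. by move=> ab; rewrite /clip le_max lexx /= ge_max ab ge_min lexx orbT. Qed.

Lemma clip_id a b t : a <= t <= b -> clip a b t = t.
Proof. by move=> /andP[at_ tb]; rewrite /clip (min_idPl tb) (max_idPr at_). Qed.

Lemma clip_lip a b s t : `|clip a b s - clip a b t| <= `|s - t|.
Proof.
wlog st : s t / t <= s.
  by move=> H; case: (leP t s) => [/H//|/ltW/H]; rewrite distrC [leRHS]distrC.
rewrite [leRHS]ger0_norm ?subr_ge0 //.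
rewrite /clip /Num.max /Num.min.
by repeat case: ifPn; rewrite -?leNgt => *; rewrite ler_norml; apply/andP; split; lra.
Qed.

Lemma lipschitz_continuous (V : normedModType R) (f : V -> R) (C : R) :
  (forall s t : V, `|f s - f t| <= C * `|s - t|) -> continuous f.
Proof.
move=> fl s; apply/cvgrPdist_lt => e e0.
have C0 : 0 < `|C| + 1 by rewrite ltr_wpDl.
near=> t; apply: le_lt_trans (fl _ _) _.
apply: (@le_lt_trans _ _ ((`|C| + 1) * `|s - t|)).
  by rewrite ler_wpM2r // (le_trans (ler_norm C)) // lerDl.
rewrite mulrC -ltr_pdivlMr //; near: t; apply: cvgr_dist_lt => //.
by rewrite divr_gt0.
Unshelve. all: by end_near. Qed.

Lemma clip_continuous a b : continuous (clip a b).
Proof. by apply: (@lipschitz_continuous _ _ 1) => s t; rewrite mul1r; exact: clip_lip. Qed.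

End Clip.

(** * Paths on the unit interval: primitives, comparison and the Gronwall inequality *)

Section Curves.
Context {R : realType}.
Implicit Types (s t : R).

Local Notation clamp := (clip (0 : R) 1).

Lemma clamp_in t : 0 <= clamp t <= 1. Proof. exact: clip_in. Qed.

Lemma clampK t : clamp (clamp t) = clamp t.
Proof. by apply: clip_id; exact: clamp_in. Qed.

(** The integral of f from 0 to the clamped s, written as a difference of integrals from -1 so that
    every s in [0, 1] is interior to the interval on which the fundamental theorem is applied. *)
Definition prim (f : R -> R) (s : R) : R :=
  parameterized_integral lebesgue_measure (-1) (clamp s) f
  - parameterized_integral lebesgue_measure (-1) 0 f.

Lemma prim0 f : prim f 0 = 0.
Proof. by rewrite /prim clip_id ?subrr // lexx ler01. Qed.

Lemma primK f s : prim f (clamp s) = prim f s.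
Proof. by rewrite /prim clampK. Qed.

Lemma is_derive_prim_ext (f : R -> R) s : continuous f -> 0 <= s <= 1 ->
  is_derive s 1 (fun t : R => parameterized_integral lebesgue_measure (-1) t f) (f s).
Proof.
move=> cf /andP[s0 s1].
have s2 : s < 2 by apply: le_lt_trans s1 _; rewrite ltr1n.
have [||d1 d2] := @continuous_FTC1_closed R f (-1) s 2 s2 _ _ (cf s).
- apply: continuous_compact_integrable; first exact: segment_compact.
  by apply: continuous_subspaceT => x; exact: cf.
- by apply: lt_le_trans s0; rewrite oppr_lt0.
apply: (@DeriveDef _ _ _ _ _
  (fun t : R => parameterized_integral lebesgue_measure (-1) t f) _ d1).
by rewrite -[RHS]d2 derive1E.
Qed.

Lemma prim_continuous (f : R -> R) : continuous f -> continuous (prim f).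
Proof.
move=> cf s; apply: (@continuousB _ _ _ (fun s => parameterized_integral lebesgue_measure (-1) (clamp s) f) (cst _)); last exact: cst_continuous.
apply: (@continuous_comp _ _ _ (clip 0 1)
  (fun t : R => parameterized_integral lebesgue_measure (-1) t f)).
  exact: clip_continuous.
have [d _] := is_derive_prim_ext cf (clamp_in s).
exact/differentiable_continuous/derivable1_diffP.
Qed.

Lemma near_clamp s : 0 < s < 1 -> \forall t \near s, clamp t = t.
Proof.
move=> /andP[s0 s1]; near=> t; apply: clip_id; apply/andP; split.
  by apply: ltW; near: t; exact: lt_nbhsr.
by apply: ltW; near: t; exact: lt_nbhsl.
Unshelve. all: by end_near. Qed.

Lemma is_derive_prim (f : R -> R) s : continuous f -> 0 < s < 1 -> is_derive s 1 (prim f) (f s).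
Proof.
move=> cf s01; have /andP[s0 s1] := s01.
have := is_derive_prim_ext cf (_ : 0 <= s <= 1); rewrite !ltW // => /(_ isT) D.
apply: (near_eq_is_derive
   (f := (fun t : R => parameterized_integral lebesgue_measure (-1) t f)
     - cst (parameterized_integral lebesgue_measure (-1) 0 f))).
  by near=> t; rewrite /prim (near (near_clamp s01)).
by rewrite -[f s]subr0; apply: is_deriveB.
Unshelve. all: by end_near. Qed.

(** The derivative is prescribed on the open interval only, because a clamped path may have a corner
    at 0 and at 1; continuity on the whole line bridges the end points. *)
Definition is_curve n (y y' : R -> 'rV[R]_n) :=
  (forall i, continuous (fun s => y s 0 i)) /\
  forall s, 0 < s < 1 -> forall i, is_derive s 1 (fun t => y t 0 i) (y' s 0 i).

Lemma is_derive_mull (k : R) t : is_derive t 1 (fun t : R => k * t) k.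
Proof.
have := @is_deriveZ _ _ _ id k t 1 _ (is_derive_id t 1).
by rewrite [k *: 1](mulr1 k).
Qed.

Lemma curve_le (f f' c c' : R -> R) : continuous f -> continuous c ->
  (forall s : R, 0 < s < 1 -> is_derive s 1 f (f' s)) ->
  (forall s : R, 0 < s < 1 -> is_derive s 1 c (c' s)) ->
  (forall s, 0 < s < 1 -> f' s <= c' s) -> f 0 <= c 0 ->
  forall s, 0 <= s <= 1 -> f s <= c s.
Proof.
move=> cf cc df dc fc' fc0 s /andP[]; rewrite le_eqVlt => /predU1P[<-//|s0] s1.
have D (t : R) : t \in `]0, s[ -> is_derive t 1 (c - f) (c' t - f' t).
  rewrite in_itv /= => /andP[t0 ts].
  by apply: is_deriveB; [apply: dc|apply: df]; rewrite t0 (lt_le_trans ts).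
have [|t] := @MVT R (c - f) (fun t => c' t - f' t) 0 s s0 D.
  by apply: continuous_subspaceT => x; exact: continuousB (cc x) (cf x).
rewrite in_itv /= => /andP[t0 ts] E.
have : 0 <= (c - f) s - (c - f) 0.
  by rewrite E mulr_ge0 ?subr_ge0 // ?(ltW s0) // fc' // t0 (lt_le_trans ts).
rewrite -![(c - f) _]/(c _ - f _); lra.
Qed.

(** The sup norm is not differentiable, so the comparison is made for every coordinate and for its
    negative. *)
Lemma curve_norm_le n (y y' : R -> 'rV[R]_n) (c c' : R -> R) :
  is_curve y y' -> continuous c ->
  (forall s : R, 0 < s < 1 -> is_derive s 1 c (c' s)) ->
  (forall s, 0 < s < 1 -> `|y' s| <= c' s) -> `|y 0| <= c 0 ->
  forall s, 0 <= s <= 1 -> `|y s| <= c s.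
Proof.
move=> [cy dy] cc dc yc y0 s s01.
have le i : `|y s 0 i| <= c s.
  rewrite ler_norml; apply/andP; split; last first.
    apply: (curve_le (cy i) cc (fun s s01 => dy s s01 i) dc) s01 => [t t01|].
      by apply: le_trans (yc t t01); apply: le_trans (ler_norm _) _; exact: coord_le.
    by apply: le_trans y0; apply: le_trans (ler_norm _) _; exact: coord_le.
  rewrite lerNl.
  apply: (curve_le (f := fun s => - y s 0 i) (f' := fun s => - y' s 0 i) _ cc _ dc) s01.
  - by move=> t; apply: continuousN; exact: cy.
  - by move=> t t01; have := dy t t01 i => ?; exact: is_deriveN.
  - move=> t t01; apply: le_trans (yc t t01).
    by apply: le_trans (ler_norm _) _; rewrite normrN; exact: coord_le.
  - apply: le_trans y0.
    by apply: le_trans (ler_norm _) _; rewrite normrN; exact: coord_le.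
apply: normv_le => //.
(* The norm bound also asks for [0 <= c s]; it holds because c starts nonnegative and its derivative
   dominates a norm. *)
apply: le_trans (normr_ge0 (y 0)) _; apply: (le_trans y0).
apply: (curve_le (f := fun=> c 0) (f' := fun=> 0) _ cc _ dc _ _ s01) => //.
- by move=> t; exact: cst_continuous.
- by move=> t t01; apply: le_trans (yc t t01).
Qed.

Lemma coord_continuousB n (y z : R -> 'rV[R]_n) :
  (forall i, continuous (fun s => y s 0 i)) -> (forall i, continuous (fun s => z s 0 i)) ->
  forall i, continuous (fun s => (y s - z s) 0 i).
Proof.
move=> cy cz i s.
have -> : (fun s => (y s - z s) 0 i) = (fun s => y s 0 i) - (fun s => z s 0 i).
  by apply/funext => t; rewrite !mxE.
exact: continuousB (cy i s) (cz i s).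
Qed.

Lemma is_curveB n (y y' z z' : R -> 'rV[R]_n) :
  is_curve y y' -> is_curve z z' ->
  is_curve (fun s => y s - z s) (fun s => y' s - z' s).
Proof.
move=> [cy dy] [cz dz]; split=> [|s s01 i]; first exact: coord_continuousB.
have -> : (fun s => (y s - z s) 0 i) = (fun s => y s 0 i) - (fun s => z s 0 i).
  by apply/funext => t; rewrite !mxE.
by rewrite !mxE; have := dy s s01 i; have := dz s s01 i => ? ?; exact: is_deriveB.
Qed.

Lemma is_curveZ n (a : R) (y y' : R -> 'rV[R]_n) :
  is_curve y y' -> is_curve (fun s => a *: y s) (fun s => a *: y' s).
Proof.
move=> [cy dy]; split=> [i s|s s01 i].
  have -> : (fun s => (a *: y s) 0 i) = (fun s => a * y s 0 i).
    by apply/funext => t; rewrite !mxE.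
  exact: continuousM (@cst_continuous R R a s) (cy i s).
have -> : (fun s => (a *: y s) 0 i) = a \*: (fun s => y s 0 i).
  by apply/funext => t; rewrite !mxE.
by rewrite !mxE; have := dy s s01 i => ?; exact: is_deriveZ.
Qed.

Lemma sqr_norm_le n (v : 'rV[R]_n) : `|v| ^+ 2 <= \sum_i v 0 i ^+ 2.
Proof.
have s0 : 0 <= \sum_i v 0 i ^+ 2 by apply: sumr_ge0 => i _; exact: sqr_ge0.
rewrite -[leRHS]sqr_sqrtr // ler_pXn2r ?nnegrE ?sqrtr_ge0 //.
apply: normv_le; first exact: sqrtr_ge0.
move=> i; rewrite -sqrtr_sqr ler_sqrt // (bigD1 i) //= lerDl.
by apply: sumr_ge0 => j _; exact: sqr_ge0.
Qed.

(** The exponential is the square root of the growth factor exp (2 n (K + 1)) of the energy in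
    [gronwall]; the factor n + 1 pays for the passage between the sup norm and the sum of
    squares. *)
Definition gronwall_cst (n : nat) (K : R) : R := n.+1%:R * expR (n%:R * (K + 1)).

Lemma gronwall_cst_gt0 n K : 0 < gronwall_cst n K.
Proof. by rewrite mulr_gt0 // expR_gt0. Qed.

(** The energy E, the sum of the squared coordinates plus the square of b, is differentiable where
    the sup norm is not. The summand from b makes the inequality homogeneous, E' <= C E, so that E
    exp (- C s) never exceeds its value at 0. *)
Lemma gronwall n (y y' : R -> 'rV[R]_n) (K b : R) :
  is_curve y y' -> 0 <= K -> 0 <= b ->
  (forall s, 0 < s < 1 -> `|y' s| <= K * `|y s| + b) ->
  forall s, 0 <= s <= 1 -> `|y s| <= gronwall_cst n K * (`|y 0| + b).
Proof.
move=> [cy dy] K0 b0 yK s s01.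
pose C : R := 2 * (n%:R * (K + 1)).
have C0 : 0 <= C by rewrite !mulr_ge0 ?addr_ge0.
pose E s := \sum_i y s 0 i ^+ 2 + b ^+ 2.
pose dE s := \sum_i y s 0 i * y' s 0 i *+ 2.
have E0 t : 0 <= E t by rewrite addr_ge0 ?sqr_ge0 // sumr_ge0 // => i _; exact: sqr_ge0.
have cE : continuous E.
  have c1 : continuous (fun t => \sum_i y t 0 i ^+ 2).
    move=> t; apply: (@cvg_sumr R _ _ _ _ _ _ _ (nbhs_filter t)) => i _.
    exact: continuousM (cy i t) (cy i t).
  by move=> t; exact: continuousD (c1 t) (@cst_continuous R R (b ^+ 2) t).
have DE (t : R) : 0 < t < 1 -> is_derive t 1 E (dE t).
  move=> t01; rewrite -[dE t]addr0; apply: is_deriveD.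
  have -> : (fun t => \sum_i y t 0 i ^+ 2) = \sum_i (fun t => y t 0 i) ^+ 2.
    by apply/funext => u; rewrite fct_sumE.
  apply: is_derive_sum => i; have D := dy t t01 i.
  have := @is_deriveX _ _ _ 2 _ _ _ D.
  by rewrite /= expr1 /GRing.scale /= -mulrA mulr_natl.
have le1 t : 0 < t < 1 -> dE t <= C * E t.
  move=> t01; pose m := `|y t|.
  have m0 : 0 <= m by rewrite /m normr_ge0.
  have mE : m ^+ 2 + b ^+ 2 <= E t by rewrite lerD2r; exact: sqr_norm_le.
  apply: (@le_trans _ _ (\sum_(i < n) 2 * ((K + 1) * E t))).
    apply: ler_sum => i _; rewrite -mulr_natl ler_wpM2l //.
    apply: le_trans (ler_norm _) _; rewrite normrM.
    apply: (@le_trans _ _ (m * (K * m + b))).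
      apply: ler_pM => //; first exact: coord_le.
      by apply: le_trans (yK t t01); exact: coord_le.
    apply: (@le_trans _ _ ((K + 1) * (m ^+ 2 + b ^+ 2))); last first.
      by apply: ler_wpM2l mE; rewrite addr_ge0.
    have : 0 <= (m - b) ^+ 2 by exact: sqr_ge0.
    have : 0 <= K * b ^+ 2 by rewrite mulr_ge0 ?sqr_ge0.
    have : 0 <= b ^+ 2 by exact: sqr_ge0.
    have : 0 <= m ^+ 2 by exact: sqr_ge0.
    by rewrite !expr2; nra.
  rewrite sumr_const card_ord -[leLHS]mulr_natl /C.
    by move: (n%:R : R) (E t) => p e; rewrite (_ : p * _ = 2 * (p * (K + 1)) * e) //; ring.
have key : E s * expR (- C * s) <= E 0.
  apply: (curve_le (f := fun t => E t * expR (- C * t))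
     (f' := fun t => E t *: (expR (- C * t) * (- C)) + expR (- C * t) *: dE t)
     (c := fun=> E 0) (c' := fun=> 0) _ _ _ _ _ _ s01).
  - have ce : continuous (fun t : R => expR (- C * t)).
      move=> t; apply: continuous_comp; last exact: continuous_expR.
      by have [d _] := is_derive_mull (- C) t; exact/differentiable_continuous/derivable1_diffP.
    by move=> t; exact: continuousM (cE t) (ce t).
  - by move=> t; exact: cst_continuous.
  - move=> t t01; have D1 := DE t t01.
    have D2 : is_derive t 1 (fun t => expR (- C * t)) (expR (- C * t) * (- C)).
      apply: (@is_derive1_comp _ expR (fun t => - C * t)).
      exact: is_derive_mull.
    exact: is_deriveM.
  - move=> t t01; have := le1 t t01; have := expR_gt0 (- C * t).
    rewrite /GRing.scale /=; move: (expR _) (E t) (dE t) => e x z e0 xz.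
    by rewrite (_ : _ + _ = - (e * (C * x - z))); [rewrite oppr_le0 mulr_ge0 ?subr_ge0 // ltW|ring].
  - by rewrite mulr0 expR0 mulr1.
have : E s <= E 0 * expR C.
  have /andP[s0 s1] := s01.
  have : E s <= E 0 * expR (C * s).
    by rewrite -ler_pdivrMr ?expR_gt0 // -expRN -mulNr.
  move/le_trans; apply; apply: ler_wpM2l; first exact: E0.
  by rewrite ler_expR ler_piMr.
move=> Es.
have G0 := gronwall_cst_gt0 n K.
rewrite -(@ler_pXn2r _ 2) ?nnegrE ?mulr_ge0 ?addr_ge0 ?(ltW G0) //.
apply: le_trans (sqr_norm_le _) _.
apply: (@le_trans _ _ (E s)); first by rewrite lerDl sqr_ge0.
apply: (le_trans Es).
rewrite /gronwall_cst !exprMn -expRM_natl -/C mulrAC.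
apply: ler_wpM2r; first by rewrite ltW ?expR_gt0.
have E00 : E 0 <= n%:R * `|y 0| ^+ 2 + b ^+ 2.
  rewrite lerD2r; apply: (@le_trans _ _ (\sum_(i < n) `|y 0| ^+ 2)).
    by apply: ler_sum => i _; rewrite -[leLHS]real_normK ?num_real // ler_pXn2r ?nnegrE // coord_le.
  by rewrite sumr_const card_ord mulr_natl.
apply: (le_trans E00).
have n0 : 0 <= n%:R :> R by [].
have m0 : 0 <= `|y 0| by [].
rewrite -natr1; move: (n%:R) (`|y 0|) n0 m0 => p m p0 m0.
have : 0 <= m * b by rewrite mulr_ge0.
have : 0 <= m ^+ 2 by exact: sqr_ge0.
have : 0 <= b ^+ 2 by exact: sqr_ge0.
rewrite !expr2 => h1 h2 h3.
have h4 : 0 <= p * (m * b) by rewrite mulr_ge0.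
have h5 : 0 <= p * p * (m * b) by rewrite !mulr_ge0.
have h6 : 0 <= p * (m * m) by rewrite !mulr_ge0.
have h7 : 0 <= p * p * (m * m) by rewrite !mulr_ge0.
have h8 : 0 <= p * (b * b) by rewrite !mulr_ge0.
have h9 : 0 <= p * p * (b * b) by rewrite !mulr_ge0.
by nra.
Qed.

End Curves.

(** * Existence of solutions by Picard iteration *)

Section Picard.
Context {R : realType}.
Implicit Types (s t : R).

Local Notation clamp := (clip (0 : R) 1).

Lemma geom_small (a C : R) : (forall n : nat, `|a| <= C * 2^-1 ^+ n) -> a = 0.
Proof.
move=> H; apply/eqP; rewrite -normr_le0.
apply/ler_addgt0Pr => e e0; rewrite add0r.
have /cvgrPdist_lt/(_ _ e0)[N _ HN] : geometric C (2^-1 : R) @ \oo --> 0.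
  by apply: cvg_geometric; rewrite ger0_norm ?invr_ge0 // invf_lt1 // ltr1n.
apply: le_trans (H N) _.
have := HN N (leqnn N); rewrite /= sub0r normrN => /ltW; apply: le_trans.
exact: ler_norm.
Qed.

(** With q the tail of the geometric series, u - q increases, u + q decreases, and every value of
    the first lies below every value of the second. The limit is the supremum of u - q, which also
    gives the rate. *)
Lemma geom_cvg (u : nat -> R) (B : R) :
  (forall n, `|u n.+1 - u n| <= B * 2^-1 ^+ n) ->
  exists l, forall n, `|u n - l| <= 2 * B * 2^-1 ^+ n.
Proof.
move=> uB.
pose q n : R := 2 * B * 2^-1 ^+ n.
have qS n : q n - q n.+1 = B * 2^-1 ^+ n.
  by rewrite /q exprS mulrA; field.
have B0 n : 0 <= B * 2^-1 ^+ n by apply: le_trans (uB n); exact: normr_ge0.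
have q0 n : 0 <= q n by rewrite /q -mulrA mulr_ge0.
have up : forall n m, u n - q n <= u (n + m)%N - q (n + m)%N.
  move=> n; elim=> [|m IH]; first by rewrite addn0.
  apply: le_trans IH _; rewrite addnS.
  have := uB (n + m)%N; rewrite ler_norml => /andP[h _]; have := qS (n + m)%N; lra.
have dn : forall n m, u (n + m)%N + q (n + m)%N <= u n + q n.
  move=> n; elim=> [|m IH]; first by rewrite addn0.
  apply: le_trans IH; rewrite addnS.
  have := uB (n + m)%N; rewrite ler_norml => /andP[_ h]; have := qS (n + m)%N; lra.
have cross n m : u n - q n <= u m + q m.
  case: (leqP n m) => [nm|/ltnW mn].
    have := up n (m - n)%N; rewrite subnKC // => h; have := q0 m; lra.
  have := dn m (n - m)%N; rewrite subnKC // => h; have := q0 n; lra.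
pose S := range (fun n => u n - q n).
have S0 : S !=set0 by exists (u 0%N - q 0%N); exists 0%N.
have Sub m : ubound S (u m + q m) by move=> _ [n _ <-]; exact: cross.
exists (sup S) => n; rewrite ler_norml; apply/andP; split.
  have : u n - q n <= sup S.
    by apply: sup_upper_bound; [split=> //; exists (u 0%N + q 0%N) | exists n].
  suff : sup S <= u n + q n by move=> h _; have := q0 n; rewrite /q in h *; lra.
  exact: ge_sup.
have : u n - q n <= sup S.
  by apply: sup_upper_bound; [split=> //; exists (u 0%N + q 0%N) | exists n].
by rewrite /q; lra.
Qed.

Lemma bounded_on_unit (f : R -> R) : continuous f ->
  exists M : R, 0 <= M /\ forall s, 0 <= s <= 1 -> `|f s| <= M.
Proof.
move=> cf.
have [||c _ cM] := @EVT_max R (fun s => `|f s|) 0 1; first exact: ler01.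
  apply: continuous_subspaceT => x; apply: (@continuous_comp _ _ _ f); first exact: cf.
  exact: norm_continuous.
by exists `|f c|; split=> // s s01; apply: cM; rewrite in_itv.
Qed.

Lemma bounded_curve n (y : R -> 'rV[R]_n) : (forall i, continuous (fun s => y s 0 i)) ->
  exists2 M : R, 0 <= M & forall s, 0 <= s <= 1 -> `|y s| <= M.
Proof.
move=> cy.
have [M MP] := @choice _ _ _ (fun i => bounded_on_unit (cy i)).
have M0 i : 0 <= M i by case: (MP i).
exists (\sum_i M i); first by apply: sumr_ge0.
move=> s s01; apply: normv_le; first exact: sumr_ge0.
move=> i; rewrite (bigD1 i) //=; apply: le_trans (_ : M i <= _).
  by case: (MP i) => _; exact.
by rewrite lerDl; exact: sumr_ge0.
Qed.

Lemma uniform_limit_cont (y : nat -> R -> R) (z : R -> R) (C : R) :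
  (forall n, continuous (y n)) ->
  (forall n s, `|y n s - z s| <= C * 2^-1 ^+ n) -> continuous z.
Proof.
move=> cy yz s; apply/cvgrPdist_lt => e e0.
have e30 : 0 < e / 3 by rewrite divr_gt0.
have /cvgrPdist_lt/(_ _ e30)[N _ HN] : geometric C (2^-1 : R) @ \oo --> 0.
  by apply: cvg_geometric; rewrite ger0_norm ?invr_ge0 // invf_lt1 // ltr1n.
have {HN}CN : C * 2^-1 ^+ N < e / 3.
  by have := HN N (leqnn N); rewrite /= sub0r normrN; apply: le_lt_trans; exact: ler_norm.
have /cvgrPdist_lt/(_ _ e30) := cy N s; apply: filterS => t yst.
have h1 := le_lt_trans (yz N s) CN; have h2 := le_lt_trans (yz N t) CN.
rewrite distrC in h1.
apply: le_lt_trans (ler_distD (y N s) _ _) _.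
apply: (@lt_le_trans _ _ (e / 3 + (e / 3 + e / 3))); last by lra.
apply: ltrD => //; apply: le_lt_trans (ler_distD (y N t) _ _) _.
exact: ltrD.
Qed.

Definition picard_step n (F : R -> 'rV[R]_n -> 'rV[R]_n) (y0 : 'rV[R]_n)
    (y : R -> 'rV[R]_n) (s : R) : 'rV[R]_n :=
  \row_i (y0 0 i + prim (fun t => F t (y t) 0 i) s).

(** Joint continuity of F is expressed through its action on continuous paths, the form in which the
    integrand of a Picard step requires it. *)
Definition cont_field n (F : R -> 'rV[R]_n -> 'rV[R]_n) : Prop :=
  forall y : R -> 'rV[R]_n, (forall i, continuous (fun s => y s 0 i)) ->
  forall i, continuous (fun s => F s (y s) 0 i).

Lemma picard_stepP n (F : R -> 'rV[R]_n -> 'rV[R]_n) (y0 : 'rV[R]_n)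
    (y : R -> 'rV[R]_n) :
  cont_field F -> (forall i, continuous (fun s => y s 0 i)) ->
  [/\ is_curve (picard_step F y0 y) (fun s => F s (y s)),
      picard_step F y0 y 0 = y0 &
      forall s, picard_step F y0 y (clamp s) = picard_step F y0 y s].
Proof.
move=> cF cy; split; last 1 first.
- by move=> s; apply/rowP => i; rewrite !mxE primK.
- split=> [i s|s s01 i].
    have -> : (fun s => picard_step F y0 y s 0 i) =
       (cst (y0 0 i) + prim (fun t => F t (y t) 0 i)).
      by apply/funext => t; rewrite mxE.
    apply: continuousD; first exact: cst_continuous.
    exact: prim_continuous (cF y cy i) s.
  have -> : (fun s => picard_step F y0 y s 0 i) =
     (cst (y0 0 i) + prim (fun t => F t (y t) 0 i)).
    by apply/funext => t; rewrite mxE.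
  have D := is_derive_prim (cF y cy i) s01.
  by rewrite -[F s (y s) 0 i]add0r; exact: is_deriveD.
- by apply/rowP => i; rewrite mxE prim0 addr0.
Qed.

(** The differences of the iterates are measured against the weight exp (la s) with la = 2 (K + 1).
    One step then contracts by 1/2 on the whole unit interval, whatever the Lipschitz constant K
    is. *)
Theorem picard n (F : R -> 'rV[R]_n -> 'rV[R]_n) (K : R) (y0 : 'rV[R]_n) :
  cont_field F -> 0 <= K -> (forall s u v, `|F s u - F s v| <= K * `|u - v|) ->
  exists y, [/\ is_curve y (fun s => F s (y s)), y 0 = y0 &
                forall s, y (clamp s) = y s].
Proof.
move=> cF K0 lF.
pose Y n := iter n (picard_step F y0) (fun=> y0).
have cY m i : continuous (fun s => Y m s 0 i).
  elim: m i => [|m IH] i; first by move=> s; exact: cst_continuous.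
  by have [[c _] _ _] := picard_stepP y0 cF IH; exact: c.
have YP m : [/\ is_curve (Y m.+1) (fun s => F s (Y m s)), Y m.+1 0 = y0 &
      forall s, Y m.+1 (clamp s) = Y m.+1 s].
  exact: picard_stepP.
have Yc m s : Y m (clamp s) = Y m s by case: m => [//|m]; have [_ _] := YP m.
have [M M0 HM] : exists2 M : R, 0 <= M & forall s, 0 <= s <= 1 -> `|Y 1%N s - Y 0%N s| <= M.
  exact: (@bounded_curve _ (fun s => Y 1%N s - Y 0%N s) (coord_continuousB (cY 1%N) (cY 0%N))).
pose la : R := 2 * (K + 1).
have la0 : 0 <= la by rewrite mulr_ge0 // addr_ge0.
have dexp (a : R) (s : R) : is_derive s 1 (fun s : R => a * expR (la * s)) (a * (la * expR (la * s))).
  have D : is_derive s 1 (fun t => expR (la * t)) (expR (la * s) * la).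
    apply: (@is_derive1_comp _ expR (fun t => la * t)).
    exact: is_derive_mull.
  have := @is_deriveZ _ _ _ _ a _ _ _ D.
  by rewrite [la * expR _]mulrC.
have cexp (a : R) : continuous (fun s : R => a * expR (la * s)).
  move=> t; have [d _] := dexp a t.
  exact/differentiable_continuous/derivable1_diffP.
have step m s : 0 <= s <= 1 -> `|Y m.+1 s - Y m s| <= M * 2^-1 ^+ m * expR (la * s).
  elim: m s => [|m IH] s s01.
    rewrite expr0 mulr1; apply: le_trans (HM s s01) _.
    rewrite ler_peMr // -expR0 ler_expR mulr_ge0 //; by case/andP: s01.
  have [C1 z1 _] := YP m.+1; have [C0 z0 _] := YP m.
  apply: (curve_norm_le (is_curveB C1 C0) (cexp _) (fun s _ => dexp _ s)) s01 => [t t01|].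
    apply: le_trans (lF _ _ _) _.
    apply: (@le_trans _ _ (K * (M * 2^-1 ^+ m * expR (la * t)))).
      by apply: ler_wpM2l => //; apply: IH; case/andP: t01 => /ltW -> /ltW ->.
    have e0 : 0 <= M * 2^-1 ^+ m * expR (la * t).
      by rewrite !mulr_ge0 ?expR_ge0 // exprn_ge0 // invr_ge0.
    rewrite exprS /la; move: (2^-1 ^+ m) (expR _) e0 => x e e0.
    by rewrite [leRHS](_ : _ = (K + 1) * (M * x * e)); [rewrite ler_wpM2r // lerDl | field].
  by rewrite z1 z0 subrr normr0 !mulr_ge0 ?expR_ge0 // exprn_ge0 // invr_ge0.
pose B := M * expR la.
have stepB m s : `|Y m.+1 s - Y m s| <= B * 2^-1 ^+ m.
  rewrite -(Yc m.+1) -(Yc m); apply: le_trans (step _ _ (clamp_in s)) _.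
  rewrite /B mulrAC; apply: ler_wpM2r; first by rewrite exprn_ge0 // invr_ge0.
  apply: ler_wpM2l => //; rewrite ler_expR ler_piMr //.
  by have /andP[] := clamp_in s.
have lim (si : R * 'I_n) : exists l, forall m, `|Y m si.1 0 si.2 - l| <= 2 * B * 2^-1 ^+ m.
  apply: geom_cvg => m; apply: le_trans (stepB m si.1).
  by have := coord_le (Y m.+1 si.1 - Y m si.1) si.2; rewrite !mxE.
have [l lP] := @choice _ _ _ lim.
pose y s : 'rV[R]_n := \row_i l (s, i).
have yP m s i : `|Y m s 0 i - y s 0 i| <= 2 * B * 2^-1 ^+ m.
  by rewrite mxE; exact: (lP (s, i)).
have B0 : 0 <= B by rewrite mulr_ge0 // expR_ge0.
have yPn m s : `|Y m s - y s| <= 2 * B * 2^-1 ^+ m.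
  apply: normv_le; first by rewrite !mulr_ge0 // exprn_ge0 // invr_ge0.
  by move=> i; have := yP m s i; rewrite !mxE.
have cy i : continuous (fun s => y s 0 i).
  exact: (uniform_limit_cont (fun m => cY m i) (fun m s => yP m s i)).
have [Cz z0 zc] := picard_stepP y0 cF cy.
(* The iterates converge to their limit y and also to the Picard step z of that limit, so y = z and
   y solves the equation. *)
pose z := picard_step F y0 y.
have cmp m s : 0 <= s <= 1 -> `|Y m.+1 s - z s| <= K * (2 * B * 2^-1 ^+ m).
  move=> s01; have [C1 z1 _] := YP m.
  have CC0 : 0 <= K * (2 * B * 2^-1 ^+ m) by rewrite !mulr_ge0 // exprn_ge0 // invr_ge0.
  apply: (@le_trans _ _ (K * (2 * B * 2^-1 ^+ m) * s)); last first.
    by rewrite ler_piMr //; case/andP: s01.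
  have dl (t : R) : is_derive t 1 (fun t : R => K * (2 * B * 2^-1 ^+ m) * t) (K * (2 * B * 2^-1 ^+ m)).
    exact: is_derive_mull.
  apply: (curve_norm_le (is_curveB C1 Cz) _ (fun s _ => dl s)) s01 => [t|t t01|].
  - by have [d _] := dl t; exact/differentiable_continuous/derivable1_diffP.
  - by apply: le_trans (lF _ _ _) _; apply: ler_wpM2l.
  - by rewrite z1 z0 subrr normr0 mulr0.
have zy s : y s = z s.
  apply/rowP => i; apply/eqP; rewrite -subr_eq0; apply/eqP.
  apply: (@geom_small _ ((K + 1) * (2 * B))) => m.
  have h1 := yP m.+1 s i.
  have h2 : `|Y m.+1 s 0 i - z s 0 i| <= K * (2 * B * 2^-1 ^+ m).
    apply: le_trans (cmp m (clamp s) (clamp_in s)); rewrite Yc /z zc.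
    by have := coord_le (Y m.+1 s - z s) i; rewrite !mxE.
  rewrite distrC in h1.
  apply: le_trans (ler_distD (Y m.+1 s 0 i) _ _) _.
  apply: le_trans (lerD h1 h2) _.
  have x0 : 0 <= 2 * B * 2^-1 ^+ m by rewrite !mulr_ge0 // exprn_ge0 // invr_ge0.
  rewrite exprS [leRHS](_ : _ = 2 * B * 2^-1 ^+ m + K * (2 * B * 2^-1 ^+ m)); last by ring.
  rewrite lerD2r mulrCA.
  by rewrite ler_piMl // invf_le1 // ler1n.
exists z; have -> : z = y by apply/funext => s; rewrite zy.
split; [|by rewrite zy|by move=> s; rewrite !zy; exact: zc].
have -> : y = z by apply/funext => s; rewrite zy.
have E : (fun s => F s (z s)) = (fun s => F s (y s)) by apply/funext => s; rewrite zy.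
by rewrite E.
Qed.

End Picard.

(** * Uniform estimates on compact boxes *)

Section Box.
Context {R : realType} {n : nat}.
Implicit Types (c rho x y v : 'rV[R]_n).

(** One radius per coordinate, so that the product of two boxes is again a box; the doubled flows
    rely on this. *)
Definition box c rho : set 'rV[R]_n :=
  [set v | forall i, `[c 0 i - rho 0 i, c 0 i + rho 0 i]%classic (v 0 i)].

Lemma box_compact c rho : compact (box c rho).
Proof.
apply: (@rV_compact _ _ (fun i => `[c 0 i - rho 0 i, c 0 i + rho 0 i]%classic)) => i.
exact: segment_compact.
Qed.

Lemma box_convex c rho x y (t : R) : box c rho x -> box c rho y -> 0 <= t <= 1 ->
  box c rho (x + t *: (y - x)).
Proof.
move=> Bx By /andP[t0 t1] i; have := Bx i; have := By i.
rewrite /= !in_itv /= !mxE => /andP[y1 y2] /andP[x1 x2].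
move: (c 0 i) (rho 0 i) (x 0 i) (y 0 i) y1 y2 x1 x2 => p r a b y1 y2 x1 x2.
by apply/andP; split; nra.
Qed.

Lemma box_bounded c rho (f : 'rV[R]_n -> R) :
  (forall x, box c rho x -> {for x, continuous f}) ->
  exists M : R, 0 <= M /\ forall x, box c rho x -> `|f x| <= M.
Proof.
move=> cf; have [B0|/set0P/negP/negPn/eqP B0] := pselect (box c rho !=set0); last first.
  by exists 0; split=> // x; rewrite B0.
have [|m _ mM] := @EVT_max_rV R n (fun x => `|f x|) _ B0 (@box_compact c rho).
  apply: continuous_in_subspaceT => x; rewrite inE => Bx.
  apply: (@continuous_comp _ _ _ f); first exact: cf.
  exact: norm_continuous.
by exists `|f m|; split=> // x Bx; apply: mM; rewrite inE.
Qed.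

Section OneFunction.
Variables (V : set 'rV[R]_n) (c rho : 'rV[R]_n) (f : 'rV[R]_n -> R).
Hypotheses (oV : open V) (BV : box c rho `<=` V).

Lemma box_MVT x y : Ck_on 1 V f -> box c rho x -> box c rho y ->
  exists2 z, box c rho z /\ `|z - x| <= `|y - x| &
    f y - f x = \sum_j (y 0 j - x 0 j) * 'D_(basis_vec j) f z.
Proof.
move=> Cf Bx By.
pose z (t : R) := x + t *: (y - x).
pose df t := \sum_j (y - x) 0 j * 'D_(basis_vec j) f (z t).
have Bz t : 0 <= t <= 1 -> box c rho (z t) by exact: box_convex.
have D (t : R) : 0 <= t <= 1 -> is_derive t 1 (f \o z) (df t).
  move=> t01; have Vz := BV (Bz t t01).
  have [d E] := is_derive_C1 (y - x) oV Vz Cf.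
  by have := is_derive_line d; rewrite E.
have [||t t01 E] := @MVT R (f \o z) df 0 1 ltr01.
- by move=> t; rewrite in_itv /= => /andP[/ltW ? /ltW ?]; apply: D; exact/andP.
- apply: derivable_within_continuous => t; rewrite in_itv /= => t01.
  by have [] := D t t01.
move: t01 E; rewrite in_itv /= => /andP[/ltW t0 /ltW t1].
rewrite /z scale0r addr0 scale1r subrKC subr0 mulr1 => E.
exists (z t); last by rewrite E; apply: eq_bigr => j _; rewrite !mxE.
split; first by apply: Bz; rewrite t0.
by rewrite /z addrAC subrr add0r normrZ ger0_norm // ler_piMl.
Qed.

Lemma box_lip : Ck_on 1 V f -> exists K : R, 0 <= K /\
  forall x y, box c rho x -> box c rho y -> `|f y - f x| <= K * `|y - x|.
Proof.
move=> Cf.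
have bd j : exists M : R, 0 <= M /\ forall x, box c rho x -> `|'D_(basis_vec j) f x| <= M.
  apply: box_bounded => x Bx; exact: Ck_on_cont (Ck_on_derive j Cf) (BV Bx).
have [M MP] := choice bd.
exists (\sum_j M j); split; first by apply: sumr_ge0 => j _; case: (MP j).
move=> x y Bx By; have [z [Bz _] ->] := box_MVT Cf Bx By.
rewrite mulr_suml; apply: le_trans (ler_norm_sum _ _ _) _.
apply: ler_sum => j _; rewrite normrM mulrC.
apply: ler_pM => //; first by case: (MP j) => _; exact.
by have := coord_le (y - x) j; rewrite !mxE.
Qed.

End OneFunction.

Lemma box_taylor (V : set 'rV[R]_n) c rho (f : 'rV[R]_n -> R) :
  open V -> box c rho `<=` V -> Ck_on 2 V f -> exists K : R, 0 <= K /\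
  forall x y, box c rho x -> box c rho y ->
  `|f y - f x - \sum_j (y 0 j - x 0 j) * 'D_(basis_vec j) f x| <= K * `|y - x| ^+ 2.
Proof.
move=> oV BV Cf.
have [M MP] := choice (fun j => box_lip oV BV (Ck_on_derive j Cf)).
exists (\sum_j M j); split; first by apply: sumr_ge0 => j _; case: (MP j).
move=> x y Bx By; have [z [Bz zx] ->] := box_MVT oV BV (Ck_onS Cf) Bx By.
rewrite -sumrB mulr_suml; apply: le_trans (ler_norm_sum _ _ _) _.
apply: ler_sum => j _; rewrite -mulrBr normrM expr2 mulrCA.
apply: ler_pM => //; first by have := coord_le (y - x) j; rewrite !mxE.
have [M0 H] := MP j; apply: le_trans (H _ _ Bx Bz) _.
exact: ler_wpM2l.
Qed.

End Box.

Section VectorField.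
Context {R : realType} {n : nat}.

(** The Jacobian of G at z applied to v, written with partial derivatives so that linearity in v is
    a computation with sums. *)
Definition dfield (G : 'rV[R]_n -> 'rV[R]_n) (z v : 'rV[R]_n) : 'rV[R]_n :=
  \row_i \sum_j v 0 j * 'D_(basis_vec j) (fun x => G x 0 i) z.

Lemma dfieldB G z (v w : 'rV[R]_n) : dfield G z (v - w) = dfield G z v - dfield G z w.
Proof.
apply/rowP => i; rewrite !mxE -sumrB; apply: eq_bigr => j _.
by rewrite !mxE mulrBl.
Qed.

Lemma dfieldZ G z (a : R) (v : 'rV[R]_n) : dfield G z (a *: v) = a *: dfield G z v.
Proof.
apply/rowP => i; rewrite !mxE mulr_sumr; apply: eq_bigr => j _.
by rewrite !mxE mulrA.
Qed.

Section OnBox.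
Variables (Om : set 'rV[R]_n) (G : 'rV[R]_n -> 'rV[R]_n) (c rho : 'rV[R]_n).
Hypotheses (oOm : open Om) (BOm : box c rho `<=` Om)
  (sG : forall i, smooth_on Om (fun z => G z 0 i)).

Lemma field_lip : exists K : R, 0 <= K /\
  forall x y, box c rho x -> box c rho y -> `|G y - G x| <= K * `|y - x|.
Proof.
have [M MP] := choice (fun i => box_lip oOm BOm (sG i 1%N)).
have M0 i : 0 <= M i by case: (MP i).
exists (\sum_i M i); split; first exact: sumr_ge0.
move=> x y Bx By; apply: normv_le; first by rewrite mulr_ge0 // sumr_ge0.
move=> i; rewrite !mxE; have [_ H] := MP i; apply: le_trans (H _ _ Bx By) _.
by rewrite ler_wpM2r // (bigD1 i) //= lerDl sumr_ge0.
Qed.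

Lemma field_taylor : exists K : R, 0 <= K /\
  forall x y, box c rho x -> box c rho y ->
  `|G y - G x - dfield G x (y - x)| <= K * `|y - x| ^+ 2.
Proof.
have [M MP] := choice (fun i => box_taylor oOm BOm (sG i 2%N)).
have M0 i : 0 <= M i by case: (MP i).
exists (\sum_i M i); split; first exact: sumr_ge0.
move=> x y Bx By; apply: normv_le; first by rewrite mulr_ge0 ?sumr_ge0 ?exprn_ge0.
move=> i; rewrite !mxE; under eq_bigr do rewrite !mxE.
have [_ H] := MP i; apply: le_trans (H _ _ Bx By) _.
by rewrite ler_wpM2r ?exprn_ge0 // (bigD1 i) //= lerDl sumr_ge0.
Qed.

Lemma dfield_bound : exists K : R, 0 <= K /\
  forall x v, box c rho x -> `|dfield G x v| <= K * `|v|.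
Proof.
have bd (ij : 'I_n * 'I_n) : exists M : R, 0 <= M /\ forall x, box c rho x ->
    `|'D_(basis_vec ij.2) (fun x => G x 0 ij.1) x| <= M.
  apply: box_bounded => x Bx.
  exact: Ck_on_cont (Ck_on_derive ij.2 (sG ij.1 1%N)) (BOm Bx).
have [M MP] := choice bd.
have M0 i : 0 <= M i by case: (MP i).
exists (\sum_i \sum_j M (i, j)); split; first by apply: sumr_ge0 => *; exact: sumr_ge0.
move=> x v Bx; apply: normv_le; first by rewrite mulr_ge0 // sumr_ge0 // => *; exact: sumr_ge0.
move=> i; rewrite mxE; apply: (@le_trans _ _ ((\sum_j M (i, j)) * `|v|)).
  rewrite mulr_suml; apply: le_trans (ler_norm_sum _ _ _) _; apply: ler_sum => j _.
  rewrite normrM mulrC; apply: ler_pM => //; last exact: coord_le.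
  by have [_] := MP (i, j); exact.
rewrite ler_wpM2r // [leRHS](bigD1 i) //= lerDl.
by apply: sumr_ge0 => *; exact: sumr_ge0.
Qed.

End OnBox.
End VectorField.

(** * Flows and their smooth dependence on the initial point *)

Section Flow.
Context {R : realType}.
Local Notation clamp := (clip (0 : R) 1).

(** All trajectories issuing from D stay in one compact box inside Om. This provides Lipschitz and
    Taylor constants of G that are uniform along the flow. *)
Definition flow_on n (Om D : set 'rV[R]_n) (G : 'rV[R]_n -> 'rV[R]_n)
    (c rho : 'rV[R]_n) (Z : R -> 'rV[R]_n -> 'rV[R]_n) : Prop :=
  [/\ open Om, open D, forall i, smooth_on Om (fun z => G z 0 i),
      box c rho `<=` Om &
      forall z, D z -> [/\ Z 0 z = z, is_curve (Z^~ z) (fun s => G (Z s z)) &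
                           forall s, box c rho (Z s z)]].

Section OneFlow.
Context {n : nat}.
Variables (Om D : set 'rV[R]_n) (G : 'rV[R]_n -> 'rV[R]_n) (c rho : 'rV[R]_n)
  (Z : R -> 'rV[R]_n -> 'rV[R]_n).
Hypothesis flow : flow_on Om D G c rho Z.

Lemma flow_lip : exists C : R, 0 <= C /\ forall z z', D z -> D z' ->
  forall s, 0 <= s <= 1 -> `|Z s z' - Z s z| <= C * `|z' - z|.
Proof.
have [oOm oD sG BOm ZP] := flow.
have [K [K0 HK]] := field_lip oOm BOm sG.
exists (gronwall_cst n K); split; first exact/ltW/gronwall_cst_gt0.
move=> z z' Dz Dz' s s01.
have [z0 cz Bz] := ZP z Dz; have [z0' cz' Bz'] := ZP z' Dz'.
have := gronwall (is_curveB cz' cz) K0 (lexx 0) _ s01.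
rewrite z0 z0' addr0; apply=> t t01.
by rewrite addr0; exact: HK.
Qed.

(** The candidate derivative chi solves the linearised equation. The difference between the
    increment of the flow and h chi solves that equation up to a Taylor error quadratic in h, and
    [gronwall] turns this into a quadratic bound. *)
Lemma flow_derive z v (chi : R -> 'rV[R]_n) : D z ->
  is_curve chi (fun s => dfield G (Z s z) (chi s)) -> chi 0 = v ->
  forall s, 0 <= s <= 1 -> forall i, is_derive z v (fun x => Z s x 0 i) (chi s 0 i).
Proof.
move=> Dz cchi chi0 s s01 i.
have [oOm oD sG BOm ZP] := flow.
have [C1 [C10 HC1]] := flow_lip.
have [K [K0 HK]] := dfield_bound BOm sG.
have [C2 [C20 HC2]] := field_taylor oOm BOm sG.
have [z0 cz Bz] := ZP z Dz.
pose C3 := gronwall_cst n K * (C2 * (C1 * `|v|) ^+ 2).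
have C30 : 0 <= C3 by rewrite !mulr_ge0 ?exprn_ge0 ?mulr_ge0 // ltW ?gronwall_cst_gt0.
have est (h : R) : D (h *: v + z) ->
    `|Z s (h *: v + z) - Z s z - h *: chi s| <= C3 * `|h| ^+ 2.
  move=> Dh; have [z0' cz' Bz'] := ZP _ Dh.
  pose b := C2 * (C1 * `|h *: v|) ^+ 2.
  have b0 : 0 <= b by rewrite !mulr_ge0 ?exprn_ge0 ?mulr_ge0.
  have := gronwall (is_curveB (is_curveB cz' cz) (is_curveZ h cchi)) K0 b0 _ s01.
  rewrite z0 z0' chi0 addrK subrr normr0 add0r => H.
  have -> : C3 * `|h| ^+ 2 = gronwall_cst n K * b.
    by rewrite /b /C3 normrZ; ring.
  apply: H => t t01.
  have t01' : 0 <= t <= 1 by case/andP: t01 => /ltW -> /ltW ->.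
  set y' := Z t (h *: v + z); set y := Z t z.
  have -> : G y' - G y - h *: dfield G y (chi t) =
     (G y' - G y - dfield G y (y' - y)) + dfield G y (y' - y - h *: chi t).
    by rewrite (dfieldB _ _ (y' - y)) dfieldZ addrA subrK.
  apply: le_trans (ler_normD _ _) _; rewrite addrC; apply: lerD; first exact: HK (Bz t).
  apply: le_trans (HC2 _ _ (Bz t) (Bz' t)) _.
  apply: ler_wpM2l => //; rewrite ler_pXn2r ?nnegrE ?mulr_ge0 //.
  by have := HC1 _ _ Dz Dh t t01'; rewrite addrK.
have main : (fun h : R => h^-1 *: (((fun x => Z s x 0 i) \o shift z) (h *: v) - Z s z 0 i))
    @ 0^' --> chi s 0 i.
  apply: (@cvg_sub0 _ _ _ _ _ _ (fun=> chi s 0 i)); last exact: cvg_cst.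
  apply/cvgr0Pnorm_le => e e0.
  have C31 : 0 < C3 + 1 by rewrite ltr_wpDl.
  have nD : \forall h \near (0 : R)^', D (h *: v + z).
    apply: nbhs_dnbhs.
    have c0 : (fun h : R => h *: v + z) @ (0 : R) --> z.
      have : (fun h : R => h *: v + z) @ (0 : R) --> 0 *: v + z.
        apply: cvgD; last exact: cvg_cst.
        by apply: cvgZ; [exact: cvg_id|exact: cvg_cst].
      by rewrite scale0r add0r.
    by apply: c0; exact: open_nbhs_nbhs.
  near=> h.
  have h0 : h != 0 by near: h; exact: nbhs_dnbhs_neq.
  have Dh : D (h *: v + z) by near: h.
  have he : `|h| <= e / (C3 + 1).
    near: h; apply: nbhs_dnbhs; apply: (@cvgr0_norm_le _ _ _ (nbhs (0 : R)) _ id) => //.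
    by rewrite divr_gt0.
  have E : h^-1 *: (Z s (h *: v + z) 0 i - Z s z 0 i) - chi s 0 i =
      h^-1 * (Z s (h *: v + z) - Z s z - h *: chi s) 0 i.
    by rewrite !mxE mulrBr mulKf.
  rewrite -[X in `|X|]/(h^-1 *: (Z s (h *: v + z) 0 i - Z s z 0 i) - chi s 0 i) E.
  rewrite normrM normfV ler_pdivrMl ?normr_gt0 //.
  apply: le_trans (coord_le _ _) _; apply: le_trans (est h Dh) _.
  rewrite expr2 mulrCA; apply: ler_wpM2l => //.
  apply: (@le_trans _ _ ((C3 + 1) * `|h|)); first by rewrite ler_wpM2r // lerDl.
  by rewrite mulrC -ler_pdivlMr.
apply: DeriveDef; first by apply/cvg_ex; eexists; exact: main.
exact: cvg_lim main.
Unshelve. all: by end_near. Qed.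

Lemma variation_exists z v : D z -> exists chi : R -> 'rV[R]_n,
  [/\ is_curve chi (fun s => dfield G (Z s z) (chi s)), chi 0 = v &
      forall s, chi (clamp s) = chi s].
Proof.
move=> Dz; have [oOm oD sG BOm ZP] := flow.
have [K [K0 HK]] := dfield_bound BOm sG.
have [z0 cz Bz] := ZP z Dz.
apply: (@picard R n (fun s => dfield G (Z s z)) K v) => //; last first.
  by move=> s u w; rewrite -dfieldB; exact: HK.
move=> y cy i s.
have -> : (fun s => dfield G (Z s z) (y s) 0 i) =
   (fun s => \sum_j y s 0 j * 'D_(basis_vec j) (fun x => G x 0 i) (Z s z)).
  by apply/funext => t; rewrite mxE.
apply: (@cvg_sumr R _ _ _ _ _ _ _ (nbhs_filter s)) => j _.
apply: cvgM; first exact: cy.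
apply: (@continuous_comp _ _ _ (fun s => Z s z)
   (fun w => 'D_(basis_vec j) (fun x => G x 0 i) w)).
  by apply: (@cvg_coord _ _ _ _ _ _ (nbhs_filter s)) => l; have [h _] := cz; exact: h.
exact: Ck_on_cont (Ck_on_derive j (sG i 1%N)) (BOm _ (Bz s)).
Qed.

End OneFlow.

Lemma lsub_row n m (x : 'rV[R]_(n + m)) j : lsubmx x 0 j = x 0 (lshift m j).
Proof. by rewrite mxE. Qed.

Lemma rsub_row n m (x : 'rV[R]_(n + m)) j : rsubmx x 0 j = x 0 (rshift n j).
Proof. by rewrite mxE. Qed.

Lemma lsubmx_continuous n m : continuous (fun x : 'rV[R]_(n + m) => lsubmx x).
Proof.
move=> x; apply: (@cvg_coord _ _ _ _ _ _ (nbhs_filter x)) => i.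
rewrite (_ : (fun y : 'rV[R]_(n + m) => lsubmx y 0 i) = fun y => y 0 (lshift m i)).
  by rewrite lsub_row; exact: coord_continuous.
by apply/funext => y; rewrite lsub_row.
Qed.

Lemma rsubmx_continuous n m : continuous (fun x : 'rV[R]_(n + m) => rsubmx x).
Proof.
move=> x; apply: (@cvg_coord _ _ _ _ _ _ (nbhs_filter x)) => i.
rewrite (_ : (fun y : 'rV[R]_(n + m) => rsubmx y 0 i) = fun y => y 0 (rshift n i)).
  by rewrite rsub_row; exact: coord_continuous.
by apply/funext => y; rewrite rsub_row.
Qed.

Lemma Ck_on_lsub n m k (V : set 'rV[R]_n) (f : 'rV[R]_n -> R) : open V -> Ck_on k V f ->
  Ck_on k [set x : 'rV[R]_(n + m) | V (lsubmx x)] (fun x => f (lsubmx x)).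
Proof.
move=> oV Cf; apply: (@Ck_on_comp R n (n + m) k V _ f (fun x => lsubmx x)) => //.
  by apply: open_comp oV => x _; exact: lsubmx_continuous.
move=> j.
have -> : (fun x : 'rV[R]_(n + m) => lsubmx x 0 j) = (fun x => x 0 (lshift m j)).
  by apply/funext => x; rewrite lsub_row.
exact: Ck_on_coord.
Qed.

(** The lift of G to the tangent bundle: the second component is the linearised equation along the
    flow. *)
Definition double_field n (G : 'rV[R]_n -> 'rV[R]_n) (x : 'rV[R]_(n + n)) :
  'rV[R]_(n + n) := row_mx (G (lsubmx x)) (dfield G (lsubmx x) (rsubmx x)).

(* The derivative of a flow solves, together with the flow, an equation of the
   same kind; this is what makes the induction on the order of
   differentiability in [flow_Ck] work. *)
Lemma double_flow n Om D G c rho (Z : R -> 'rV[R]_n -> 'rV[R]_n) :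
  flow_on Om D G c rho Z ->
  exists rho2 Z2, flow_on [set x | Om (lsubmx x)]
    [set x | D (lsubmx x) /\ `|rsubmx x| < 2] (double_field G)
    (row_mx c 0) rho2 Z2 /\
    forall z v, D z -> `|v| < 2 -> forall s, 0 <= s <= 1 -> forall i,
      is_derive z v (fun x => Z s x 0 i) (Z2 s (row_mx z v) 0 (rshift n i)).
Proof.
move=> flow; have [oOm oD sG BOm ZP] := flow.
have [K [K0 HK]] := dfield_bound BOm sG.
have ex (zv : 'rV[R]_n * 'rV[R]_n) : exists x : R -> 'rV[R]_n, D zv.1 ->
    [/\ is_curve x (fun s => dfield G (Z s zv.1) (x s)), x 0 = zv.2 &
        forall s, x (clamp s) = x s].
    have [Dz|nDz] := pselect (D zv.1); last by exists (fun=> 0) => /nDz.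
    by have [x xP] := variation_exists flow zv.2 Dz; exists x.
have [chi chiP] := choice ex.
(* By [gronwall] a solution of the linearised equation with initial vector of norm below 2 stays
   below this radius. The bound 2 leaves room for the basis vectors, whose norm is at most 1. *)
exists (row_mx rho (const_mx (gronwall_cst n K * 2))).
exists (fun s x => row_mx (Z s (lsubmx x)) (chi (lsubmx x, rsubmx x) s)).
split; last first.
  move=> z v Dz v2 s s01 i; rewrite row_mxKl row_mxKr row_mxEr.
  have [c1 c2 _] := chiP (z, v) Dz.
  exact: (flow_derive flow Dz c1 c2 s01 i).
split.
- by apply: open_comp oOm => x _; exact: lsubmx_continuous.
- apply: openI; first by apply: open_comp oD => x _; exact: lsubmx_continuous.
  apply: (@open_comp _ _ (fun x : 'rV[R]_(n + n) => `|rsubmx x|) [set t | t < 2]).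
    move=> x _; apply: (@continuous_comp _ _ _ (fun x : 'rV[R]_(n + n) => rsubmx x)).
      exact: rsubmx_continuous.
    exact: norm_continuous.
  exact: open_lt.
- have oOm2 : open [set x : 'rV[R]_(n + n) | Om (lsubmx x)].
    by apply: open_comp oOm => x _; exact: lsubmx_continuous.
  move=> i k; case: (split_ordP i) => j ->.
    have -> : (fun z => double_field G z 0 (lshift n j)) = (fun z => G (lsubmx z) 0 j).
      by apply/funext => z; rewrite /double_field row_mxEl.
    by apply: (@Ck_on_lsub n n k Om (fun z => G z 0 j)) => //; exact: sG.
  have -> : (fun z => double_field G z 0 (rshift n j)) = (fun z => \sum_l
     z 0 (rshift n l) * 'D_(basis_vec l) (fun x => G x 0 j) (lsubmx z)).
    apply/funext => z; rewrite /double_field row_mxEr mxE.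
    by apply: eq_bigr => l _; rewrite rsub_row.
  apply: Ck_on_sum => // l _; apply: Ck_onM => //.
    exact: Ck_on_coord.
  apply: (@Ck_on_lsub n n k Om (fun z => 'D_(basis_vec l) (fun x => G x 0 j) z)) => //.
  exact: Ck_on_derive (sG j k.+1).
- move=> x Bx; apply: BOm => i; have := Bx (lshift n i).
  by rewrite !row_mxEl lsub_row.
move=> x [Dx vx]; have [z0 cz Bz] := ZP _ Dx; have [c1 c2 c3] := chiP (lsubmx x, rsubmx x) Dx.
have [cz1 cz2] := cz; have [c11 c12] := c1.
split.
- by rewrite z0 c2 hsubmxK.
- split=> [i|s s01 i]; case: (split_ordP i) => j ->.
  + by under eq_fun do rewrite row_mxEl; exact: cz1.
  + by under eq_fun do rewrite row_mxEr; exact: c11.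
  + under eq_fun do rewrite row_mxEl.
    by rewrite /double_field row_mxEl row_mxKl; exact: cz2.
  + under eq_fun do rewrite row_mxEr.
    by rewrite /double_field row_mxEr row_mxKl row_mxKr; exact: c12.
move=> s i; case: (split_ordP i) => j ->; first by rewrite !row_mxEl; exact: Bz.
rewrite !row_mxEr !mxE sub0r add0r.
have b : `|chi (lsubmx x, rsubmx x) s| <= gronwall_cst n K * 2.
  rewrite -c3; apply: le_trans (gronwall c1 K0 (lexx 0) _ (clamp_in s)) _.
    by move=> t t01; rewrite addr0; exact: HK.
  by rewrite addr0 c2; apply: ler_wpM2l; [exact/ltW/gronwall_cst_gt0 | exact: ltW].
by have := le_trans (coord_le _ j) b; rewrite ler_norml /= in_itv.
Qed.

(** The induction runs over all dimensions and all flows at once, since a partial derivative of Z is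
    a coordinate of the doubled flow started at (z, e_j). Order zero is the Lipschitz estimate. *)
Theorem flow_Ck k n Om D G c rho (Z : R -> 'rV[R]_n -> 'rV[R]_n) :
  flow_on Om D G c rho Z -> forall s, 0 <= s <= 1 -> forall i,
  Ck_on k D (fun z => Z s z 0 i).
Proof.
elim: k n Om D G c rho Z => [|k IH] n Om D G c rho Z flow s s01 i.
  have [oOm oD sG BOm ZP] := flow; have [C [C0 HC]] := flow_lip flow.
  split=> // z Dz.
  apply/(@cvgrPdist_lt _ _ _ _ (nbhs_filter z)) => e e0.
  have C1 : 0 < C + 1 by rewrite ltr_wpDl.
  near=> y.
  have Dy : D y by near: y; exact: open_nbhs_nbhs.
  have yz : `|z - y| < e / (C + 1).
    by near: y; apply: cvgr_dist_lt; [exact: cvg_id|rewrite divr_gt0].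
  apply: (@le_lt_trans _ _ `|Z s z - Z s y|).
    by have := coord_le (Z s z - Z s y) i; rewrite !mxE.
  apply: le_lt_trans (HC _ _ Dy Dz s s01) _.
  apply: (@le_lt_trans _ _ ((C + 1) * `|z - y|)); first by rewrite ler_wpM2r // lerDl.
  by rewrite mulrC -ltr_pdivlMr.
have [oOm oD sG BOm ZP] := flow.
have [rho2 [Z2 [flow2 dZ]]] := double_flow flow.
have C0 := IH _ _ _ _ _ _ _ flow s s01 i.
have e2 j : `|basis_vec j : 'rV[R]_n| < 2.
  by apply: le_lt_trans (norm_basis_vec _) _; rewrite ltr1n.
split; first by move=> z Dz; exact: Ck_on_cont C0 Dz.
move=> j; split; first by move=> z Dz; have [] := dZ z (basis_vec j) Dz (e2 j) s s01 i.
apply: (@Ck_on_eq R n k D (fun z => Z2 s (row_mx z (basis_vec j)) 0 (rshift n i))) => //.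
  by move=> z Dz; have [_ ->] := dZ z (basis_vec j) Dz (e2 j) s s01 i.
have [oOm2 oD2 _ _ _] := flow2.
apply: (@Ck_on_comp R (n + n) n k _ D (fun x => Z2 s x 0 (rshift n i))
  (fun z => row_mx z (basis_vec j)) oD2 oD).
- by move=> z Dz; rewrite /= row_mxKl row_mxKr; split=> //; exact: e2.
- move=> l; case: (split_ordP l) => l' ->.
    by under eq_fun do rewrite row_mxEl; exact: Ck_on_coord.
  by under eq_fun do rewrite row_mxEr; exact: Ck_on_cst.
exact: IH flow2 s s01 (rshift n i).
Unshelve. all: by end_near. Qed.

(** Composing G with the coordinatewise retraction [cl] onto a box makes it globally Lipschitz.
    Comparison with the constant solution z0 keeps every solution that starts close enough inside
    the box for the whole unit of time, and there the retraction changes nothing. *)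
Theorem flow_near_equilibrium n (Om : set 'rV[R]_n) (G : 'rV[R]_n -> 'rV[R]_n) z0 :
  open Om -> (forall i, smooth_on Om (fun z => G z 0 i)) -> Om z0 -> G z0 = 0 ->
  exists D c rho Z, D z0 /\ flow_on Om D G c rho Z.
Proof.
move=> oOm sG Oz0 Gz0.
have /nbhs_ballP[r /= r0 rOm] : nbhs z0 Om by exact: open_nbhs_nbhs.
pose r2 := r / 2.
have r20 : 0 < r2 by rewrite divr_gt0.
pose rho : 'rV[R]_n := const_mx r2.
have boxP z : box z0 rho z <-> `|z - z0| <= r2.
  split=> [Bz|zr i].
    apply: normv_le; first exact: ltW.
    move=> i; have := Bz i; rewrite /= in_itv /= !mxE ler_norml => /andP[a b].
    by apply/andP; split; lra.
  have := le_trans (coord_le _ i) zr; rewrite !mxE ler_norml => /andP[a b].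
  by rewrite /= in_itv /= ?mxE; apply/andP; split; lra.
have BOm : box z0 rho `<=` Om.
  move=> z /boxP zr; apply: rOm; rewrite -ball_normE /ball_ /= distrC.
  by apply: le_lt_trans zr _; rewrite /r2 ltr_pdivrMr // ltr_pMr // ltr1n.
have [K [K0 HK]] := field_lip oOm BOm sG.
pose cl (z : 'rV[R]_n) : 'rV[R]_n :=
  \row_i clip (z0 0 i - r2) (z0 0 i + r2) (z 0 i).
have Bcl z : box z0 rho (cl z).
  move=> i; rewrite /= in_itv /= !mxE; apply: clip_in.
  by rewrite lerD2l gt0_cp.
have clK z : box z0 rho z -> cl z = z.
  move=> Bz; apply/rowP => i; rewrite mxE clip_id //.
  by have := Bz i; rewrite /= in_itv /= !mxE.
have cll u v : `|cl u - cl v| <= `|u - v|.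
  apply: normv_le => // i; rewrite !mxE; apply: le_trans (clip_lip _ _ _ _) _.
  by have := coord_le (u - v) i; rewrite !mxE.
pose F (s : R) z := G (cl z).
have lF s u v : `|F s u - F s v| <= K * `|u - v|.
  apply: le_trans (HK _ _ (Bcl v) (Bcl u)) _.
  by apply: ler_wpM2l => //; exact: cll.
have cF : cont_field F.
  move=> y cy i s.
  apply: (@continuous_comp _ _ _ (fun s => y s) (fun z => G (cl z) 0 i)).
    by apply: (@cvg_coord _ _ _ _ _ _ (nbhs_filter s)) => j; exact: cy.
  apply: (@lipschitz_continuous _ _ _ K) => u v.
  apply: le_trans (lF 0 u v).
  by have := coord_le (F 0 u - F 0 v) i; rewrite !mxE.
have ex (z : 'rV[R]_n) := picard z cF K0 lF.
have [Z ZP] := choice ex.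
have g0 := gronwall_cst_gt0 n K.
(* [gronwall] magnifies the initial distance to z0 by at most [gronwall_cst n K], so trajectories
   starting in this ball remain within r2 of z0. *)
pose D : set 'rV[R]_n := ball z0 (r2 / gronwall_cst n K).
exists D, z0, rho, (fun s z => Z z s); split.
  by apply: ballxx; rewrite divr_gt0.
split=> //; first exact: ball_open.
move=> z Dz; have [c1 c2 c3] := ZP z.
have Bz s : box z0 rho (Z z s).
  apply/boxP; rewrite -c3.
  have cz0 : is_curve (fun=> z0) (fun=> 0 : 'rV[R]_n).
    split=> [i|t t01 i]; first by move=> t; exact: cst_continuous.
    by rewrite mxE; exact: is_derive_cst.
  apply: le_trans (gronwall (is_curveB c1 cz0) K0 (lexx 0) _ (clamp_in s)) _.
    move=> t t01; rewrite addr0 subr0 /F.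
    have -> : G (cl (Z z t)) = G (cl (Z z t)) - G z0 by rewrite Gz0 subr0.
    have Bz0 : box z0 rho z0 by apply/boxP; rewrite subrr normr0 ltW.
    apply: le_trans (HK _ _ Bz0 (Bcl _)) _; apply: ler_wpM2l => //.
    by rewrite -{1}(clK z0 Bz0); exact: cll.
  rewrite c2 addr0 mulrC -ler_pdivlMr //.
  by move: Dz; rewrite /D -ball_normE /ball_ /= distrC => /ltW.
split=> //.
have -> : (fun s => G (Z z s)) = (fun s => F s (Z z s)).
  by apply/funext => s; rewrite /F clK.
exact: c1.
Qed.

End Flow.

(** * The Frobenius theorem *)

Section MatrixDerivative.
Context {R : realType}.

Definition is_dmx (W : normedModType R) m r (x v : W) (F : W -> 'M[R]_(m, r))
    (dF : 'M[R]_(m, r)) : Prop :=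
  forall i j, is_derive x v (fun y => F y i j) (dF i j).

Section Rules.
Context {W : normedModType R} (x v : W).

Lemma is_dmx_cst m r (A : 'M[R]_(m, r)) : is_dmx x v (fun=> A) 0.
Proof. by move=> i j; rewrite mxE; exact: is_derive_cst. Qed.

Lemma is_dmxD m r (F G : W -> 'M[R]_(m, r)) dF dG :
  is_dmx x v F dF -> is_dmx x v G dG -> is_dmx x v (fun y => F y + G y) (dF + dG).
Proof.
move=> HF HG i j; rewrite mxE.
have -> : (fun y => (F y + G y) i j) = (fun y => F y i j) + (fun y => G y i j).
  by apply/funext => y; rewrite mxE.
exact: is_deriveD (HF i j) (HG i j).
Qed.

Lemma is_dmxN m r (F : W -> 'M[R]_(m, r)) dF :
  is_dmx x v F dF -> is_dmx x v (fun y => - F y) (- dF).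
Proof.
move=> HF i j; rewrite mxE.
have -> : (fun y => (- F y) i j) = - (fun y => F y i j).
  by apply/funext => y; rewrite mxE.
exact: is_deriveN (HF i j).
Qed.

Lemma is_dmxM m r s (F : W -> 'M[R]_(m, r)) (G : W -> 'M[R]_(r, s)) dF dG :
  is_dmx x v F dF -> is_dmx x v G dG ->
  is_dmx x v (fun y => F y *m G y) (dF *m G x + F x *m dG).
Proof.
move=> HF HG i j.
have -> : (fun y => (F y *m G y) i j) = \sum_k ((fun y => F y i k) * (fun y => G y k j)).
  by apply/funext => y; rewrite fct_sumE mxE.
rewrite !mxE -big_split /=.
apply: is_derive_sum => k.
have := is_deriveM (HF i k) (HG k j).
by rewrite /GRing.scale /= addrC [G x k j * _]mulrC.
Qed.

Lemma is_dmx_scale m r (a : W -> R) (da : R) (F : W -> 'M[R]_(m, r)) dF :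
  is_derive x v a da -> is_dmx x v F dF ->
  is_dmx x v (fun y => a y *: F y) (da *: F x + a x *: dF).
Proof.
move=> Ha HF i j; rewrite !mxE.
have -> : (fun y => (a y *: F y) i j) = a * (fun y => F y i j).
  by apply/funext => y; rewrite mxE.
have := is_deriveM Ha (HF i j).
by rewrite /GRing.scale /= addrC [F x i j * _]mulrC.
Qed.

Lemma is_dmx_tr m r (F : W -> 'M[R]_(m, r)) dF :
  is_dmx x v F dF -> is_dmx x v (fun y => (F y)^T) dF^T.
Proof.
move=> HF i j; rewrite mxE.
by have -> : (fun y => (F y)^T i j) = (fun y => F y j i) by apply/funext => y; rewrite mxE.
Qed.

Lemma is_dmx_row m r s (F : W -> 'M[R]_(m, r)) (G : W -> 'M[R]_(m, s)) dF dG :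
  is_dmx x v F dF -> is_dmx x v G dG ->
  is_dmx x v (fun y => row_mx (F y) (G y)) (row_mx dF dG).
Proof.
move=> HF HG i j; case: (split_ordP j) => k ->.
  rewrite row_mxEl.
  by have -> : (fun y => row_mx (F y) (G y) i (lshift s k)) = (fun y => F y i k)
    by apply/funext => y; rewrite row_mxEl.
rewrite row_mxEr.
by have -> : (fun y => row_mx (F y) (G y) i (rshift r k)) = (fun y => G y i k)
  by apply/funext => y; rewrite row_mxEr.
Qed.

Lemma is_dmx_lsub m r s (F : W -> 'M[R]_(m, r + s)) dF :
  is_dmx x v F dF -> is_dmx x v (fun y => lsubmx (F y)) (lsubmx dF).
Proof.
move=> HF i j; rewrite mxE.
by have -> : (fun y => lsubmx (F y) i j) = (fun y => F y i (lshift s j))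
  by apply/funext => y; rewrite mxE.
Qed.

Lemma is_dmx_rsub m r s (F : W -> 'M[R]_(m, r + s)) dF :
  is_dmx x v F dF -> is_dmx x v (fun y => rsubmx (F y)) (rsubmx dF).
Proof.
move=> HF i j; rewrite mxE.
by have -> : (fun y => rsubmx (F y) i j) = (fun y => F y i (rshift r j))
  by apply/funext => y; rewrite mxE.
Qed.

Lemma is_dmx_unique m r (F : W -> 'M[R]_(m, r)) dF dF' :
  is_dmx x v F dF -> is_dmx x v F dF' -> dF = dF'.
Proof.
by move=> H H'; apply/matrixP => i j; have [_ <-] := H i j; have [_ <-] := H' i j.
Qed.

End Rules.

Lemma is_dmx_id n (x v : 'rV[R]_n) : is_dmx x v id v.
Proof. by move=> i j; rewrite ord1; exact: is_derive_coord. Qed.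

Definition smooth_mxon n (V : set 'rV[R]_n) m r (F : 'rV[R]_n -> 'M[R]_(m, r)) : Prop :=
  forall i j, smooth_on V (fun x => F x i j).

Definition dmat n m r (F : 'rV[R]_n -> 'M[R]_(m, r)) (x a : 'rV[R]_n) : 'M[R]_(m, r) :=
  \matrix_(i, j) \sum_l a 0 l * 'D_(basis_vec l) (fun y => F y i j) x.

Lemma dmatZ n m r (F : 'rV[R]_n -> 'M[R]_(m, r)) x (c : R) a :
  dmat F x (c *: a) = c *: dmat F x a.
Proof.
apply/matrixP => i j; rewrite !mxE mulr_sumr; apply: eq_bigr => l _.
by rewrite !mxE mulrA.
Qed.

Lemma is_dmx_comp (W : normedModType R) n (V : set 'rV[R]_n) m r
    (F : 'rV[R]_n -> 'M[R]_(m, r)) (phi : W -> 'rV[R]_n) x v dphi :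
  open V -> V (phi x) -> smooth_mxon V F -> is_dmx x v phi dphi ->
  is_dmx x v (fun y => F (phi y)) (dmat F (phi x) dphi).
Proof.
move=> oV Vx sF dp i j; rewrite mxE.
exact: (is_derive_comp_C1 oV Vx (sF i j 1%N) (fun l => dp 0 l)).
Qed.

Lemma is_dmx_smooth n (V : set 'rV[R]_n) m r (F : 'rV[R]_n -> 'M[R]_(m, r)) x v :
  open V -> V x -> smooth_mxon V F -> is_dmx x v F (dmat F x v).
Proof. by move=> oV Vx sF; apply: is_dmx_comp oV Vx sF (is_dmx_id x v). Qed.

Section SmoothRules.
Context {n : nat} (V : set 'rV[R]_n) (oV : open V).

Lemma smooth_mxon_cst m r (A : 'M[R]_(m, r)) : smooth_mxon V (fun=> A).
Proof. by move=> i j k; exact: Ck_on_cst. Qed.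

Lemma smooth_mxonM m r s (F : 'rV[R]_n -> 'M[R]_(m, r)) (G : 'rV[R]_n -> 'M[R]_(r, s)) :
  smooth_mxon V F -> smooth_mxon V G -> smooth_mxon V (fun x => F x *m G x).
Proof.
move=> sF sG i j k.
have -> : (fun x => (F x *m G x) i j) = (fun x => \sum_l F x i l * G x l j).
  by apply/funext => x; rewrite mxE.
by apply: Ck_on_sum => // l _; apply: Ck_onM => //; [exact: sF|exact: sG].
Qed.

Lemma smooth_mxonD m r (F G : 'rV[R]_n -> 'M[R]_(m, r)) :
  smooth_mxon V F -> smooth_mxon V G -> smooth_mxon V (fun x => F x + G x).
Proof.
move=> sF sG i j k.
have -> : (fun x => (F x + G x) i j) = (fun x => F x i j + G x i j).
  by apply/funext => x; rewrite mxE.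
by apply: Ck_onD => //; [exact: sF|exact: sG].
Qed.

Lemma smooth_mxonN m r (F : 'rV[R]_n -> 'M[R]_(m, r)) :
  smooth_mxon V F -> smooth_mxon V (fun x => - F x).
Proof.
move=> sF i j k.
have -> : (fun x => (- F x) i j) = (fun x => - F x i j).
  by apply/funext => x; rewrite mxE.
by apply: Ck_onN => //; exact: sF.
Qed.

Lemma smooth_mxon_tr m r (F : 'rV[R]_n -> 'M[R]_(m, r)) :
  smooth_mxon V F -> smooth_mxon V (fun x => (F x)^T).
Proof.
move=> sF i j k.
have -> : (fun x => (F x)^T i j) = (fun x => F x j i) by apply/funext => x; rewrite mxE.
exact: sF.
Qed.

Lemma smooth_mxon_row m r s (F : 'rV[R]_n -> 'M[R]_(m, r)) (G : 'rV[R]_n -> 'M[R]_(m, s)) :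
  smooth_mxon V F -> smooth_mxon V G -> smooth_mxon V (fun x => row_mx (F x) (G x)).
Proof.
move=> sF sG i j k; case: (split_ordP j) => l ->.
  have -> : (fun x => row_mx (F x) (G x) i (lshift s l)) = (fun x => F x i l).
    by apply/funext => x; rewrite row_mxEl.
  exact: sF.
have -> : (fun x => row_mx (F x) (G x) i (rshift r l)) = (fun x => G x i l).
  by apply/funext => x; rewrite row_mxEr.
exact: sG.
Qed.

Lemma smooth_mxon_lsub m r s (F : 'rV[R]_n -> 'M[R]_(m, r + s)) :
  smooth_mxon V F -> smooth_mxon V (fun x => lsubmx (F x)).
Proof.
move=> sF i j k.
have -> : (fun x => lsubmx (F x) i j) = (fun x => F x i (lshift s j)).
  by apply/funext => x; rewrite mxE.
exact: sF.
Qed.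

Lemma smooth_mxon_rsub m r s (F : 'rV[R]_n -> 'M[R]_(m, r + s)) :
  smooth_mxon V F -> smooth_mxon V (fun x => rsubmx (F x)).
Proof.
move=> sF i j k.
have -> : (fun x => rsubmx (F x) i j) = (fun x => F x i (rshift r j)).
  by apply/funext => x; rewrite mxE.
exact: sF.
Qed.

Lemma smooth_mxon_id : smooth_mxon V (fun x : 'rV[R]_n => x).
Proof. by move=> i j k; rewrite ord1; exact: Ck_on_coord. Qed.

End SmoothRules.

Lemma smooth_mxon_comp n n' (V : set 'rV[R]_n) (W : set 'rV[R]_n') m r
    (F : 'rV[R]_n -> 'M[R]_(m, r)) (phi : 'rV[R]_n' -> 'rV[R]_n) :
  open V -> open W -> (forall x, W x -> V (phi x)) ->
  smooth_mxon W phi -> smooth_mxon V F -> smooth_mxon W (fun x => F (phi x)).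
Proof.
move=> oV oW WV sp sF i j k.
by apply: (@Ck_on_comp R n n' k V W (fun y => F y i j) phi) => // [l|]; [exact: sp|exact: sF].
Qed.

Lemma dfield_unique n (V : set 'rV[R]_n) (G : 'rV[R]_n -> 'rV[R]_n) x v dG :
  open V -> V x -> smooth_mxon V G -> is_dmx x v G dG -> dfield G x v = dG.
Proof.
move=> oV Vx sG HG.
rewrite -(is_dmx_unique (is_dmx_smooth v oV Vx sG) HG).
by apply/matrixP => i j; rewrite !mxE ord1.
Qed.

Lemma is_derive_affine (W W' : normedModType R) (A : W' -> W) (f : W -> R) x v d df :
  (forall h : R, A (h *: v + x) = h *: d + A x) -> is_derive (A x) d f df ->
  is_derive x v (f \o A) df.
Proof.
move=> HA [d1 d2].
have E : (fun h : R => h^-1 *: (((f \o A) \o shift x) (h *: v) - (f \o A) x)) =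
  (fun h : R => h^-1 *: ((f \o shift (A x)) (h *: d) - f (A x))).
  by apply/funext => h /=; rewrite HA.
by apply: DeriveDef; [rewrite /derivable E | rewrite /derive E].
Qed.

End MatrixDerivative.

(** * Leaves and potentials from commuting fields *)

Section Frobenius.
Context {R : realType} {n : nat}.
Variables (V : set 'rV[R]_n) (Pi : 'rV[R]_n -> 'M[R]_n) (om : 'rV[R]_n -> 'rV[R]_n).
Hypotheses (oV : open V) (sPi : smooth_mxon V Pi) (som : smooth_mxon V om).

(* The vector fields [x |-> w *m Pi x], for constant [w], commute. *)
Hypothesis comm : forall x, V x -> forall v w : 'rV[R]_n,
  w *m dmat Pi x (v *m Pi x) = v *m dmat Pi x (w *m Pi x).

(* The restriction of the one-form [om] to the image of [Pi] is closed. *)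
Hypothesis closed : forall x, V x -> forall v w : 'rV[R]_n,
  v *m Pi x *m (dmat om x (w *m Pi x))^T = w *m Pi x *m (dmat om x (v *m Pi x))^T.

Local Notation N := (n + (n + 1))%N.
Local Notation pos x := (lsubmx (x : 'rV[R]_N)).
Local Notation vel x := (lsubmx (rsubmx (x : 'rV[R]_N))).

(* The equations [z' = w *m Pi z], [w' = 0], [zeta' = w *m Pi z *m (om z)^T]
   for a path in a leaf and the integral of [om] along it. *)
Definition leaf_field (x : 'rV[R]_N) : 'rV[R]_N :=
  row_mx (vel x *m Pi (pos x))
    (row_mx 0 (vel x *m Pi (pos x) *m (om (pos x))^T)).

Let Om : set 'rV[R]_N := [set x | V (pos x)].

Let oOm : open Om.
Proof. by apply: open_comp oV => x _; exact: lsubmx_continuous. Qed.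

Let spos : smooth_mxon Om (fun x : 'rV[R]_N => pos x).
Proof. by apply: smooth_mxon_lsub; exact: smooth_mxon_id. Qed.

Let svel : smooth_mxon Om (fun x : 'rV[R]_N => vel x).
Proof. by apply: smooth_mxon_lsub; apply: smooth_mxon_rsub; exact: smooth_mxon_id. Qed.

Lemma leaf_field_smooth : smooth_mxon Om leaf_field.
Proof.
have sP : smooth_mxon Om (fun x : 'rV[R]_N => Pi (pos x)).
  exact: (smooth_mxon_comp oV oOm _ spos sPi).
have so : smooth_mxon Om (fun x : 'rV[R]_N => om (pos x)).
  exact: (smooth_mxon_comp oV oOm _ spos som).
apply: smooth_mxon_row; first exact: smooth_mxonM.
apply: smooth_mxon_row; first exact: smooth_mxon_cst.
by apply: smooth_mxonM => //; [exact: smooth_mxonM | exact: smooth_mxon_tr].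
Qed.

Lemma dfield_leaf (x : 'rV[R]_N) (a b : 'rV[R]_n) (c : 'rV[R]_1) : Om x ->
  dfield leaf_field x (row_mx a (row_mx b c)) =
  row_mx (b *m Pi (pos x) + vel x *m dmat Pi (pos x) a)
    (row_mx 0 ((b *m Pi (pos x) + vel x *m dmat Pi (pos x) a) *m (om (pos x))^T
        + vel x *m Pi (pos x) *m (dmat om (pos x) a)^T)).
Proof.
move=> Ox; apply: (dfield_unique oOm Ox leaf_field_smooth).
have dpos : is_dmx x (row_mx a (row_mx b c)) (fun x : 'rV[R]_N => pos x) a.
  have := is_dmx_lsub (is_dmx_id x (row_mx a (row_mx b c))); by rewrite row_mxKl.
have dvel : is_dmx x (row_mx a (row_mx b c)) (fun x : 'rV[R]_N => vel x) b.
  have := is_dmx_lsub (is_dmx_rsub (is_dmx_id x (row_mx a (row_mx b c)))).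
  by rewrite row_mxKr row_mxKl.
have dP := is_dmx_comp oV Ox sPi dpos.
have do_ := is_dmx_comp oV Ox som dpos.
have dw := is_dmxM dvel dP.
apply: is_dmx_row => //; apply: is_dmx_row; first exact: is_dmx_cst.
exact: is_dmxM dw (is_dmx_tr do_).
Qed.

Section Variation.
Variables (D : set 'rV[R]_N) (c rho : 'rV[R]_N) (Z : R -> 'rV[R]_N -> 'rV[R]_N).
Hypothesis flow : flow_on Om D leaf_field c rho Z.

(** The linearised equation is solved explicitly by [chi]. If the initial point is moved by l X Pi
    and the coefficient vector by k X, then the point at time s moves by (l + k s) X Pi, thanks to
    [comm], and the integral of [om] changes by a boundary term, thanks to [closed]. The choice (l,
    k) = (0, 1) gives leaves, and (1, -1), which fixes the end point, gives potentials. *)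
Lemma leaf_variation (x : 'rV[R]_N) (X : 'rV[R]_n) (l k : R) : D x ->
  is_dmx x (row_mx (l *: (X *m Pi (pos x))) (row_mx (k *: X) 0)) (Z 1)
    (row_mx ((l + k) *: (X *m Pi (pos (Z 1 x))))
      (row_mx (k *: X) ((l + k) *: (X *m Pi (pos (Z 1 x)) *m (om (pos (Z 1 x)))^T)
         - l *: (X *m Pi (pos x) *m (om (pos x))^T)))).
Proof.
move=> Dx; have [_ oD sG BOm ZP] := flow.
have [z0 cz Bz] := ZP x Dx.
have Oz s : Om (Z s x) by exact: BOm (Bz s).
pose q s : 'rV[R]_1 := X *m Pi (pos (Z s x)) *m (om (pos (Z s x)))^T.
pose chi s : 'rV[R]_N := row_mx ((l + k * s) *: (X *m Pi (pos (Z s x))))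
   (row_mx (k *: X) ((l + k * s) *: q s - l *: q 0)).
have cZ : continuous (fun s => Z s x).
  move=> s; apply: (@cvg_coord _ _ _ _ _ _ (nbhs_filter s)) => i.
  by have [h _] := cz; exact: h.
have cpos (f : 'rV[R]_n -> R) : smooth_on V f -> continuous (fun s => f (pos (Z s x))).
  move=> sf s; apply: (@continuous_comp _ _ _ (fun s => pos (Z s x)) f).
    apply: (@continuous_comp _ _ _ (fun s => Z s x) (fun y => pos y)); first exact: cZ.
    exact: lsubmx_continuous.
  exact: Ck_on_cont (sf 0%N) (Oz s).
have sXP : smooth_mxon V (fun z => X *m Pi z).
  by apply: smooth_mxonM => //; exact: smooth_mxon_cst.
have sq : smooth_mxon V (fun z => X *m Pi z *m (om z)^T).
  by apply: smooth_mxonM => //; exact: smooth_mxon_tr.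
have cXP i : continuous (fun s => (X *m Pi (pos (Z s x))) 0 i).
  exact: (cpos (fun z => (X *m Pi z) 0 i) (sXP 0 i)).
have cq i j : continuous (fun s => q s i j).
  exact: (cpos (fun z => (X *m Pi z *m (om z)^T) i j) (sq i j)).
have clk : continuous (fun s : R => l + k * s).
  move=> s; apply: (@continuousD _ _ _ (cst l) (fun s => k * s)); first exact: cst_continuous.
  by have [d _] := is_derive_mull k s; exact/differentiable_continuous/derivable1_diffP.
have cchi : is_curve chi (fun s => dfield leaf_field (Z s x) (chi s)).
  split=> [i s|s s01].
    case: (split_ordP i) => j ->; last case: (split_ordP j) => j' ->.
    - have -> : (fun s => chi s 0 (lshift (n + 1) j)) =
         (fun s => l + k * s) * (fun s => (X *m Pi (pos (Z s x))) 0 j).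
        by apply/funext => t; rewrite row_mxEl mxE.
      exact: continuousM (clk s) (cXP j s).
    - have -> : (fun s => chi s 0 (rshift n (lshift 1 j'))) = (fun=> (k *: X) 0 j').
        by apply/funext => t; rewrite row_mxEr row_mxEl.
      exact: cst_continuous.
    - have -> : (fun s => chi s 0 (rshift n (rshift n j'))) =
         (fun s => l + k * s) * (fun s => q s 0 j') - (cst ((l *: q 0) 0 j')).
        apply/funext => t; rewrite row_mxEr row_mxEr.
        by rewrite [LHS]mxE [X in X + _ = _]mxE [X in _ + X = _]mxE.
      apply: continuousB; last exact: cst_continuous.
      exact: continuousM (clk s) (cq 0 j' s).
  suff : is_dmx s 1 chi (dfield leaf_field (Z s x) (chi s)) by move=> H i; exact: H.
  have dZ : is_dmx s 1 (fun s => Z s x) (leaf_field (Z s x)).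
    by move=> i j; rewrite ord1; have [_ h] := cz; exact: h.
  have dpos : is_dmx s 1 (fun s => pos (Z s x)) (vel (Z s x) *m Pi (pos (Z s x))).
    by have := is_dmx_lsub dZ; rewrite /leaf_field row_mxKl.
  have dP := is_dmx_comp (phi := fun s : R => pos (Z s x)) oV (Oz s) sPi dpos.
  have do_ := is_dmx_comp (phi := fun s : R => pos (Z s x)) oV (Oz s) som dpos.
  have dXP := is_dmxM (is_dmx_cst s 1 X) dP.
  have dq := is_dmxM dXP (is_dmx_tr do_).
  have dlk : is_derive s 1 (fun s : R => l + k * s) k.
    rewrite -[k in X in is_derive _ _ _ X]add0r.
    exact: (is_deriveD (is_derive_cst l s 1) (is_derive_mull k s)).
  have d1 := is_dmx_scale dlk dXP.
  have d2 := is_dmxD (is_dmx_scale dlk dq) (is_dmx_cst s 1 (- (l *: q 0))).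
  have d3 := is_dmx_row d1 (is_dmx_row (is_dmx_cst s 1 (k *: X)) d2).
  rewrite mul0mx add0r addr0 in d3.
  rewrite /chi dfield_leaf; last exact: Oz.
  set z := lsubmx (Z s x); set w := lsubmx (rsubmx (Z s x)).
  (* [comm] exchanges the coefficient vector w with X, and in the next equation [closed] does the
     same for the form; both sides then agree with the product rule for [chi]. *)
  have E1 : k *: X *m Pi z + w *m dmat Pi z ((l + k * s) *: (X *m Pi z)) =
      k *: (X *m Pi z) + (l + k * s) *: (X *m dmat Pi z (w *m Pi z)).
    by rewrite dmatZ -scalemxAl -scalemxAr (comm (Oz s)).
  have E2 : w *m Pi z *m (dmat om z ((l + k * s) *: (X *m Pi z)))^T =
      (l + k * s) *: (X *m Pi z *m (dmat om z (w *m Pi z))^T).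
    by rewrite dmatZ linearZ /= -scalemxAr (closed (Oz s)).
  rewrite E1 E2 mulmxDl -!scalemxAl -addrA -scalerDr.
  exact: d3.
have chi0 : chi 0 = row_mx (l *: (X *m Pi (pos x))) (row_mx (k *: X) 0).
  by rewrite /chi /q z0 mulr0 addr0 subrr.
have s1 : 0 <= (1 : R) <= 1 by rewrite ler01 lexx.
have H := flow_derive flow Dx cchi chi0 s1.
move=> i j; rewrite ord1; have := H j.
by rewrite /chi /q mulr1 z0.
Qed.

End Variation.

(** The field vanishes where the coefficient vector is zero, so (u0, 0) is an equilibrium;
    uniqueness, as [gronwall] with b = 0, makes it a fixed point of the time-one map. *)
Lemma leaf_flow (u0 : 'rV[R]_n) : V u0 -> exists D c rho Z,
  [/\ D (row_mx u0 0), flow_on Om D leaf_field c rho Z & Z 1 (row_mx u0 0) = row_mx u0 0].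
Proof.
move=> Vu0.
have G0 : leaf_field (row_mx u0 0) = 0.
  by rewrite /leaf_field row_mxKr linear0 !mul0mx !row_mx0.
have sG i : smooth_on Om (fun z => leaf_field z 0 i) by exact: leaf_field_smooth.
have Ou0 : Om (row_mx u0 0) by rewrite /Om /= row_mxKl.
have [D [c [rho [Z [Du0 flow]]]]] := flow_near_equilibrium oOm sG Ou0 G0.
exists D, c, rho, Z; split=> //.
have [_ oD _ BOm ZP] := flow.
have [z0 cz Bz] := ZP _ Du0.
have [K [K0 HK]] := field_lip oOm BOm sG.
have cz0 : is_curve (fun=> row_mx u0 0 : 'rV[R]_N) (fun=> 0).
  split=> [i|t t01 i]; first by move=> t; exact: cst_continuous.
  exact: (is_dmx_cst t 1 (row_mx u0 0 : 'rV[R]_N) 0 i).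
have s1 : 0 <= (1 : R) <= 1 by rewrite ler01 lexx.
have := gronwall (is_curveB cz cz0) K0 (lexx 0) _ s1.
rewrite z0 subrr normr0 addr0 mulr0 normr_le0 subr_eq0 => H; apply/eqP; apply: H => t t01.
rewrite addr0 subr0 -[leaf_field _]subr0 -{1}G0; apply: HK => //.
by have := Bz 0; rewrite z0.
Qed.

(** The leaf is parametrised like an exponential map: f u is the end point at time 1 of the path
    that starts at u0 with coefficient vector [u *m B]. *)
Lemma frobenius_leaf r (u0 : 'rV[R]_n) (B : 'M[R]_(r, n)) : V u0 ->
  exists (D : set 'rV[R]_r) (f : 'rV[R]_r -> 'rV[R]_n),
    [/\ open D, D 0, f 0 = u0, smooth_mxon D f & forall u, D u -> V (f u) /\
        forall i, is_dmx u (basis_vec i) f (row i B *m Pi (f u))].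
Proof.
move=> Vu0; have [D [c [rho [Z [Du0 flow Z1]]]]] := leaf_flow Vu0.
have [_ oD _ BOm ZP] := flow.
pose A (u : 'rV[R]_r) : 'rV[R]_N := row_mx u0 (row_mx (u *m B) 0).
have A0 : A 0 = row_mx u0 0 by rewrite /A mul0mx row_mx0.
have sA (W : set 'rV[R]_r) : open W -> smooth_mxon W A.
  move=> oW; apply: smooth_mxon_row; first exact: smooth_mxon_cst.
  apply: smooth_mxon_row; last exact: smooth_mxon_cst.
  by apply: (smooth_mxonM oW); [exact: smooth_mxon_id|exact: smooth_mxon_cst].
have cA : continuous A.
  move=> u; apply: (@cvg_coord _ _ _ _ _ _ (nbhs_filter u)) => i.
  have Tu : [set: 'rV[R]_r] u by [].
  exact: Ck_on_cont (sA _ openT 0 i 0%N) Tu.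
have oDA : open (A @^-1` D) by apply: open_comp oD => u _; exact: cA.
exists (A @^-1` D), (fun u => lsubmx (Z 1 (A u))).
have s1 : 0 <= (1 : R) <= 1 by rewrite ler01 lexx.
split=> //.
- by rewrite /= A0.
- by rewrite A0 Z1 row_mxKl.
- apply: smooth_mxon_lsub.
  apply: (smooth_mxon_comp oD oDA _ (sA _ oDA)) => // i j k.
  by rewrite ord1; exact: flow_Ck flow _ s1 j.
move=> u Du; split; first by have [_ _ Bz] := ZP _ Du; exact: BOm (Bz 1).
move=> i.
have := leaf_variation flow (row i B) 0 1 Du.
rewrite !scale0r !add0r !scale1r => dZ.
suff H : is_dmx u (basis_vec i) (fun u => Z 1 (A u))
    (row_mx (row i B *m Pi (lsubmx (Z 1 (A u))))
      (row_mx (row i B) (row i B *m Pi (lsubmx (Z 1 (A u))) *m (om (lsubmx (Z 1 (A u))))^T - 0))).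
  by have := is_dmx_lsub H; rewrite row_mxKl.
move=> i' j'; apply: (is_derive_affine _ (dZ i' j')) => h.
rewrite /A mulmxDl -scalemxAl -rowE !scale_row_mx !scaler0 !add_row_mx add0r.
by rewrite addr0.
Qed.

(** sigma x is minus the integral of [om] along the path from x with coefficient vector u0 - x. If x
    moves by a vector X of the distribution, the coefficient vector moves by -X; to first order the
    end point stays fixed and the integral changes by minus the value of [om] on X. *)
Lemma frobenius_potential (u0 : 'rV[R]_n) : V u0 ->
  exists (D : set 'rV[R]_n) (sigma : 'rV[R]_n -> R),
    [/\ open D, D u0, D `<=` V, smooth_on D sigma & forall x, D x ->
        forall X : 'rV[R]_n, X *m Pi x = X ->
        'D_X sigma x = (X *m (om x)^T) 0 0].
Proof.
move=> Vu0; have [D [c [rho [Z [Du0 flow Z1]]]]] := leaf_flow Vu0.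
have [_ oD _ BOm ZP] := flow.
pose A (x : 'rV[R]_n) : 'rV[R]_N := row_mx x (row_mx (u0 - x) 0).
have A0 : A u0 = row_mx u0 0 by rewrite /A subrr row_mx0.
have sA (W : set 'rV[R]_n) : open W -> smooth_mxon W A.
  move=> oW; apply: smooth_mxon_row; first exact: smooth_mxon_id.
  apply: smooth_mxon_row; last exact: smooth_mxon_cst.
  apply: (smooth_mxonD oW); first exact: smooth_mxon_cst.
  by apply: (smooth_mxonN oW); exact: smooth_mxon_id.
have cA : continuous A.
  move=> u; apply: (@cvg_coord _ _ _ _ _ _ (nbhs_filter u)) => i.
  have Tu : [set: 'rV[R]_n] u by [].
  exact: Ck_on_cont (sA _ openT 0 i 0%N) Tu.
have oDA : open (A @^-1` D) by apply: open_comp oD => u _; exact: cA.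
exists (A @^-1` D), (fun x => - (rsubmx (rsubmx (Z 1 (A x)))) 0 0).
have s1 : 0 <= (1 : R) <= 1 by rewrite ler01 lexx.
split=> //.
- by rewrite /= A0.
- move=> x Dx; have [z0 _ Bz] := ZP _ Dx.
  by have := BOm _ (Bz 0); rewrite z0 /Om /= /A row_mxKl.
- move=> k; apply: Ck_onN => //.
  have H : smooth_mxon (A @^-1` D) (fun x => rsubmx (rsubmx (Z 1 (A x)))).
    apply: smooth_mxon_rsub; apply: smooth_mxon_rsub.
    apply: (smooth_mxon_comp oD oDA _ (sA _ oDA)) => // i j l.
    by rewrite ord1; exact: flow_Ck flow _ s1 j.
  exact: H.
move=> x Dx X XP.
have := leaf_variation flow X 1 (-1) Dx.
have -> : lsubmx (A x) = x by rewrite /A row_mxKl.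
rewrite XP !scale1r scaleN1r subrr !scale0r sub0r => dZ.
have dA : is_dmx x X (fun x => Z 1 (A x))
    (row_mx 0 (row_mx (- X) (- (X *m (om x)^T)))).
  move=> i' j'; apply: (is_derive_affine _ (dZ i' j')) => h.
  rewrite /A !scale_row_mx !scaler0 !add_row_mx addr0.
  by congr (row_mx _ (row_mx _ _)); rewrite scalerN opprD addrCA addrA.
have := is_dmx_rsub (is_dmx_rsub dA); rewrite !row_mxKr => H.
have [d E] := is_deriveN (H 0 0).
by rewrite E mxE opprK.
Qed.

End Frobenius.

(** * Calculus in charts *)

Section SmoothInverse.
Context {R : realType} {n : nat} (V : set 'rV[R]_n) (oV : open V).

Lemma smooth_det m (A : 'rV[R]_n -> 'M[R]_m) :
  smooth_mxon V A -> smooth_on V (fun x => \det (A x)).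
Proof.
move=> sA k; apply: Ck_on_sum => // s _; apply: Ck_onM => //; first exact: Ck_on_cst.
by apply: Ck_on_prod => // i _; exact: sA.
Qed.

Lemma smooth_mxon_inv m (A : 'rV[R]_n -> 'M[R]_m) :
  (forall x, V x -> A x \in unitmx) ->
  smooth_mxon V A -> smooth_mxon V (fun x => invmx (A x)).
Proof.
move=> uA sA i j k.
apply: (@Ck_on_eq R n k V (fun x => (\det (A x))^-1 * \adj (A x) i j)) => //.
  by move=> x Vx; rewrite /invmx uA // [RHS]mxE.
apply: Ck_onM => //.
  apply: Ck_onV => //; last exact: smooth_det.
  by move=> x Vx; have := uA x Vx; rewrite unitmxE unitfE.
have -> : (fun x => \adj (A x) i j) =
  (fun x => (-1) ^+ (j + i) * \det (row' j (col' i (A x)))).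
  by apply/funext => x; rewrite mxE.
apply: Ck_onM => //; first exact: Ck_on_cst.
apply: (@smooth_det _ (fun x => row' j (col' i (A x)))) => i' j' l.
have -> : (fun x => row' j (col' i (A x)) i' j') = (fun x => A x (lift j i') (lift i j')).
  by apply/funext => x; rewrite !mxE.
exact: sA.
Qed.

Lemma smooth_mxon_scale m r (f : 'rV[R]_n -> R) (F : 'rV[R]_n -> 'M[R]_(m, r)) :
  smooth_on V f -> smooth_mxon V F -> smooth_mxon V (fun x => f x *: F x).
Proof.
move=> sf sF i j k.
have -> : (fun x => (f x *: F x) i j) = (fun x => f x * F x i j).
  by apply/funext => x; rewrite mxE.
by apply: Ck_onM => //; exact: sF.
Qed.

End SmoothInverse.

Section ChartCalculus.
Context {R : realType} {n : nat} {M : smoothManifold R n}.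
Implicit Types (a b : chart_index M) (x : M) (W : set M) (v : 'rV[R]_n).

Lemma paramK a x : cdom a x -> cparam a (ccoo a x) = x.
Proof. exact: cooK. Qed.

Lemma img_param a W u : W `<=` cdom a -> (ccoo a @` W) u ->
  W (cparam a u) /\ ccoo a (cparam a u) = u.
Proof. by move=> Wa [x Wx <-]; rewrite paramK //; exact: Wa. Qed.

Lemma img_coo a W x : W x -> (ccoo a @` W) (ccoo a x).
Proof. by move=> Wx; exists x. Qed.

(** Inside the open image of the chart, the image of W is the preimage of W under the continuous
    parametrisation. *)
Lemma img_open_sub a W : open W -> W `<=` cdom a -> open (ccoo a @` W).
Proof.
move=> oW Wa.
have -> : ccoo a @` W = (ccoo a @` cdom a) `&` (cparam a @^-1` W).
  apply/seteqP; split=> [u Wu|u [Du /= Wu]].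
    by have [Wpu E] := img_param Wa Wu; split=> //; exists (cparam a u) => //; exact: Wa.
  exists (cparam a u) => //.
  by have [|_ ->] := @img_param a (cdom a) u _ Du.
rewrite openE => u [Du Wu]; apply: filterI.
  by apply: open_nbhs_nbhs; split=> //; exact: (@img_open _ _ _ (atlas a)).
have := @param_continuous _ _ _ (atlas a) u Du.
by apply; exact: open_nbhs_nbhs.
Qed.

Lemma preimage_open a (D : set 'rV[R]_n) : open D -> open (cdom a `&` ccoo a @^-1` D).
Proof.
move=> oD; rewrite openE => x [Dx Cx]; apply: filterI.
  by apply: open_nbhs_nbhs; split=> //; exact: (@dom_open _ _ _ (atlas a)).
have := @coo_continuous _ _ _ (atlas a) x Dx.
by apply; exact: open_nbhs_nbhs.
Qed.

Lemma cdom_open a : open (cdom a).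
Proof. exact: (@dom_open _ _ _ (atlas a)). Qed.

Definition mder a v m r (F : M -> 'M[R]_(m, r)) x : 'M[R]_(m, r) :=
  \matrix_(i, j) dir a v (fun y => F y i j) x.

Section InChart.
Variables (a : chart_index M) (W : set M).
Hypotheses (oW : open W) (Wa : W `<=` cdom a).

Let V := ccoo a @` W.
Let oV : open V := img_open_sub oW Wa.

Lemma smooth_in_cst (c : R) : smooth_in a W (fun=> c).
Proof. by move=> k; exact: Ck_on_cst. Qed.

Lemma smooth_inD f g : smooth_in a W f -> smooth_in a W g -> smooth_in a W (fun x => f x + g x).
Proof. by move=> sf sg k; apply: (Ck_onD oV); [exact: sf|exact: sg]. Qed.

Lemma smooth_inM f g : smooth_in a W f -> smooth_in a W g -> smooth_in a W (fun x => f x * g x).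
Proof. by move=> sf sg k; apply: (Ck_onM oV); [exact: sf|exact: sg]. Qed.

Lemma smooth_inN f : smooth_in a W f -> smooth_in a W (fun x => - f x).
Proof. by move=> sf k; apply: (Ck_onN oV); exact: sf. Qed.

Lemma smooth_inB f g : smooth_in a W f -> smooth_in a W g -> smooth_in a W (fun x => f x - g x).
Proof. by move=> sf sg; apply: smooth_inD => //; exact: smooth_inN. Qed.

Lemma smooth_in_sum (I : Type) (r : seq I) (P : pred I) (F : I -> M -> R) :
  (forall i, P i -> smooth_in a W (F i)) ->
  smooth_in a W (fun x => \sum_(i <- r | P i) F i x).
Proof.
move=> sF k.
by apply: (Ck_on_sum (F := fun i u => F i (cparam a u)) _ oV) => i Pi; exact: sF.
Qed.

Lemma smooth_inV f : (forall x, W x -> f x != 0) -> smooth_in a W f ->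
  smooth_in a W (fun x => (f x)^-1).
Proof.
move=> f0 sf k; apply: (Ck_onV oV); last exact: sf.
by move=> u /(img_param Wa)[/f0].
Qed.

Lemma smooth_in_exp f : smooth_in a W f -> smooth_in a W (fun x => expR (f x)).
Proof. by move=> sf k; apply: (Ck_on_exp oV); exact: sf. Qed.

Lemma smooth_in_ln f : (forall x, W x -> 0 < f x) -> smooth_in a W f ->
  smooth_in a W (fun x => ln (f x)).
Proof.
move=> f0 sf k; apply: (Ck_on_ln oV); last exact: sf.
by move=> u /(img_param Wa)[/f0].
Qed.

Lemma eq_smooth_in f g : (forall x, W x -> f x = g x) ->
  smooth_in a W f -> smooth_in a W g.
Proof.
move=> fg sf k; apply: (Ck_on_eq oV _ (sf k)).
by move=> u /(img_param Wa)[/fg].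
Qed.

Lemma smooth_in_dir v f : smooth_in a W f -> smooth_in a W (fun x => dir a v f x).
Proof.
move=> sf k.
apply: (@Ck_on_eq _ _ k V (fun u => \sum_i v 0 i * 'D_(basis_vec i) (f \o cparam a) u)) => //.
  move=> u Vu; have [Wu E] := img_param Wa Vu.
  by rewrite /= /dir E (derive_C1 _ oV Vu (sf 1%N)).
apply: Ck_on_sum => // i _; apply: Ck_onM => //; first exact: Ck_on_cst.
by apply: Ck_on_derive; exact: sf k.+1.
Qed.

Lemma smooth_in_pd i f : smooth_in a W f -> smooth_in a W (fun x => pd a i f x).
Proof. exact: smooth_in_dir. Qed.

Lemma is_derive_dir v f x : W x -> smooth_in a W f ->
  is_derive (ccoo a x) v (f \o cparam a) (dir a v f x).
Proof.
move=> Wx sf; have := is_derive_C1 v oV (img_coo a Wx) (sf 1%N).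
by move=> [d E]; apply: DeriveDef.
Qed.

Lemma dirE v f x : W x -> smooth_in a W f -> dir a v f x = \sum_i v 0 i * pd a i f x.
Proof. by move=> Wx sf; exact: derive_C1 oV (img_coo a Wx) (sf 1%N). Qed.

Lemma dir_eq v f g x : W x -> (forall y, W y -> f y = g y) -> dir a v f x = dir a v g x.
Proof.
move=> Wx fg; apply: near_eq_derive.
apply: (open_near oV (img_coo a Wx)) => u /(img_param Wa)[Wu _] /=; exact: fg.
Qed.

Lemma dir_cst v (c : R) x : dir a v (fun=> c) x = 0.
Proof. exact: derive_cst. Qed.

Lemma dirD v f g x : W x -> smooth_in a W f -> smooth_in a W g ->
  dir a v (fun y => f y + g y) x = dir a v f x + dir a v g x.
Proof.
move=> Wx sf sg.
by have [_ E] := is_deriveD (is_derive_dir v Wx sf) (is_derive_dir v Wx sg).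
Qed.

Lemma dirN v f x : W x -> smooth_in a W f -> dir a v (fun y => - f y) x = - dir a v f x.
Proof. by move=> Wx sf; have [_ E] := is_deriveN (is_derive_dir v Wx sf). Qed.

Lemma dirB v f g x : W x -> smooth_in a W f -> smooth_in a W g ->
  dir a v (fun y => f y - g y) x = dir a v f x - dir a v g x.
Proof.
by move=> Wx sf sg; rewrite dirD ?dirN //; exact: smooth_inN.
Qed.

Lemma dirM v f g x : W x -> smooth_in a W f -> smooth_in a W g ->
  dir a v (fun y => f y * g y) x = dir a v f x * g x + f x * dir a v g x.
Proof.
move=> Wx sf sg.
have [_ E] := is_deriveM (is_derive_dir v Wx sf) (is_derive_dir v Wx sg).
rewrite [LHS]E /= paramK; last exact: Wa.
by rewrite /GRing.scale /= addrC [g x * _]mulrC.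
Qed.

Lemma dir_sum v (I : finType) (F : I -> M -> R) x : W x ->
  (forall i, smooth_in a W (F i)) ->
  dir a v (fun y => \sum_i F i y) x = \sum_i dir a v (F i) x.
Proof.
move=> Wx sF.
elim: (index_enum I) => [|i r IH].
  rewrite big_nil -[RHS](dir_cst v 0 x).
  by congr (dir a v _ x); apply/funext => y; rewrite big_nil.
rewrite big_cons -IH -dirD //; last exact: smooth_in_sum.
by congr (dir a v _ x); apply/funext => y; rewrite big_cons.
Qed.

Lemma dir_exp v f x : W x -> smooth_in a W f ->
  dir a v (fun y => expR (f y)) x = expR (f x) * dir a v f x.
Proof.
move=> Wx sf.
have [_ E] := is_derive_chain1 (is_derive_expR _) (is_derive_dir v Wx sf).
by rewrite [LHS]E /= paramK //; exact: Wa.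
Qed.

Lemma pdC i j f x : W x -> smooth_in a W f ->
  pd a i (fun y => pd a j f y) x = pd a j (fun y => pd a i f y) x.
Proof.
move=> Wx sf.
have E k l : pd a k (fun y => pd a l f y) x =
    'D_(basis_vec k) (fun z => 'D_(basis_vec l) (f \o cparam a) z) (ccoo a x).
  apply: near_eq_derive; apply: (open_near oV (img_coo a Wx)) => u /(img_param Wa)[Wu Eu] /=.
  by rewrite /pd /dir Eu.
by rewrite !E; exact: Schwarz oV (img_coo a Wx) (sf 2%N).
Qed.

Section Matrices.
Context {m r s : nat}.

Lemma smooth_mx_cst (A : 'M[R]_(m, r)) : smooth_mx a W (fun=> A).
Proof. by move=> i j; exact: smooth_in_cst. Qed.

Lemma smooth_mxM (F : M -> 'M[R]_(m, r)) (G : M -> 'M[R]_(r, s)) :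
  smooth_mx a W F -> smooth_mx a W G -> smooth_mx a W (fun x => F x *m G x).
Proof. exact: (@smooth_mxonM R n V oV m r s (F \o cparam a) (G \o cparam a)). Qed.

Lemma smooth_mxD (F G : M -> 'M[R]_(m, r)) :
  smooth_mx a W F -> smooth_mx a W G -> smooth_mx a W (fun x => F x + G x).
Proof. exact: (@smooth_mxonD R n V oV m r (F \o cparam a) (G \o cparam a)). Qed.

Lemma smooth_mxN (F : M -> 'M[R]_(m, r)) :
  smooth_mx a W F -> smooth_mx a W (fun x => - F x).
Proof. exact: (@smooth_mxonN R n V oV m r (F \o cparam a)). Qed.

Lemma smooth_mx_scale (f : M -> R) (F : M -> 'M[R]_(m, r)) :
  smooth_in a W f -> smooth_mx a W F -> smooth_mx a W (fun x => f x *: F x).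
Proof. exact: (@smooth_mxon_scale R n V oV m r (f \o cparam a) (F \o cparam a)). Qed.

Lemma smooth_mx_tr (F : M -> 'M[R]_(m, r)) :
  smooth_mx a W F -> smooth_mx a W (fun x => (F x)^T).
Proof. exact: (@smooth_mxon_tr R n V m r (F \o cparam a)). Qed.

Lemma smooth_mx_row (F : M -> 'M[R]_(m, r)) (G : M -> 'M[R]_(m, s)) :
  smooth_mx a W F -> smooth_mx a W G -> smooth_mx a W (fun x => row_mx (F x) (G x)).
Proof. exact: (@smooth_mxon_row R n V m r s (F \o cparam a) (G \o cparam a)). Qed.

Lemma smooth_mx_lsub (F : M -> 'M[R]_(m, r + s)) :
  smooth_mx a W F -> smooth_mx a W (fun x => lsubmx (F x)).
Proof. exact: (@smooth_mxon_lsub R n V m r s (F \o cparam a)). Qed.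

Lemma smooth_mx_rsub (F : M -> 'M[R]_(m, r + s)) :
  smooth_mx a W F -> smooth_mx a W (fun x => rsubmx (F x)).
Proof. exact: (@smooth_mxon_rsub R n V m r s (F \o cparam a)). Qed.

Lemma eq_smooth_mx (F G : M -> 'M[R]_(m, r)) : (forall x, W x -> F x = G x) ->
  smooth_mx a W F -> smooth_mx a W G.
Proof.
by move=> FG sF i j; apply: eq_smooth_in (sF i j) => x Wx; rewrite FG.
Qed.

Lemma smooth_mder v (F : M -> 'M[R]_(m, r)) :
  smooth_mx a W F -> smooth_mx a W (mder a v F).
Proof.
move=> sF i j.
have -> : (fun x => mder a v F x i j) = (fun x => dir a v (fun y => F y i j) x).
  by apply/funext => x; rewrite mxE.
exact: smooth_in_dir (sF i j).
Qed.

Lemma mder_eq v (F G : M -> 'M[R]_(m, r)) x : W x -> (forall y, W y -> F y = G y) ->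
  mder a v F x = mder a v G x.
Proof.
move=> Wx FG; apply/matrixP => i j; rewrite !mxE.
by apply: (dir_eq v Wx) => y Wy; rewrite FG.
Qed.

Lemma is_dmx_mder v (F : M -> 'M[R]_(m, r)) x : W x -> smooth_mx a W F ->
  is_dmx (ccoo a x) v (F \o cparam a) (mder a v F x).
Proof. by move=> Wx sF i j; rewrite mxE; exact: (is_derive_dir v Wx (sF i j)). Qed.

Lemma mder_of v (F : M -> 'M[R]_(m, r)) dF x :
  is_dmx (ccoo a x) v (F \o cparam a) dF -> mder a v F x = dF.
Proof. by move=> H; apply/matrixP => i j; rewrite mxE; have [_ <-] := H i j. Qed.

Lemma mder_cst v (A : 'M[R]_(m, r)) x : mder a v (fun=> A) x = 0.
Proof. by apply/matrixP => i j; rewrite !mxE dir_cst. Qed.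

Lemma mderE v (F : M -> 'M[R]_(m, r)) x : W x -> smooth_mx a W F ->
  mder a v F x = \sum_i v 0 i *: mder a (basis_vec i) F x.
Proof.
move=> Wx sF; apply/matrixP => i j; rewrite summxE mxE (dirE v Wx (sF i j)).
by apply: eq_bigr => k _; rewrite !mxE.
Qed.

End Matrices.

Section MatrixRules.
Variables (x : M) (Wx : W x) (v : 'rV[R]_n).

Let xK : cparam a (ccoo a x) = x. Proof. by apply: paramK; exact: Wa. Qed.

Lemma mderM m r s (F : M -> 'M[R]_(m, r)) (G : M -> 'M[R]_(r, s)) :
  smooth_mx a W F -> smooth_mx a W G ->
  mder a v (fun y => F y *m G y) x = mder a v F x *m G x + F x *m mder a v G x.
Proof.
move=> sF sG; apply: mder_of.
by have := is_dmxM (is_dmx_mder v Wx sF) (is_dmx_mder v Wx sG); rewrite /= xK.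
Qed.

Lemma mderD m r (F G : M -> 'M[R]_(m, r)) : smooth_mx a W F -> smooth_mx a W G ->
  mder a v (fun y => F y + G y) x = mder a v F x + mder a v G x.
Proof.
by move=> sF sG; apply: mder_of; exact: is_dmxD (is_dmx_mder v Wx sF) (is_dmx_mder v Wx sG).
Qed.

Lemma mderN m r (F : M -> 'M[R]_(m, r)) : smooth_mx a W F ->
  mder a v (fun y => - F y) x = - mder a v F x.
Proof. by move=> sF; apply: mder_of; exact: is_dmxN (is_dmx_mder v Wx sF). Qed.

Lemma mderZ m r (f : M -> R) (F : M -> 'M[R]_(m, r)) :
  smooth_in a W f -> smooth_mx a W F ->
  mder a v (fun y => f y *: F y) x = dir a v f x *: F x + f x *: mder a v F x.
Proof.
move=> sf sF; apply: mder_of.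
by have := is_dmx_scale (is_derive_dir v Wx sf) (is_dmx_mder v Wx sF); rewrite /= xK.
Qed.

Lemma mder_tr m r (F : M -> 'M[R]_(m, r)) : smooth_mx a W F ->
  mder a v (fun y => (F y)^T) x = (mder a v F x)^T.
Proof. by move=> sF; apply: mder_of; exact: is_dmx_tr (is_dmx_mder v Wx sF). Qed.

End MatrixRules.

Lemma smooth_mx_inv m (A : M -> 'M[R]_m) : (forall x, W x -> A x \in unitmx) ->
  smooth_mx a W A -> smooth_mx a W (fun x => invmx (A x)).
Proof.
move=> uA; apply: (@smooth_mxon_inv R n V oV m (A \o cparam a)).
by move=> u /(img_param Wa)[/uA].
Qed.

Lemma mder_inv m (A : M -> 'M[R]_m) v x : W x -> (forall x, W x -> A x \in unitmx) ->
  smooth_mx a W A ->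
  mder a v (fun y => invmx (A y)) x = - (invmx (A x) *m mder a v A x *m invmx (A x)).
Proof.
move=> Wx uA sA.
have sI := smooth_mx_inv uA sA.
have : mder a v (fun y => invmx (A y) *m A y) x = 0.
  rewrite -[RHS](mder_cst v (1%:M) x); apply: (mder_eq v Wx) => y Wy.
  by rewrite mulVmx // uA.
rewrite (mderM Wx v sI sA) => /eqP; rewrite addr_eq0 => /eqP E.
by rewrite -mulNmx -E -mulmxA mulmxV ?mulmx1 // uA.
Qed.

End InChart.

Lemma smooth_in_sub a W W' f : W' `<=` W -> smooth_in a W f -> smooth_in a W' f.
Proof. by move=> WW sf k; apply: Ck_on_sub (sf k) => _ [x /WW Wx <-]; exists x. Qed.

Lemma smooth_mx_sub a W W' m r (F : M -> 'M[R]_(m, r)) :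
  W' `<=` W -> smooth_mx a W F -> smooth_mx a W' F.
Proof. by move=> WW sF i j; exact: smooth_in_sub WW (sF i j). Qed.

Section TwoCharts.
Variables (a b : chart_index M) (W : set M).
Hypotheses (oW : open W) (Wa : W `<=` cdom a) (Wb : W `<=` cdom b).

Lemma smooth_in_coo j : smooth_in a W (fun y => ccoo b y 0 j).
Proof.
move=> k; have := @atlas_smooth R n M a b j k; apply: Ck_on_sub.
by move=> _ [x Wx <-]; exists x => //; split; [exact: Wa|exact: Wb].
Qed.

Lemma dir_jac v f x : W x -> smooth_in b W f ->
  dir b (v *m jac a b x) f x = dir a v f x.
Proof.
move=> Wx sf.
have sc j := smooth_in_coo j.
have oVb := img_open_sub oW Wb; have oVa := img_open_sub oW Wa.
have xK : cparam a (ccoo a x) = x by apply: paramK; exact: Wa.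
pose phi u := ccoo b (cparam a u).
have Vb : (ccoo b @` W) (phi (ccoo a x)) by rewrite /phi xK; exact: img_coo.
have dp i : is_derive (ccoo a x) v (fun y => phi y 0 i)
    ((\row_j dir a v (fun y => ccoo b y 0 j) x) 0 i).
  by rewrite mxE; exact: (is_derive_dir oW Wa v Wx (sc i)).
have [_ E] := is_derive_comp_C1 oVb Vb (sf 1%N) dp.
have -> : dir a v f x = 'D_v ((f \o cparam b) \o phi) (ccoo a x).
  apply: near_eq_derive; apply: (open_near oVa (img_coo a Wx)) => u /(img_param Wa)[Wu Eu].
  by rewrite /phi /= paramK //; exact: Wb.
rewrite E (dirE oW Wb _ Wx sf) /phi xK; apply: eq_bigr => i _.
rewrite !mxE (dirE oW Wa v Wx (sc i)); congr (_ * _).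
by apply: eq_bigr => j _; rewrite mxE.
Qed.

End TwoCharts.

Lemma smooth_in_chart a b W f : open W -> W `<=` cdom a -> W `<=` cdom b ->
  smooth_in a W f -> smooth_in b W f.
Proof.
move=> oW Wa Wb sf k.
have oVb := img_open_sub oW Wb; have oVa := img_open_sub oW Wa.
apply: (@Ck_on_eq _ _ k _ ((f \o cparam a) \o (fun u => ccoo a (cparam b u)))) => //.
  move=> u /(img_param Wb)[Wu Eu] /=; rewrite paramK //; exact: Wa.
apply: (Ck_on_comp oVa oVb) (sf k).
- by move=> u /(img_param Wb)[Wu Eu]; exact: img_coo.
- by move=> j; exact: (smooth_in_coo Wb Wa j k).
Qed.

Lemma jac_mul a b c x : cdom a x -> cdom b x -> cdom c x ->
  jac a b x *m jac b c x = jac a c x.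
Proof.
move=> ax bx cx.
pose W : set M := cdom a `&` cdom b `&` cdom c.
have oW : open W by apply: openI; [apply: openI|]; exact: cdom_open.
have Wa : W `<=` cdom a by move=> y [[]].
have Wb : W `<=` cdom b by move=> y [[]].
have Wc : W `<=` cdom c by move=> y [].
have Wx : W x by [].
apply/matrixP => i j.
have := dir_jac oW Wa Wb (basis_vec i) Wx (smooth_in_coo Wb Wc j).
rewrite (dirE oW Wb _ Wx (smooth_in_coo Wb Wc j)) => E.
rewrite !mxE [RHS]/pd -E; apply: eq_bigr => k _.
by rewrite -rowE !mxE.
Qed.

Lemma jac_id a x : cdom a x -> jac a a x = 1%:M.
Proof.
move=> ax; apply/matrixP => i j; rewrite !mxE /pd /dir.
have oD := img_open_sub (cdom_open a) (@subset_refl _ (cdom a)).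
have -> : 'D_(basis_vec i) ((fun y => ccoo a y 0 j) \o cparam a) (ccoo a x) =
   'D_(basis_vec i) (fun u : 'rV[R]_n => u 0 j : R) (ccoo a x).
  apply: near_eq_derive; apply: (open_near oD (img_coo a ax)) => u Du /=.
  by have [_ ->] := img_param (@subset_refl _ (cdom a)) Du.
have [_ ->] := is_derive_coord (ccoo a x) (basis_vec i) j.
by rewrite mxE eqxx eq_sym.
Qed.

Lemma jac_unit a b x : cdom a x -> cdom b x -> jac a b x \in unitmx.
Proof.
move=> ax bx; have := jac_mul ax bx ax; rewrite jac_id // => E.
by have [] := mulmx1_unit E.
Qed.

End ChartCalculus.

(** * Curvature and conformal change *)

Section ConformalAlgebra.
Context {R : realType} {n : nat}.

Lemma sum_deltar (F : 'I_n -> R) (j : 'I_n) : \sum_l F l * (j == l)%:R = F j.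
Proof.
rewrite (bigD1 j) //= eqxx mulr1 big1 ?addr0 // => l lj.
by rewrite eq_sym (negbTE lj) mulr0.
Qed.

(** The divergence of the changed Christoffel symbols in abstract form: A and B stand for second
    derivatives of s, P for derivatives of the metric coefficient c, u for the gradient and D for
    its derivatives. *)
Lemma sum_conf_derivative (X Y A B P u D : 'I_n -> R) (c : R) (i j : 'I_n) :
  (forall l, X l = Y l + (A l * (j == l)%:R + B l * (i == l)%:R - (P l * u l + c * D l))) ->
  \sum_l X l = \sum_l Y l + (A j + B i) - (\sum_l u l * P l + c * \sum_l D l).
Proof.
move=> E; rewrite (eq_bigr _ (fun l _ => E l)) big_split sumrB !big_split /= !sum_deltar.
by rewrite mulr_sumr addrA; under [X in _ - (X + _) = _]eq_bigr do rewrite mulrC.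
Qed.

Variables (G : 'I_n -> 'I_n -> R) (Ga : 'I_n -> 'I_n -> 'I_n -> R) (s su : 'I_n -> R).
Hypotheses (Gsym : forall i j, G i j = G j i) (Gasym : forall i j l, Ga i j l = Ga j i l)
  (Gsu : forall j, \sum_l G l j * su l = s j).

(* The difference of the Christoffel symbols of e^(2 s) g and g; su is the
   gradient of the function with differential s. *)
Definition conf_term (i j l : 'I_n) : R :=
  s i * (j == l)%:R + s j * (i == l)%:R - G i j * su l.

Local Notation C := conf_term.
Local Notation N := (\sum_m su m * s m).
Local Notation ga m := (\sum_l Ga l m l).

Lemma conf_contract i j (F : 'I_n -> R) :
  \sum_m C i j m * F m = s i * F j + s j * F i - G i j * \sum_m su m * F m.
Proof.
rewrite /C; under eq_bigr do rewrite mulrBl mulrDl.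
rewrite sumrB big_split /=; congr (_ + _ - _).
- by under eq_bigr do rewrite mulrAC; rewrite sum_deltar.
- by under eq_bigr do rewrite mulrAC; rewrite sum_deltar.
- by rewrite mulr_sumr; under eq_bigr do rewrite -mulrA.
Qed.

Lemma conf_trace m : \sum_l C l m l = n%:R * s m.
Proof.
rewrite /C sumrB big_split /= sum_deltar Gsu.
under [X in _ + X - _]eq_bigr do rewrite eqxx mulr1.
by rewrite addrAC subrr add0r sumr_const card_ord mulr_natl.
Qed.

Lemma conf_sym i j l : C i j l = C j i l.
Proof. by rewrite /C [X in X - _]addrC Gsym. Qed.

Lemma conf_trace' i : \sum_l C i l l = n%:R * s i.
Proof. by rewrite -conf_trace; apply: eq_bigr => l _; exact: conf_sym. Qed.

(** The part of the new Ricci tensor that is quadratic in the difference of the two connections. *)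
Lemma conf_quadratic i j :
  \sum_l \sum_m (C i j m * C l m l - C l j m * C i m l) =
  (n%:R - 2) * (s i * s j) - (n%:R - 2) * (G i j * N).
Proof.
under eq_bigr do rewrite sumrB.
rewrite sumrB exchange_big /=.
under eq_bigr do rewrite -mulr_sumr conf_trace.
rewrite conf_contract.
have -> : \sum_m su m * (n%:R * s m) = n%:R * N.
  by rewrite mulr_sumr; apply: eq_bigr => m _; rewrite mulrCA.
have -> : \sum_l \sum_m C l j m * C i m l = (n%:R + 2) * (s i * s j) - 2 * (G i j * N).
  under eq_bigr do rewrite conf_contract.
  rewrite sumrB big_split /=.
  have -> : \sum_l s l * C i j l = 2 * (s i * s j) - G i j * N.
    under eq_bigr do rewrite mulrC.
    by rewrite conf_contract; ring.
  rewrite -mulr_sumr conf_trace'.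
  have -> : \sum_l G l j * (\sum_m su m * C i m l) = G i j * N.
    under eq_bigr do rewrite mulr_sumr.
    rewrite exchange_big /=.
    under eq_bigr => m _.
      under eq_bigr do rewrite mulrCA [G _ _ * _]mulrC.
      rewrite -mulr_sumr conf_contract.
      under eq_bigr do rewrite mulrC.
      rewrite Gsu.
      over.
    under eq_bigr do rewrite mulrBr mulrDr.
    rewrite sumrB big_split /=.
    have -> : \sum_m su m * (s i * G m j) = s i * s j.
      by rewrite -[in RHS](Gsu j) mulr_sumr; apply: eq_bigr => m _; ring.
    have -> : \sum_m su m * (s m * G i j) = G i j * N.
      by rewrite mulr_sumr; apply: eq_bigr => m _; ring.
    have -> : \sum_m su m * (G i m * s j) = s i * s j.
      rewrite -[in RHS](Gsu i) mulr_suml; apply: eq_bigr => m _.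
      by rewrite [G i m]Gsym; ring.
    by ring.
  by ring.
by ring.
Qed.

(** The part of the new Ricci tensor that pairs the old Christoffel symbols with the difference
    tensor. Its last sum is the derivative of the metric along the gradient, kept in this form
    because it cancels in [ricci_conf]. *)
Lemma conf_mixed i j :
  \sum_l \sum_m (Ga i j m * C l m l + C i j m * Ga l m l
                 - Ga l j m * C i m l - C l j m * Ga i m l) =
  (n%:R - 2) * (\sum_m Ga i j m * s m) - G i j * (\sum_m su m * ga m)
  + \sum_l su l * \sum_m (Ga l j m * G m i + Ga l i m * G m j).
Proof.
under eq_bigr do rewrite !sumrB big_split /=.
rewrite !sumrB big_split /=.
have -> : \sum_l \sum_m Ga i j m * C l m l = n%:R * \sum_m Ga i j m * s m.
  rewrite exchange_big mulr_sumr /=; apply: eq_bigr => m _.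
  by rewrite -mulr_sumr conf_trace mulrCA.
have -> : \sum_l \sum_m C i j m * Ga l m l =
    s i * ga j + s j * ga i - G i j * \sum_m su m * ga m.
  rewrite exchange_big /=; under eq_bigr do rewrite -mulr_sumr.
  by rewrite conf_contract.
have -> : \sum_l \sum_m Ga l j m * C i m l =
    s i * ga j + (\sum_m Ga i j m * s m) - \sum_l su l * \sum_m Ga l j m * G m i.
  rewrite /C; under eq_bigr do under eq_bigr do rewrite mulrBr mulrDr.
  under eq_bigr do rewrite sumrB big_split /=.
  rewrite sumrB big_split /=; congr (_ + _ - _).
  - rewrite mulr_sumr; apply: eq_bigr => l _.
    under eq_bigr do rewrite mulrA eq_sym.
    by rewrite sum_deltar mulrC.
  - rewrite exchange_big /=; apply: eq_bigr => m _.
    by under eq_bigr do rewrite mulrA; rewrite sum_deltar.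
  - apply: eq_bigr => l _; rewrite mulr_sumr; apply: eq_bigr => m _.
    by rewrite [G i m]Gsym; ring.
have -> : \sum_l \sum_m C l j m * Ga i m l =
    (\sum_m Ga i j m * s m) + s j * ga i - \sum_l su l * \sum_m Ga l i m * G m j.
  under eq_bigr do rewrite conf_contract.
  rewrite sumrB big_split /=; congr (_ + _ - _).
  - by apply: eq_bigr => l _; rewrite mulrC.
  - by rewrite mulr_sumr; apply: eq_bigr => l _; rewrite Gasym.
  - under eq_bigr do rewrite mulr_sumr.
    rewrite exchange_big /=; apply: eq_bigr => l _.
    by rewrite mulr_sumr; apply: eq_bigr => m _; rewrite Gasym; ring.
under [X in _ = _ + X]eq_bigr do rewrite big_split mulrDr /=.
rewrite [X in _ = _ + X]big_split /=.
by ring.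
Qed.

End ConformalAlgebra.

(* Unification otherwise unfolds derivatives down to filter limits. *)
Opaque dir.

(** * The Levi-Civita connection and the Ricci tensor in a chart *)

Section LeviCivita.
Context {R : realType} {n : nat} {M : smoothManifold R n}.
Variables (a : chart_index M) (W : set M).
Hypotheses (oW : open W) (Wa : W `<=` cdom a).

Definition metric_in (g : tensor2 M) : Prop :=
  [/\ smooth_mx a W (g a), forall x, W x -> (g a x)^T = g a x &
      forall x, W x -> g a x \in unitmx].

Definition conn (g : tensor2 M) (v : 'rV[R]_n) (x : M) : 'M[R]_n :=
  \matrix_(j, l) \sum_i v 0 i * christoffel g a i j l x.

Lemma conn_basis g i j l x : conn g (basis_vec i) x j l = christoffel g a i j l x.
Proof.
rewrite mxE (bigD1 i) //= !mxE !eqxx mul1r big1 ?addr0 // => k ki.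
by rewrite mxE (negbTE ki) andbF mul0r.
Qed.

Lemma nablaE g v (Y : M -> 'rV[R]_n) x :
  nabla g a v Y x = mder a v Y x + Y x *m conn g v x.
Proof.
apply/rowP => l; rewrite !mxE; congr (_ + _).
rewrite exchange_big /=; apply: eq_bigr => j _; rewrite mxE mulr_sumr.
by apply: eq_bigr => i _; ring.
Qed.

Lemma mderC m r (F : M -> 'M[R]_(m, r)) i j x : W x -> smooth_mx a W F ->
  mder a (basis_vec i) (mder a (basis_vec j) F) x =
  mder a (basis_vec j) (mder a (basis_vec i) F) x.
Proof.
move=> Wx sF; apply/matrixP => k l.
have E i' j' : mder a (basis_vec i') (mder a (basis_vec j') F) x k l =
    pd a i' (fun y => pd a j' (fun z => F z k l) y) x.
  by rewrite mxE /pd; congr (dir a _ _ x); apply/funext => y; rewrite mxE.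
apply: (etrans (E i j)); apply: (etrans _ (esym (E j i))).
exact: (@pdC R n M a W oW Wa i j (fun z => F z k l) x Wx (sF k l)).
Qed.

Section OneMetric.
Variable g : tensor2 M.
Hypothesis mg : metric_in g.

Let sg : smooth_mx a W (g a). Proof. by case: mg. Qed.
Let gT x : W x -> (g a x)^T = g a x. Proof. by case: mg => _ + _; exact. Qed.
Let gU x : W x -> g a x \in unitmx. Proof. by case: mg => _ _; exact. Qed.

Lemma metric_sym x i j : W x -> g a x i j = g a x j i.
Proof. by move=> Wx; rewrite -[in LHS]gT // mxE. Qed.

Lemma invg_sym x : W x -> (invmx (g a x))^T = invmx (g a x).
Proof. by move=> Wx; rewrite trmx_inv gT. Qed.

Lemma smooth_inv_metric : smooth_mx a W (fun x => invmx (g a x)).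
Proof. exact: (smooth_mx_inv oW Wa gU sg). Qed.

Lemma smooth_christoffel i j l : smooth_in a W (christoffel g a i j l).
Proof.
apply: smooth_inM => //; first exact: smooth_in_cst.
apply: smooth_in_sum => // m _; apply: smooth_inM => //; first exact: smooth_inv_metric.
apply: smooth_inB => //; last exact: (smooth_in_pd oW Wa _ (sg i j)).
by apply: smooth_inD => //; [exact: (smooth_in_pd oW Wa _ (sg j m)) |
   exact: (smooth_in_pd oW Wa _ (sg i m))].
Qed.

Lemma christoffelC i j l x : W x -> christoffel g a i j l x = christoffel g a j i l x.
Proof.
move=> Wx; rewrite /christoffel; congr (_ * _); apply: eq_bigr => m _; congr (_ * _).
congr (_ - _); first exact: addrC.
by apply: (dir_eq oW Wa _ Wx) => y Wy; exact: metric_sym.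
Qed.

Lemma connC v w x : W x -> w *m conn g v x = v *m conn g w x.
Proof.
move=> Wx; apply/rowP => l; rewrite !mxE.
under eq_bigr do rewrite mxE mulr_sumr.
rewrite exchange_big /=; apply: eq_bigr => j _; rewrite mxE mulr_sumr.
by apply: eq_bigr => i _; rewrite christoffelC //; ring.
Qed.

(** Row j is the derivative of the metric in the direction e_j contracted with v; with it the Koszul
    formula becomes the matrix identity [connG]. *)
Definition koszul (v : 'rV[R]_n) (x : M) : 'M[R]_n :=
  \matrix_(j, m) (v *m mder a (basis_vec j) (g a) x) 0 m.

Lemma connE v x : W x -> conn g v x =
  2^-1 *: ((mder a v (g a) x + koszul v x - (koszul v x)^T) *m invmx (g a x)).
Proof.
move=> Wx; apply/matrixP => j l; rewrite !mxE.
rewrite /christoffel; under eq_bigr do rewrite mulrCA.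
rewrite -mulr_sumr; congr (_ * _).
under eq_bigr do rewrite mulr_sumr.
rewrite exchange_big /=; apply: eq_bigr => m _.
under eq_bigr do rewrite mulrCA.
rewrite -mulr_sumr mulrC.
have -> : invmx (g a x) l m = invmx (g a x) m l by rewrite -[in LHS]invg_sym // mxE.
congr (_ * _); rewrite !mxE (dirE oW Wa _ Wx (sg j m)).
rewrite -big_split -sumrB /=; apply: eq_bigr => i _.
by rewrite !mxE /pd; ring.
Qed.

Lemma connG v x : W x -> conn g v x *m g a x =
  2^-1 *: (mder a v (g a) x + koszul v x - (koszul v x)^T).
Proof. by move=> Wx; rewrite connE // -scalemxAl mulmxKV // gU. Qed.

Lemma mder_metricT v x : W x -> (mder a v (g a) x)^T = mder a v (g a) x.
Proof.
move=> Wx; rewrite -(mder_tr oW Wa Wx v sg).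
by apply: (mder_eq oW Wa v Wx) => y Wy; exact: gT.
Qed.

(** In [connG] the two Koszul terms form a skew matrix, which cancels against its transpose; half
    the derivative of the metric is left from each summand. *)
Lemma conn_metric v x : W x ->
  mder a v (g a) x = conn g v x *m g a x + g a x *m (conn g v x)^T.
Proof.
move=> Wx.
have -> : g a x *m (conn g v x)^T = (conn g v x *m g a x)^T by rewrite trmx_mul gT.
rewrite connG //; apply/matrixP => i j.
have /matrixP/(_ i j) := mder_metricT v Wx.
rewrite !mxE => ->; by field.
Qed.

Lemma pd_metric l i j x : W x -> pd a l (fun y => g a y i j) x =
  \sum_m (christoffel g a l j m x * g a x m i + christoffel g a l i m x * g a x m j).
Proof.
move=> Wx; have /matrixP/(_ i j) := conn_metric (basis_vec l) Wx.
rewrite mxE => E; rewrite [LHS]E mxE [X in X + _]mxE [X in _ + X]mxE addrC -big_split /=.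
apply: eq_bigr => m _.
have -> : (conn g (basis_vec l) x)^T m j = christoffel g a l j m x.
  by rewrite mxE conn_basis.
by rewrite conn_basis [g a x i m]metric_sym // [X in X + _]mulrC.
Qed.

Opaque christoffel.

Definition ctrace (i : 'I_n) (y : M) : R := \sum_l christoffel g a l i l y.

Lemma smooth_ctrace i : smooth_in a W (ctrace i).
Proof. by apply: smooth_in_sum => // l _; exact: smooth_christoffel. Qed.

Lemma ricciE i j x : W x -> ricci g a x i j =
  \sum_l pd a l (christoffel g a i j l) x - pd a i (ctrace j) x +
  \sum_l \sum_m (christoffel g a i j m x * christoffel g a l m l x
                 - christoffel g a l j m x * christoffel g a i m l x).
Proof.
move=> Wx; rewrite mxE /riemann big_split sumrB /=; congr (_ - _ + _).
by rewrite /pd (dir_sum oW Wa _ Wx) // => l; exact: smooth_christoffel.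
Qed.

Lemma ctraceE i y : W y ->
  ctrace i y = 2^-1 * \tr (mder a (basis_vec i) (g a) y *m invmx (g a y)).
Proof.
move=> Wy; rewrite /ctrace.
under eq_bigr do rewrite christoffelC // -conn_basis.
rewrite -[LHS]/(\tr (conn g (basis_vec i) y)) connE // mxtraceZ; congr (_ * _).
rewrite -addrA mulmxDl mxtraceD.
set A := koszul _ _.
suff -> : \tr ((A - A^T) *m invmx (g a y)) = 0 by rewrite addr0.
rewrite mulmxBl linearB /= -[X in _ - X]mxtrace_tr trmx_mul trmxK invg_sym //.
by rewrite mxtrace_mulC subrr.
Qed.

(** The contracted Christoffel symbol is half of d log |det g|, hence a closed form. With its trace
    expression [ctraceE] this follows from the symmetry of second derivatives and the cyclicity of
    the trace. *)
Lemma pd_ctraceC i j x : W x -> pd a i (ctrace j) x = pd a j (ctrace i) x.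
Proof.
move=> Wx.
have sD k : smooth_mx a W (mder a (basis_vec k) (g a)) by exact: (smooth_mder oW Wa _ sg).
have E k l : pd a k (ctrace l) x = 2^-1 * \tr (mder a (basis_vec k) (fun y =>
     mder a (basis_vec l) (g a) y *m invmx (g a y)) x).
  have sP : smooth_mx a W (fun y => mder a (basis_vec l) (g a) y *m invmx (g a y)).
    by apply: smooth_mxM => //; exact: smooth_inv_metric.
  rewrite /pd (dir_eq oW Wa (basis_vec k) Wx (g := fun y => 2^-1 * \sum_m
    (mder a (basis_vec l) (g a) y *m invmx (g a y)) m m)); last by move=> y; exact: ctraceE.
  rewrite (dirM oW Wa) //; [|exact: smooth_in_cst|by apply: smooth_in_sum => // m _; exact: sP].
  rewrite dir_cst mul0r add0r (dir_sum oW Wa) //.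
  by congr (_ * _); apply: eq_bigr => m _; rewrite mxE.
have sI := smooth_inv_metric.
have E2 k l : pd a k (ctrace l) x = 2^-1 * (\tr (mder a (basis_vec k)
     (mder a (basis_vec l) (g a)) x *m invmx (g a x)) -
     \tr (mder a (basis_vec l) (g a) x *m invmx (g a x) *m
          (mder a (basis_vec k) (g a) x *m invmx (g a x)))).
  rewrite E (mderM oW Wa Wx _ (sD l) sI) (mder_inv oW Wa _ Wx gU sg) mulmxN linearB /=.
  by rewrite !mulmxA.
have MC : mder a (basis_vec i) (mder a (basis_vec j) (g a)) x =
          mder a (basis_vec j) (mder a (basis_vec i) (g a)) x.
  exact: mderC sg.
rewrite (E2 i j) (E2 j i) MC.
move: (mder a _ (mder a _ _) x) (mder a _ (g a) x) (mder a _ (g a) x) (invmx _) => A B C D.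
by rewrite [\tr (B *m _ *m _)]mxtrace_mulC.
Qed.

(** All terms of [ricciE] but one are symmetric because the Christoffel symbols are; the remaining
    one is the derivative of the trace, settled by [pd_ctraceC]. *)
Lemma ricci_sym x : W x -> (ricci g a x)^T = ricci g a x.
Proof.
move=> Wx; apply/matrixP => i j; rewrite mxE (ricciE j i Wx) (ricciE i j Wx) (pd_ctraceC i j Wx).
have cong (u v w u' w' : R) : u = u' -> w = w' -> u - v + w = u' - v + w'.
  by move=> -> ->.
apply: cong.
  by apply: eq_bigr => l _; apply: (dir_eq oW Wa _ Wx) => y Wy; exact: christoffelC.
pose F i j l m := christoffel g a i j l x * christoffel g a m l m x.
pose F' i j l m := christoffel g a l j m x * christoffel g a i m l x.
have sumF i' j' : \sum_l \sum_m (F i' j' m l - F' i' j' l m) =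
    \sum_l \sum_m F i' j' m l - \sum_l \sum_m F' i' j' l m.
  by rewrite -sumrB; apply: eq_bigr => l _; rewrite sumrB.
rewrite (sumF j i) (sumF i j).
have -> : \sum_l \sum_m F j i m l = \sum_l \sum_m F i j m l.
  by apply: eq_bigr => l _; apply: eq_bigr => m _; rewrite /F (christoffelC j i _ Wx).
have -> // : \sum_l \sum_m F' j i l m = \sum_l \sum_m F' i j l m.
rewrite exchange_big /=; apply: eq_bigr => l _; apply: eq_bigr => m _.
by rewrite /F' mulrC (christoffelC j l _ Wx) (christoffelC m i _ Wx).
Qed.

End OneMetric.
End LeviCivita.

Section Pairing.
Context {R : realType} {n : nat}.
Implicit Types u v w : 'rV[R]_n.

Lemma pairC u w : (u *m w^T) 0 0 = (w *m u^T) 0 0.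
Proof.
have T (A : 'M[R]_1) : A^T 0 0 = A 0 0 by rewrite mxE.
by rewrite -T trmx_mul trmxK.
Qed.

Lemma pairDl u v w : ((u + v) *m w^T) 0 0 = (u *m w^T) 0 0 + (v *m w^T) 0 0.
Proof. by rewrite mulmxDl mxE. Qed.

Lemma pairZl c u w : ((c *: u) *m w^T) 0 0 = c * (u *m w^T) 0 0.
Proof. by rewrite -scalemxAl mxE. Qed.

Lemma pairNl u w : ((- u) *m w^T) 0 0 = - (u *m w^T) 0 0.
Proof. by rewrite mulNmx mxE. Qed.

Lemma bformDr (A : 'M[R]_n) u v w : bform A u (v + w) = bform A u v + bform A u w.
Proof. by rewrite /bform linearD /= mulmxDr mxE. Qed.

Lemma bformZr (A : 'M[R]_n) c u w : bform A u (c *: w) = c * bform A u w.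
Proof. by rewrite /bform linearZ /= -scalemxAr mxE. Qed.

Lemma bformDl (A : 'M[R]_n) u v w : bform A (v + w) u = bform A v u + bform A w u.
Proof. by rewrite /bform !mulmxDl mxE. Qed.

Lemma bformZl (A : 'M[R]_n) c u w : bform A (c *: w) u = c * bform A w u.
Proof. by rewrite /bform -!scalemxAl mxE. Qed.

Lemma bformNr (A : 'M[R]_n) u w : bform A u (- w) = - bform A u w.
Proof. by rewrite -scaleN1r bformZr mulN1r. Qed.

Lemma bformNl (A : 'M[R]_n) u w : bform A (- w) u = - bform A w u.
Proof. by rewrite -scaleN1r bformZl mulN1r. Qed.

Lemma bformZ (A : 'M[R]_n) c u w : bform (c *: A) u w = c * bform A u w.
Proof. by rewrite /bform -scalemxAr -scalemxAl mxE. Qed.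

Lemma bformC (A : 'M[R]_n) u w : A^T = A -> bform A u w = bform A w u.
Proof. by move=> AT; rewrite /bform pairC trmx_mul AT mulmxA. Qed.

End Pairing.

(** * Conformal change of the connection, the curvature and the tractor connection *)

Section ConformalChange.
Context {R : realType} {n : nat} {M : smoothManifold R n}.
Variables (a : chart_index M) (W : set M).
Hypotheses (oW : open W) (Wa : W `<=` cdom a).
Variables (g h : tensor2 M) (s : M -> R).
Hypotheses (mg : metric_in a W g) (ss : smooth_in a W s).
Hypothesis hg : forall x, W x -> h a x = expR (2 * s x) *: g a x.

Local Notation G := (g a).
Let sg : smooth_mx a W G. Proof. by case: mg. Qed.
Let gT x : W x -> (G x)^T = G x. Proof. by case: mg => _ + _; exact. Qed.
Let gU x : W x -> G x \in unitmx. Proof. by case: mg => _ _; exact. Qed.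

Lemma smooth_in_exp2 : smooth_in a W (fun x => expR (2 * s x)).
Proof. by apply: smooth_in_exp => //; apply: smooth_inM => //; exact: smooth_in_cst. Qed.

Lemma conf_metric_in : metric_in a W h.
Proof.
split=> [|x Wx|x Wx].
- apply: (eq_smooth_mx oW Wa (F := fun x => expR (2 * s x) *: G x)) => [x Wx|].
    by rewrite hg.
  by apply: smooth_mx_scale => //; exact: smooth_in_exp2.
- by rewrite hg //; apply/matrixP => i j; rewrite !mxE (metric_sym mg).
- by rewrite hg // unitmxZ ?gU // unitfE gt_eqF // expR_gt0.
Qed.

Let mh := conf_metric_in.

Definition drow x : 'rV[R]_n := \row_i pd a i s x.
Definition dgrad x : 'rV[R]_n := grad g a s x.

Lemma smooth_drow : smooth_mx a W drow.
Proof.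
move=> i j; have -> : (fun x => drow x i j) = (fun x => pd a j s x).
  by apply/funext => x; rewrite mxE.
exact: smooth_in_pd.
Qed.

Lemma dir_drow v x : W x -> dir a v s x = (v *m (drow x)^T) 0 0.
Proof. by move=> Wx; rewrite (dirE oW Wa v Wx ss) mxE; apply: eq_bigr => i _; rewrite !mxE. Qed.

Lemma smooth_dgrad : smooth_mx a W dgrad.
Proof. by apply: smooth_mxM => //; [exact: smooth_drow|exact: (smooth_inv_metric oW Wa mg)]. Qed.

Lemma dgradG x : W x -> dgrad x *m G x = drow x.
Proof. by move=> Wx; rewrite /dgrad /grad /sharp mulmxKV // gU. Qed.

Lemma dir_dgrad v x : W x -> dir a v s x = bform (G x) v (dgrad x).
Proof. by move=> Wx; rewrite (dir_drow v Wx) -(dgradG Wx) trmx_mul gT // /bform mulmxA. Qed.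

Lemma mder_conf v x : W x ->
  mder a v (h a) x = expR (2 * s x) *: ((2 * dir a v s x) *: G x + mder a v G x).
Proof.
move=> Wx; rewrite (mder_eq oW Wa v Wx hg) (mderZ oW Wa Wx v smooth_in_exp2 sg).
have s2 : smooth_in a W (fun x => 2 * s x).
  by apply: smooth_inM => //; exact: smooth_in_cst.
rewrite (dir_exp oW Wa v Wx s2).
rewrite (dirM oW Wa v Wx (smooth_in_cst a W 2) ss) dir_cst mul0r add0r.
by rewrite scalerDr scalerA.
Qed.

(** The matrix form of the difference tensor [conf_term]. After multiplication by the metric both
    sides are Koszul expressions, and the derivative of the conformal factor accounts for the new
    terms. *)
Lemma conn_conf v x : W x -> conn a h v x =
  conn a g v x + (dir a v s x)%:M + (drow x)^T *m v - (v *m G x)^T *m dgrad x.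
Proof.
move=> Wx; have hU : h a x \in unitmx by case: mh => _ _; exact.
apply: (can_inj (mulmxK hU)).
rewrite (connG oW Wa mh v Wx) hg // -[RHS]scalemxAr mulmxBl !mulmxDl.
rewrite (connG oW Wa mg v Wx) -[_ *m dgrad x *m _]mulmxA dgradG // mder_conf //.
have -> : koszul a h v x = expR (2 * s x) *: (2 *: ((drow x)^T *m (v *m G x)) + koszul a g v x).
  apply/matrixP => j m; rewrite [LHS]mxE mder_conf // -scalemxAr mulmxDr -scalemxAr.
  rewrite !mxE big_ord1 !mxE /pd; move: (dir _ _ _ _) (\sum_j0 _) (\sum_j0 _) => *; ring.
rewrite -!mulmxA mul_scalar_mx; move: (koszul _ _ _ _) (mder _ _ _ _) (v *m G x) => K D u.
move: (dir a v s x) (drow x) => d r.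
by apply/matrixP => i j; rewrite !mxE !big_ord1 !mxE; field.
Qed.

Lemma christoffel_conf i j l x : W x -> christoffel h a i j l x =
  christoffel g a i j l x +
  conf_term (fun i j => G x i j) (fun i => drow x 0 i) (fun i => dgrad x 0 i) i j l.
Proof.
move=> Wx; rewrite -!conn_basis conn_conf // /conf_term.
have -> : (basis_vec i *m G x)^T *m dgrad x = \matrix_(k, l) (G x i k * dgrad x 0 l).
  by apply/matrixP => k m; rewrite -rowE !mxE big_ord1 !mxE.
rewrite !mxE !big_ord1 !mxE -/(pd a i s x) eqxx /= eq_sym [l == i]eq_sym.
by rewrite [X in _ = _ + (X + _ - _)]mulr_natr !addrA.
Qed.

(** The Hessian of s for the Levi-Civita connection of g. *)
Definition hess x : 'M[R]_n :=
  \matrix_(i, j) (pd a i (pd a j s) x - \sum_m christoffel g a i j m x * pd a m s x).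

Lemma row_hess v x : W x ->
  v *m hess x = mder a v drow x - drow x *m (conn a g v x)^T.
Proof.
move=> Wx; apply/rowP => j; rewrite mxE.
have -> : mder a v drow x = \sum_i v 0 i *: \row_j pd a i (pd a j s) x.
  rewrite (mderE oW Wa v Wx smooth_drow); apply: eq_bigr => i _; congr (_ *: _).
  apply/matrixP => i' j'; rewrite !mxE; rewrite /pd; congr (dir a _ _ x).
  by apply/funext => y; rewrite mxE.
rewrite mxE summxE [X in _ + X]mxE [X in - X]mxE.
under [X in _ = _ - X]eq_bigr do rewrite [drow x 0 _]mxE [_^T _ _]mxE [conn _ _ _ _ _ _]mxE mulr_sumr.
rewrite exchange_big -sumrB /=; apply: eq_bigr => i _; rewrite !mxE mulrBr mulr_sumr.
have E : forall u w w' : R, w = w' -> u - w = u - w' by move=> u w w' ->.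
by apply: E; apply: eq_bigr => m _; exact: etrans (mulrA _ _ _) (mulrC _ _).
Qed.

Lemma nabla_dgrad v x : W x -> mder a v dgrad x + dgrad x *m conn a g v x =
  v *m hess x *m invmx (G x).
Proof.
move=> Wx; apply: (can_inj (mulmxK (gU Wx))).
rewrite mulmxKV ?gU // row_hess // mulmxDl.
have <- : mder a v (fun y => dgrad y *m G y) x = mder a v drow x.
  by apply: (mder_eq oW Wa v Wx) => y Wy; exact: dgradG.
rewrite (mderM oW Wa Wx v smooth_dgrad sg) (conn_metric oW Wa mg v Wx).
by rewrite mulmxDr [X in _ = _ + (_ + X) - _]mulmxA dgradG // mulmxA addrA addrK.
Qed.

Local Notation Nrm x := (bform (G x) (dgrad x) (dgrad x)).

Lemma NrmE x : W x -> Nrm x = (dgrad x *m (drow x)^T) 0 0.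
Proof. by move=> Wx; rewrite /bform -mulmxA -[in X in _ *m X](gT Wx) -trmx_mul dgradG. Qed.

Lemma ctrace_conf j x : W x -> ctrace a h j x = ctrace a g j x + n%:R * pd a j s x.
Proof.
move=> Wx; rewrite /ctrace; under eq_bigr do rewrite christoffel_conf //.
rewrite big_split /= conf_trace => [|k]; first by rewrite mxE.
rewrite -(dgradG Wx) mxE; apply: eq_bigr => l _.
by rewrite mulrC.
Qed.

Lemma laplace_hess x : W x -> \tr (hess x *m invmx (G x)) =
  \sum_l pd a l (fun y => dgrad y 0 l) x + \sum_m dgrad x 0 m * ctrace a g m x.
Proof.
move=> Wx; have -> : \sum_m dgrad x 0 m * ctrace a g m x =
    \sum_l \sum_m dgrad x 0 m * christoffel g a l m l x.
  rewrite exchange_big /=; apply: eq_bigr => m _; rewrite mulr_sumr.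
  by [].
rewrite -big_split /=; apply: eq_bigr => l _.
have := congr1 (fun z : 'rV_n => z 0 l) (nabla_dgrad (basis_vec l) Wx).
rewrite -mulmxA -rowE /= [in X in _ = X -> _]mxE => <-; rewrite mxE; congr (_ + _).
  by rewrite mxE.
by rewrite mxE; apply: eq_bigr => m _; rewrite conn_basis.
Qed.

(** The new Christoffel symbols, old ones plus [conf_term], are inserted into [ricciE]. The
    derivatives of the metric from the divergence of the difference tensor cancel against the mixed
    terms by metric compatibility; the other first order terms complete second derivatives of s to
    the Hessian and its trace. *)
Lemma ricci_conf x : W x -> ricci h a x = ricci g a x
  - (n%:R - 2) *: (hess x - (drow x)^T *m drow x)
  - (\tr (hess x *m invmx (G x)) + (n%:R - 2) * Nrm x) *: G x.
Proof.
move=> Wx; apply/matrixP => i j.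
rewrite (ricciE oW Wa mh i j Wx).
pose C i j l y := conf_term (fun i j => G y i j) (fun i => drow y 0 i)
  (fun i => dgrad y 0 i) i j l.
pose Ga i j l := christoffel g a i j l x.
have sdr k : smooth_in a W (fun y => drow y 0 k) by exact: smooth_drow.
have sdg k : smooth_in a W (fun y => dgrad y 0 k) by exact: smooth_dgrad.
have sc i' j' l' : smooth_in a W (christoffel g a i' j' l').
  exact: (smooth_christoffel oW Wa mg).
have sdl (k l : 'I_n) (c : R) : smooth_in a W (fun y => drow y 0 k * c).
  by apply: smooth_inM => //; exact: smooth_in_cst.
have sGu k : smooth_in a W (fun y => G y i j * dgrad y 0 k).
  by apply: smooth_inM => //; exact: sg.
have sC l : smooth_in a W (C i j l).
  by apply: smooth_inB => //; apply: smooth_inD => //; exact: sdl.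
have dpd k m : pd a k (fun y => drow y 0 m) x = pd a k (pd a m s) x.
  by rewrite /pd; congr (dir a _ _ x); apply/funext => y; rewrite mxE.
have pdc k (f : M -> R) (c : R) : smooth_in a W f -> pd a k (fun y => f y * c) x = pd a k f x * c.
  move=> sf; rewrite /pd (dirM oW Wa _ Wx sf (smooth_in_cst a W c)) dir_cst mulr0 addr0.
  by [].
have dC l : pd a l (C i j l) x = pd a l (pd a i s) x * (j == l)%:R
     + pd a l (pd a j s) x * (i == l)%:R
     - (pd a l (fun y => G y i j) x * dgrad x 0 l + G x i j * pd a l (fun y => dgrad y 0 l) x).
  rewrite {1}/pd (dirB oW Wa _ Wx); [|by apply: smooth_inD => //; exact: sdl|exact: sGu].
  rewrite (dirD oW Wa _ Wx (sdl _ l _) (sdl _ l _)) -![dir a (basis_vec l) _ x]/(pd a l _ x).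
  rewrite (pdc _ _ _ (sdr _)) (pdc _ _ _ (sdr _)) !dpd; congr (_ - _).
  exact: (dirM oW Wa _ Wx (sg i j) (sdg l)).
have dch l : pd a l (christoffel h a i j l) x =
    pd a l (christoffel g a i j l) x + pd a l (C i j l) x.
  rewrite -[RHS](dirD oW Wa _ Wx (sc i j l) (sC l)).
  by apply: (dir_eq oW Wa _ Wx) => y Wy; exact: christoffel_conf.
have -> : \sum_l pd a l (christoffel h a i j l) x =
    \sum_l pd a l (christoffel g a i j l) x + (pd a j (pd a i s) x + pd a i (pd a j s) x)
    - (\sum_l dgrad x 0 l * pd a l (fun y => G y i j) x
       + G x i j * \sum_l pd a l (fun y => dgrad y 0 l) x).
  exact: (@sum_conf_derivative R n (fun l => pd a l (christoffel h a i j l) x)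
    (fun l => pd a l (christoffel g a i j l) x) (fun l => pd a l (pd a i s) x)
    (fun l => pd a l (pd a j s) x) (fun l => pd a l (fun y => G y i j) x)
    (fun l => dgrad x 0 l) (fun l => pd a l (fun y => dgrad y 0 l) x) (G x i j) i j
    (fun l => etrans (dch l) (congr1 _ (dC l)))).
have -> : pd a j (pd a i s) x = pd a i (pd a j s) x by exact: (pdC oW Wa j i Wx ss).
have -> : pd a i (ctrace a h j) x = pd a i (ctrace a g j) x + n%:R * pd a i (pd a j s) x.
  have sp : smooth_in a W (pd a j s) by exact: smooth_in_pd.
  have sp' : smooth_in a W (fun y => n%:R * pd a j s y).
    by apply: smooth_inM => //; exact: smooth_in_cst.
  have -> : pd a i (ctrace a h j) x = pd a i (fun y => ctrace a g j y + n%:R * pd a j s y) x.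
    by apply: (dir_eq oW Wa _ Wx) => y Wy; exact: ctrace_conf.
  rewrite {1}/pd (dirD oW Wa _ Wx (smooth_ctrace oW Wa mg j) sp').
  by rewrite (dirM oW Wa _ Wx (smooth_in_cst a W n%:R) sp) dir_cst mul0r add0r.
have Gs k l : G x k l = G x l k by exact: (metric_sym mg).
have Gas k l m : Ga k l m = Ga l k m by exact: (christoffelC oW Wa mg).
have Gsu k : \sum_l G x l k * dgrad x 0 l = drow x 0 k.
  by rewrite -(dgradG Wx) mxE; apply: eq_bigr => l _; rewrite mulrC.
have -> : \sum_l \sum_m (christoffel h a i j m x * christoffel h a l m l x
                       - christoffel h a l j m x * christoffel h a i m l x) =
   \sum_l \sum_m (christoffel g a i j m x * christoffel g a l m l x
                       - christoffel g a l j m x * christoffel g a i m l x)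
   + (\sum_l \sum_m (Ga i j m * C l m l x + C i j m x * Ga l m l
                 - Ga l j m * C i m l x - C l j m x * Ga i m l)
      + \sum_l \sum_m (C i j m x * C l m l x - C l j m x * C i m l x)).
  rewrite -!big_split /=; apply: eq_bigr => l _; rewrite -!big_split /=.
  apply: eq_bigr => m _; rewrite !christoffel_conf // -/(Ga i j m) -/(Ga l m l) -/(Ga l j m) -/(Ga i m l).
  rewrite -/(C i j m x) -/(C l m l x) -/(C l j m x) -/(C i m l x).
  move: (Ga i j m) (Ga l m l) (Ga l j m) (Ga i m l) (C i j m x) (C l m l x) (C l j m x) (C i m l x).
  by move=> *; ring.
have -> : \sum_l \sum_m (Ga i j m * C l m l x + C i j m x * Ga l m l
      - Ga l j m * C i m l x - C l j m x * Ga i m l) =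
    (n%:R - 2) * (\sum_m Ga i j m * drow x 0 m)
    - G x i j * (\sum_m dgrad x 0 m * \sum_l Ga l m l)
    + \sum_l dgrad x 0 l * (\sum_m (Ga l j m * G x m i + Ga l i m * G x m j)).
  exact: (conf_mixed Gs Gas Gsu).
have -> : \sum_l \sum_m (C i j m x * C l m l x - C l j m x * C i m l x) =
    (n%:R - 2) * (drow x 0 i * drow x 0 j)
    - (n%:R - 2) * (G x i j * \sum_m dgrad x 0 m * drow x 0 m).
  exact: (conf_quadratic Gs Gsu).
have -> : \sum_l dgrad x 0 l * (\sum_m (Ga l j m * G x m i + Ga l i m * G x m j)) =
   \sum_l dgrad x 0 l * pd a l (fun y => G y i j) x.
  by apply: eq_bigr => l _; rewrite (pd_metric oW Wa mg).
have -> : \sum_m dgrad x 0 m * drow x 0 m = Nrm x.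
  by rewrite NrmE // mxE; apply: eq_bigr => m _; rewrite [X in _ = _ * X]mxE.
have -> : \sum_m Ga i j m * drow x 0 m = \sum_m christoffel g a i j m x * pd a m s x.
  by apply: eq_bigr => m _; rewrite [X in _ * X = _]mxE.
rewrite -/(ctrace a g _ x) laplace_hess //.
rewrite [RHS]mxE [X in _ = _ + X]mxE [X in _ = _ - X]mxE [X in _ = X + _]mxE (ricciE oW Wa mg i j Wx).
have -> : (- ((n%:R - 2) *: (hess x - (drow x)^T *m drow x))) i j =
    - ((n%:R - 2) * (pd a i (pd a j s) x - \sum_m christoffel g a i j m x * pd a m s x
       - drow x 0 i * drow x 0 j)).
  have -> : pd a i (pd a j s) x - \sum_m christoffel g a i j m x * pd a m s x = hess x i j.
    by rewrite mxE.
  by move: (hess x) (drow x) => H r; rewrite !mxE big_ord1 !mxE.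
rewrite -[\sum_m _ * (\sum_l Ga l m l)]/(\sum_m dgrad x 0 m * ctrace a g m x).
move: (pd a i (ctrace a g j) x) (pd a i (pd a j s) x) (\sum_l pd a l (fun y => dgrad y 0 l) x).
move: (\sum_l pd a l (christoffel g a i j l) x) (\sum_m dgrad x 0 m * ctrace a g m x).
move: (\sum_l dgrad x 0 l * pd a l (fun y => G y i j) x) (Nrm x).
move: (\sum_m christoffel g a i j m x * pd a m s x) (\sum_l \sum_m _).
move: (G x i j) (drow x 0 i) (drow x 0 j) => *.
by ring.
Qed.

Lemma conf_inv x : W x -> invmx (h a x) = expR (- (2 * s x)) *: invmx (G x).
Proof.
move=> Wx; have hU : h a x \in unitmx by case: mh => _ _; exact.
apply: (can_inj (mulmxK hU)); rewrite mulVmx // hg // -scalemxAl -scalemxAr mulVmx ?gU //.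
by rewrite scalerA -expRD addNr expR0 scale1r.
Qed.

Lemma sharp_conf w x : W x -> sharp h a x w = expR (- (2 * s x)) *: sharp g a x w.
Proof. by move=> Wx; rewrite /sharp conf_inv // -scalemxAr. Qed.

Lemma scal_conf x : W x -> scal h a x = expR (- (2 * s x)) *
  (scal g a x - 2 * (n%:R - 1) * \tr (hess x *m invmx (G x))
   - (n%:R - 2) * (n%:R - 1) * Nrm x).
Proof.
move=> Wx; rewrite /scal conf_inv // ricci_conf // -scalemxAl mxtraceZ; congr (_ * _).
have trN : \tr (invmx (G x) *m ((drow x)^T *m drow x)) = Nrm x.
  rewrite NrmE // mulmxA mxtrace_mulC mulmxA /mxtrace big_ord1.
  by [].
have trG : \tr (invmx (G x) *m G x) = n%:R by rewrite mulVmx ?gU // mxtrace1.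
have trB (A B : 'M[R]_n) : \tr (A - B) = \tr A - \tr B by rewrite linearB.
rewrite !mulmxBr -!scalemxAr mulmxBr !trB !mxtraceZ trB trN trG.
rewrite [\tr (invmx _ *m hess _)]mxtrace_mulC.
move: (\tr (hess x *m _)) (\tr (_ *m ricci g a x)) (bform _ _ _) => *; ring.
Qed.

Hypothesis n3 : (3 <= n)%N.

(** The scalar curvature term is weighted so that the trace of the Hessian drops out; the Hessian
    itself enters with a plus sign because the Ricci tensor enters the Schouten tensor with a minus
    sign. *)
Lemma schouten_conf x : W x -> schouten h a x = schouten g a x + hess x
  - (drow x)^T *m drow x + (2^-1 * Nrm x) *: G x.
Proof.
move=> Wx.
have n2 : (n%:R - 2 : R) != 0 by rewrite subr_eq0 eqr_nat; case: n n3 => [|[|[]]].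
have n1 : (n%:R - 1 : R) != 0 by rewrite subr_eq0 -[1]/(1%:R) eqr_nat; case: n n3 => [|[]].
rewrite /schouten scal_conf // ricci_conf // hg // scalerA.
have e : expR (- (2 * s x)) * expR (2 * s x) = 1 by rewrite -expRD addNr expR0.
move: (hess x) ((drow x)^T *m _) (ricci _ _ _) (scal g a x) (bform _ _ _) (\tr (hess x *m _)) => H d r S N t.
apply/matrixP => i j; rewrite !mxE.
move: (G x i j) (r i j) (H i j) (d i j) => Gij rij Hij dij.
(* Cancels the two opposite exponential factors, whose relation [field] cannot see. *)
have E (u v z w : R) : u * v = 1 -> u * z / w * v = z / w.
  by move=> uv; rewrite -[RHS]mul1r -uv; ring.
rewrite (E _ _ _ _ e).
by field; rewrite n1 n2.
Qed.

Lemma schouten_sym x : W x -> (schouten g a x)^T = schouten g a x.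
Proof.
move=> Wx; rewrite /schouten.
move: (ricci g a x) (ricci_sym oW Wa mg Wx) (G x) (gT Wx) => A AT B BT.
have sym (C : 'M[R]_n) i j : C^T = C -> C j i = C i j by move=> CT; rewrite -{1}CT mxE.
by apply/matrixP => i j; rewrite !mxE (sym A) // (sym B).
Qed.

Opaque schouten.

Lemma row_hess_pair v (u : 'rV[R]_n) x : W x -> (v *m hess x *m u^T) 0 0 =
  (u *m (mder a v drow x)^T) 0 0 - (u *m conn a g v x *m (drow x)^T) 0 0.
Proof.
move=> Wx; rewrite row_hess // mulmxBl [LHS]mxE [X in _ + X]mxE.
have T (A : 'M[R]_1) : A^T 0 0 = A 0 0 by rewrite mxE.
by rewrite -(T (mder _ _ _ _ *m _)) -(T (_ *m _^T *m _)) !trmx_mul !trmxK mulmxA.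
Qed.

Lemma dir_pair v (Y Z : M -> 'rV[R]_n) x : W x -> smooth_mx a W Y -> smooth_mx a W Z ->
  dir a v (fun y => (Y y *m (Z y)^T) 0 0) x =
  (mder a v Y x *m (Z x)^T) 0 0 + (Y x *m (mder a v Z x)^T) 0 0.
Proof.
move=> Wx sY sZ; have sZT := smooth_mx_tr sZ.
have := congr1 (fun A : 'M[R]_1 => A 0 0) (mderM oW Wa Wx v sY sZT).
by rewrite [X in X = _ -> _]mxE [X in _ = X -> _]mxE (mder_tr _ _ _ _ sZ).
Qed.

Lemma dir_d v (Y : M -> 'rV[R]_n) x : W x -> smooth_mx a W Y ->
  dir a v (fun y => dir a (Y y) s y) x =
  ((mder a v Y x + Y x *m conn a g v x) *m (drow x)^T) 0 0 + (v *m hess x *m (Y x)^T) 0 0.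
Proof.
move=> Wx sY.
rewrite (dir_eq oW Wa v Wx (g := fun y => (Y y *m (drow y)^T) 0 0)); last first.
  by move=> y Wy; rewrite dir_drow.
rewrite dir_pair //; last exact: smooth_drow.
rewrite row_hess_pair // mulmxDl [X in _ = X + _]mxE.
move: ((mder a v Y x *m _) 0 0) ((Y x *m _^T) 0 0) => p q.
by rewrite [LHS]addrC; ring.
Qed.

Lemma dir_Nrm v x : W x -> dir a v (fun y => Nrm y) x = 2 * (v *m hess x *m (dgrad x)^T) 0 0.
Proof.
move=> Wx.
rewrite (dir_eq oW Wa v Wx (g := fun y => (dgrad y *m (drow y)^T) 0 0)); last exact: NrmE.
rewrite (dir_pair _ Wx smooth_dgrad smooth_drow).
have -> : (dgrad x *m (mder a v drow x)^T) 0 0 =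
    (v *m hess x *m (dgrad x)^T) 0 0 + (dgrad x *m conn a g v x *m (drow x)^T) 0 0.
  by rewrite row_hess_pair // subrK.
have -> : mder a v dgrad x = v *m hess x *m invmx (G x) - dgrad x *m conn a g v x.
  by rewrite -nabla_dgrad // addrK.
rewrite mulmxBl [X in X + _]mxE [X in _ + X + _]mxE.
have -> : v *m hess x *m invmx (G x) *m (drow x)^T = v *m hess x *m (dgrad x)^T.
  by rewrite -(dgradG Wx) trmx_mul gT // mulmxA mulmxKV ?gU.
by move: ((_ *m _ *m (dgrad x)^T) 0 0) ((_ *m _ *m (drow x)^T) 0 0) => p q; ring.
Qed.

Lemma smooth_tal (t : M -> 'rV[R]_(1 + n + 1)) : smooth_mx a W t -> smooth_in a W (tal \o t).
Proof. by move=> st; exact: (smooth_mx_lsub (smooth_mx_lsub st) 0 0). Qed.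

Lemma smooth_tbe (t : M -> 'rV[R]_(1 + n + 1)) : smooth_mx a W t -> smooth_in a W (tbe \o t).
Proof. by move=> st; exact: (smooth_mx_rsub st 0 0). Qed.

Lemma smooth_tvec (t : M -> 'rV[R]_(1 + n + 1)) : smooth_mx a W t -> smooth_mx a W (tvec \o t).
Proof. by move=> st; exact: (smooth_mx_rsub (smooth_mx_lsub st)). Qed.

Lemma talE (al be : R) (Y : 'rV[R]_n) : tal (tractor al Y be) = al.
Proof. by rewrite /tal /tractor !row_mxKl mxE. Qed.

Lemma tvecE (al be : R) (Y : 'rV[R]_n) : tvec (tractor al Y be) = Y.
Proof. by rewrite /tvec /tractor row_mxKl row_mxKr. Qed.

Lemma tbeE (al be : R) (Y : 'rV[R]_n) : tbe (tractor al Y be) = be.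
Proof. by rewrite /tbe /tractor row_mxKr mxE. Qed.

Lemma tractorK (t : 'rV[R]_(1 + n + 1)) : tractor (tal t) (tvec t) (tbe t) = t.
Proof. by rewrite /tractor /tal /tvec /tbe -!mx11_scalar !hsubmxK. Qed.

Lemma smooth_Nrm : smooth_in a W (fun y => Nrm y).
Proof.
have := smooth_mxM oW Wa (smooth_mxM oW Wa smooth_dgrad sg) (smooth_mx_tr smooth_dgrad).
by move=> /(_ 0 0).
Qed.

Variable t : M -> 'rV[R]_(1 + n + 1).
Hypothesis st : smooth_mx a W t.

Local Notation al := (tal \o t).
Local Notation Y := (tvec \o t).
Local Notation be := (tbe \o t).
Let sal := smooth_tal st.
Let sY := smooth_tvec st.
Let sbe := smooth_tbe st.

Lemma bform_schouten_conf v (u : 'rV[R]_n) x : W x ->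
  bform (schouten h a x) v u = bform (schouten g a x) v u + (v *m hess x *m u^T) 0 0
   - dir a v s x * (u *m (drow x)^T) 0 0 + 2^-1 * Nrm x * bform (G x) v u.
Proof.
move=> Wx; rewrite /bform schouten_conf // !mulmxDr !mulmxDl mulmxN mulNmx.
rewrite dir_drow // mxE [X in X + _]mxE [X in X + _ + _]mxE [X in _ + X + _]mxE [X in _ + X]mxE.
congr (_ + _ - _ + _).
  rewrite mulmxA -mulmxA mxE big_ord1; congr (_ * _).
  exact: pairC.
transitivity ((v *m ((2^-1 * Nrm x) *: G x) *m u^T) 0 0); first by rewrite mxE.
by rewrite -scalemxAr -scalemxAl mxE.
Qed.

Local Notation T := (fun y => gauge_change g a s y (t y)).
Local Notation gr := dgrad.

Lemma tal_gauge : tal \o T = fun y => expR (- s y) *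
  (al y - dir a (Y y) s y - 2^-1 * be y * Nrm y).
Proof. by apply/funext => y; rewrite /= /gauge_change talE. Qed.

Lemma tvec_gauge : tvec \o T = fun y => expR (- s y) *: (Y y + be y *: gr y).
Proof. by apply/funext => y; rewrite /= /gauge_change tvecE. Qed.

Lemma tbe_gauge : tbe \o T = fun y => expR (s y) * be y.
Proof. by apply/funext => y; rewrite /= /gauge_change tbeE. Qed.

Lemma smooth_expN : smooth_in a W (fun y => expR (- s y)).
Proof. by apply: smooth_in_exp => //; exact: smooth_inN. Qed.

Lemma dir_expN v x : W x ->
  dir a v (fun y => expR (- s y)) x = expR (- s x) * - dir a v s x.
Proof. by move=> Wx; rewrite (dir_exp oW Wa v Wx (smooth_inN oW Wa ss)) (dirN oW Wa v Wx ss). Qed.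

Lemma tvec_gauge_covariant v x : W x ->
  tvec (nabla_nc h a v T x) = tvec (gauge_change g a s x (nabla_nc g a v t x)).
Proof.
move=> Wx; rewrite /nabla_nc [in RHS]/gauge_change !tvecE !tbeE nablaE nablaE.
have sbg : smooth_mx a W (fun y => be y *: gr y) by apply: smooth_mx_scale => //; exact: smooth_dgrad.
have sYb : smooth_mx a W (fun y => Y y + be y *: gr y) by exact: smooth_mxD.
have -> : mder a v (tvec \o T) x = expR (- s x) *: (- dir a v s x *: (Y x + be x *: gr x) +
    (mder a v Y x + (dir a v be x *: gr x + be x *: mder a v gr x))).
  rewrite tvec_gauge (mderZ oW Wa Wx v smooth_expN sYb) dir_expN // -scalerA -scalerDr.
  by rewrite (mderD oW Wa Wx v sY sbg) (mderZ oW Wa Wx v sbe smooth_dgrad).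
have -> : (tvec \o T) x *m conn a h v x = expR (- s x) *: (Y x *m conn a g v x
    + be x *: (gr x *m conn a g v x)
    + dir a v s x *: (Y x + be x *: gr x) + (dir a (Y x) s x + be x * Nrm x) *: v
    - (bform (G x) v (Y x) + be x * dir a v s x) *: gr x).
  rewrite tvec_gauge -scalemxAl conn_conf //; congr (_ *: _).
  rewrite mulmxBr !mulmxDr mulmxDl -scalemxAl mul_mx_scalar !mulmxA.
  congr (_ + _ - _).
    rewrite [(_ + _) *m _]mx11_scalar mul_scalar_mx pairDl pairZl.
    by rewrite -dir_drow // -NrmE.
  rewrite [(_ + _) *m _^T]mx11_scalar mul_scalar_mx pairDl pairZl pairC [X in _ * X]pairC.
  by rewrite (dir_dgrad v Wx) -scalemxAl.
(* The Hessian in the new Schouten tensor is rewritten as the covariant derivative of the gradient,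
   ready to cancel against the derivative of the term [be y *: gr y] of the gauge change. *)
have -> : (expR (s x) * tbe (t x)) *: sharp h a x (v *m schouten h a x) = expR (- s x) *: (be x *:
    (sharp g a x (v *m schouten g a x) + (mder a v gr x + gr x *m conn a g v x)
      - dir a v s x *: gr x + (2^-1 * Nrm x) *: v)).
  rewrite sharp_conf // scalerA.
  have -> : expR (s x) * tbe (t x) * expR (- (2 * s x)) = expR (- s x) * be x.
    have -> : - s x = s x - 2 * s x by ring.
    by rewrite expRD mulrAC.
  rewrite -scalerA /sharp; congr (_ *: (_ *: _)).
  rewrite nabla_dgrad // schouten_conf // !(mulmxDr, mulmxDl) mulmxN mulNmx; congr (_ + _ - _ + _).
    rewrite mulmxA -mulmxA [v *m _^T]mx11_scalar mul_scalar_mx -dir_drow //.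
  by rewrite -scalemxAr -scalemxAl mulmxK ?gU.
rewrite -[tal (gauge_change _ _ _ _ _)]/((tal \o T) x) tal_gauge -/(dgrad x).
rewrite -[tvec (t x)]/(Y x) -[tal (t x)]/(al x) -[tbe (t x)]/(be x).
move: (sharp g a x _) (mder a v gr x) (gr x *m _) (mder a v Y x) (Y x *m _) (expR _).
move: (dir a (Y x) s x) (dir a v s x) (bform _ v _) (al x) (be x) (dir a v be x) (Nrm x).
move: (Y x) (gr x) => y r b1 b2 b3 b4 b5 b6 b7 c1 c2 c3 c4 c5 e.
apply/rowP => i; rewrite !mxE.
move: (y 0 i) (r 0 i) (v 0 i) (c1 0 i) (c2 0 i) (c3 0 i) (c4 0 i) (c5 0 i) => *.
by field.
Qed.

Lemma tbe_gauge_covariant v x : W x ->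
  tbe (nabla_nc h a v T x) = tbe (gauge_change g a s x (nabla_nc g a v t x)).
Proof.
move=> Wx; rewrite /nabla_nc [in RHS]/gauge_change !tbeE.
rewrite tbe_gauge hg // [X in bform _ _ X]tvecE bformZ bformZr bformDr bformZr.
rewrite (dirM oW Wa v Wx (smooth_in_exp oW Wa ss) sbe) (dir_exp oW Wa v Wx ss) -dir_dgrad //.
have -> : expR (2 * s x) = expR (s x) * expR (s x) by rewrite -expRD; congr expR; ring.
have e : expR (s x) * expR (- s x) = 1 by rewrite -expRD subrr expR0.
rewrite -[tvec (t x)]/(Y x) -[(tbe \o t) x]/(tbe (t x)).
move: (dir a v s x) (dir a v be x) (bform _ _ _) (expR (s x)) (expR (- s x)) e (tbe (t x)).
move=> ds db b e1 e2 E be0.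
rewrite (_ : e1 * e1 * (e2 * (b + be0 * ds)) = e1 * (e1 * e2) * (b + be0 * ds)); last by ring.
by rewrite E; ring.
Qed.

Lemma dir_tal_gauge v x : W x -> dir a v (tal \o T) x =
  expR (- s x) * - dir a v s x * (al x - dir a (Y x) s x - 2^-1 * be x * Nrm x) +
  expR (- s x) * (dir a v al x
    - (((mder a v Y x + Y x *m conn a g v x) *m (drow x)^T) 0 0 + (v *m hess x *m (Y x)^T) 0 0)
    - (2^-1 * dir a v be x * Nrm x + 2^-1 * be x * (2 * (v *m hess x *m (gr x)^T) 0 0))).
Proof.
move=> Wx.
have sdY : smooth_in a W (fun y => dir a (Y y) s y).
  apply: (eq_smooth_in oW Wa (f := fun y => (Y y *m (drow y)^T) 0 0)).
    by move=> y Wy; rewrite dir_drow.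
  exact: (smooth_mxM oW Wa sY (smooth_mx_tr smooth_drow) 0 0).
have sb2 : smooth_in a W (fun y => 2^-1 * be y).
  by apply: smooth_inM => //; exact: smooth_in_cst.
have sbN : smooth_in a W (fun y => 2^-1 * be y * Nrm y).
  by apply: smooth_inM => //; exact: smooth_Nrm.
have sad : smooth_in a W (fun y => al y - dir a (Y y) s y) by exact: smooth_inB.
have sall : smooth_in a W (fun y => al y - dir a (Y y) s y - 2^-1 * be y * Nrm y).
  exact: smooth_inB.
rewrite tal_gauge (dirM oW Wa v Wx smooth_expN sall) dir_expN //.
rewrite (dirB oW Wa v Wx sad sbN) (dirB oW Wa v Wx sal sdY).
rewrite (dirM oW Wa v Wx sb2 smooth_Nrm) (dirM oW Wa v Wx (smooth_in_cst a W 2^-1) sbe) dir_cst.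
by rewrite (dir_d v Wx sY) (dir_Nrm v Wx) mul0r add0r.
Qed.

Lemma dir_tvec_nabla_nc v x : W x ->
  dir a (nabla g a v Y x + al x *: v - be x *: sharp g a x (v *m schouten g a x)) s x =
  ((mder a v Y x + Y x *m conn a g v x) *m (drow x)^T) 0 0 + al x * dir a v s x
    - be x * bform (schouten g a x) v (gr x).
Proof.
move=> Wx; rewrite (dir_drow _ Wx) nablaE [LHS]pairDl [X in X + _]pairDl pairNl !pairZl.
rewrite -(dir_drow v Wx) /sharp -mulmxA -[in X in _ - _ * X = _](dgradG Wx) trmx_mul gT //.
by rewrite [invmx _ *m _]mulmxA mulVmx ?gU // mul1mx.
Qed.

Opaque bform.

Lemma tal_gauge_covariant v x : W x ->
  tal (nabla_nc h a v T x) = tal (gauge_change g a s x (nabla_nc g a v t x)).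
Proof.
move=> Wx; rewrite /nabla_nc [in RHS]/gauge_change !talE !tvecE !tbeE.
have bfY : bform (schouten h a x) v (expR (- s x) *: (Y x + be x *: gr x)) = expR (- s x) *
    (bform (schouten g a x) v (Y x) + (v *m hess x *m (Y x)^T) 0 0
      - dir a v s x * dir a (Y x) s x + 2^-1 * Nrm x * bform (G x) v (Y x)
     + be x * (bform (schouten g a x) v (gr x) + (v *m hess x *m (gr x)^T) 0 0
      - dir a v s x * Nrm x + 2^-1 * Nrm x * dir a v s x)).
  have K1 := bform_schouten_conf v (Y x) Wx; rewrite -(dir_drow (Y x) Wx) in K1.
  have K2 := bform_schouten_conf v (gr x) Wx.
  rewrite -(NrmE Wx) -(dir_dgrad v Wx) in K2.
  have comb (e b p p' q q' : R) : p = p' -> q = q' -> e * (p + b * q) = e * (p' + b * q').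
    by move=> -> ->.
  have bfE (A : 'M[R]_n) : bform A v (expR (- s x) *: (Y x + be x *: gr x)) =
      expR (- s x) * (bform A v (Y x) + be x * bform A v (gr x)).
    by rewrite bformZr bformDr bformZr.
  exact: etrans (bfE _) (comb _ _ _ _ _ _ K1 K2).
have addE (p p' q q' r : R) : p = p' -> q = q' -> p' + q' = r -> p + q = r by move=> -> ->.
have rhsE (e c d w r r' : R) : r = r' -> e * (c + d - r - w) = e * (c + d - r' - w) by move=> ->.
apply: (addE _ _ _ _ _ (dir_tal_gauge v Wx) bfY).
apply: etrans (esym (rhsE _ _ _ _ _ _ (dir_tvec_nabla_nc v Wx))).
rewrite -/(dgrad x) -[tvec (t x)]/(Y x).
move: (dir a v (tbe \o t) x) (dir a v (tal \o t) x) (dir a (Y x) s x) (dir a v s x) (Nrm x).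
move: (bform (G x) v (Y x)) (bform (schouten g a x) v (Y x)) (bform (schouten g a x) v (gr x)).
move: (al x) (be x) (expR (- s x)) ((v *m hess x *m (Y x)^T) 0 0).
move: ((v *m hess x *m (gr x)^T) 0 0) (((mder a v Y x + Y x *m conn a g v x) *m (drow x)^T) 0 0).
by move=> *; field.
Qed.

Transparent bform schouten.

(** The three components are compared separately. The vector component needs the change of the
    connection, and both it and the first component need the change of the Schouten tensor, whose
    Hessian terms are those produced by differentiating the gradient in the gauge change. *)
Lemma gauge_covariant v x : W x ->
  nabla_nc h a v T x = gauge_change g a s x (nabla_nc g a v t x).
Proof.
move=> Wx; rewrite -[LHS]tractorK -[RHS]tractorK.
by rewrite tal_gauge_covariant // tvec_gauge_covariant // tbe_gauge_covariant.
Qed.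

End ConformalChange.

(** * Tractors *)

Section TractorAlgebra.
Context {R : realType} {n : nat}.
Implicit Types (t : 'rV[R]_(1 + n + 1)) (Y : 'rV[R]_n) (G : 'M[R]_n).

(** The maps between splittings are bare functions whose linearity is proved separately, for gauge
    changes even pointwise; the linear structure is packed here. *)
Lemma mul_lin1 m r (f : 'rV[R]_m -> 'rV[R]_r) : linear f -> forall u, u *m lin1_mx f = f u.
Proof.
move=> lf u.
pose F : {linear 'rV[R]_m -> 'rV[R]_r} := HB.pack f (GRing.isLinear.Build _ _ _ _ f lf).
exact: (mul_rV_lin1 F).
Qed.

Lemma eq_mulmx m r (A B : 'M[R]_(m, r)) : (forall u : 'rV_m, u *m A = u *m B) -> A = B.
Proof. by move=> AB; apply/row_matrixP => i; rewrite !rowE. Qed.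

Lemma talD t1 t2 : tal (t1 + t2) = tal t1 + tal t2. Proof. by rewrite /tal !mxE. Qed.
Lemma talZ c t : tal (c *: t) = c * tal t. Proof. by rewrite /tal !mxE. Qed.
Lemma tbeD t1 t2 : tbe (t1 + t2) = tbe t1 + tbe t2. Proof. by rewrite /tbe !mxE. Qed.
Lemma tbeZ c t : tbe (c *: t) = c * tbe t. Proof. by rewrite /tbe !mxE. Qed.
Lemma tvecD t1 t2 : tvec (t1 + t2) = tvec t1 + tvec t2.
Proof. by apply/rowP => i; rewrite /tvec !mxE. Qed.
Lemma tvecZ c t : tvec (c *: t) = c *: tvec t.
Proof. by apply/rowP => i; rewrite /tvec !mxE. Qed.

Lemma tvec_lin : linear (@tvec R n).
Proof. by move=> c u v; rewrite tvecD tvecZ. Qed.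

Lemma tractor_ext t1 t2 : tal t1 = tal t2 -> tvec t1 = tvec t2 -> tbe t1 = tbe t2 -> t1 = t2.
Proof. by move=> e1 e2 e3; rewrite -[t1]tractorK -[t2]tractorK e1 e2 e3. Qed.

Lemma vec_tractor_lin : linear (fun Y => @tractor R n 0 Y 0).
Proof.
move=> c u v; apply: tractor_ext; rewrite ?talD ?tvecD ?tbeD ?talZ ?tvecZ ?tbeZ ?talE ?tvecE ?tbeE //.
  by rewrite mulr0 addr0.
by rewrite mulr0 addr0.
Qed.

Lemma chart_change_lin J : linear (@chart_change R n J).
Proof.
move=> c u v; apply: tractor_ext; rewrite ?talD ?tvecD ?tbeD ?talZ ?tvecZ ?tbeZ ?talE ?tvecE ?tbeE //.
  by rewrite talD talZ.
  by rewrite tvecD tvecZ mulmxDl scalemxAl.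
by rewrite tbeD tbeZ.
Qed.

Lemma tform_Iminus G t : tform G t (@I_minus R n) = tbe t.
Proof. by rewrite /tform talE tbeE tvecE mulr0 add0r mul1r /bform trmx0 mulmx0 mxE addr0. Qed.

Lemma I_minus_perpP G t : reflect (tbe t = 0) (t <= I_minus_perp G)%MS.
Proof.
have lf : linear (fun t => (tform G t (@I_minus R n))%:M : 'rV[R]_1).
  by move=> c u v; apply/rowP => i; rewrite !mxE !tform_Iminus tbeD tbeZ ord1 eqxx !mulr1n.
apply: (iffP sub_kermxP); rewrite (mul_lin1 lf) tform_Iminus.
  by move/matrixP/(_ 0 0); rewrite !mxE eqxx mulr1n.
by move=> ->; apply/matrixP => i j; rewrite !mxE mul0rn.
Qed.

Lemma lightlike_sub_bform G (L : 'M[R]_n) : lightlike G L ->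
  forall m (B : 'M[R]_(m, n)) r (C : 'M[R]_(r, n)), (B <= L)%MS -> (C <= L)%MS -> B *m G *m C^T = 0.
Proof.
move=> ll m B r C BL CL; apply/matrixP => i j.
have := ll (row i B) (row j C) (submx_trans (row_sub i B) BL) (submx_trans (row_sub j C) CL).
rewrite /bform [X in _ -> _ = X]mxE => <-.
rewrite !mxE; apply: eq_bigr => k _; rewrite !mxE; congr (_ * _).
by apply: eq_bigr => l _; rewrite !mxE.
Qed.

(* A is self-adjoint with lightlike image, hence squares to zero. *)
Lemma selfadjoint_lightlike G (L A : 'M[R]_n) : lightlike G L -> (A <= L)%MS ->
  G^T = G -> (A *m G)^T = A *m G -> G \in unitmx ->
  (forall m (B : 'M[R]_(m, n)), (B <= L)%MS -> B *m A = 0) /\ \tr A = 0.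
Proof.
move=> ll AL GT Asym GU.
have BA m (B : 'M[R]_(m, n)) : (B <= L)%MS -> B *m A = 0.
  move=> BL; apply: (can_inj (mulmxK GU)); rewrite mul0mx -mulmxA -Asym trmx_mul GT mulmxA.
  exact: lightlike_sub_bform BL AL.
split=> //; rewrite -(mulmx_base A) mxtrace_mulC.
suff -> : row_base A *m col_base A = 0 by rewrite mxtrace0.
apply: (row_free_inj (row_base_free A)); rewrite mul0mx -mulmxA mulmx_base.
by apply: BA; rewrite eq_row_base.
Qed.

(* gauge_change at a point, with the gradient of s as an independent argument. *)
Definition gauge_pt (sx : R) G (gr : 'rV[R]_n) t :=
  tractor (expR (- sx) * (tal t - bform G (tvec t) gr - 2^-1 * tbe t * bform G gr gr))
    (expR (- sx) *: (tvec t + tbe t *: gr)) (expR sx * tbe t).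

Lemma gauge_pt_lin sx G gr : linear (gauge_pt sx G gr).
Proof.
move=> c u v; apply: tractor_ext;
  rewrite ?talD ?tvecD ?tbeD ?talZ ?tvecZ ?tbeZ ?talE ?tvecE ?tbeE ?tbeD ?tbeZ ?talD ?talZ
    ?tvecD ?tvecZ.
- rewrite bformDl bformZl.
  by move: (bform _ _ _) (bform _ _ _) (bform _ _ _) (expR _) => *; ring.
- by apply/rowP => i; rewrite !mxE; ring.
- by ring.
Qed.

Lemma gauge_pt_iso sx G gr t1 t2 : G^T = G ->
  tform (expR (2 * sx) *: G) (gauge_pt sx G gr t1) (gauge_pt sx G gr t2) = tform G t1 t2.
Proof.
move=> GT; rewrite /tform !talE !tbeE !tvecE bformZ bformZl bformZr !(bformDl, bformDr).
rewrite !(bformZl, bformZr) (bformC gr (tvec t2) GT).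
have -> : expR (2 * sx) = expR sx * expR sx by rewrite -expRD; congr expR; ring.
have := expR_gt0 sx; rewrite expRN => /lt0r_neq0.
move: (expR sx) (tal t1) (tal t2) (tbe t1) (tbe t2) => u a1 a2 b1 b2 u0.
move: (bform G gr gr) (bform G (tvec t1) gr) (bform G (tvec t2) gr) (bform G (tvec t1) _).
move=> c1 c2 c3 c4.
by field.
Qed.

Lemma gauge_pt0 G t : gauge_pt 0 G 0 t = t.
Proof.
rewrite /gauge_pt oppr0 expR0 !mul1r scaler0 addr0 scale1r.
by rewrite /bform trmx0 !mulmx0 mxE mulr0 !subr0 tractorK.
Qed.

(** The cocycle property of the transitions. The factor exp (- 2 s1) turns a gradient for G into the
    gradient of the same function for exp (2 s1) G. *)
Lemma gauge_pt_comp s1 s2 G gr1 gr2 t : G^T = G ->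
  gauge_pt s2 (expR (2 * s1) *: G) (expR (- (2 * s1)) *: gr2) (gauge_pt s1 G gr1 t) =
  gauge_pt (s1 + s2) G (gr1 + gr2) t.
Proof.
move=> GT; apply: tractor_ext; rewrite !(talE, tvecE, tbeE).
- rewrite !bformZ !bformZr !bformZl !(bformDl, bformDr, bformZl, bformZr) (bformC gr2 gr1 GT).
  have -> : - (s1 + s2) = - s1 - s2 by ring.
  rewrite expRD !expRN.
  have -> : expR (2 * s1) = expR s1 * expR s1 by rewrite -expRD; congr expR; ring.
  have := expR_gt0 s1; have := expR_gt0 s2 => /lt0r_neq0 + /lt0r_neq0.
  move: (expR s1) (expR s2) => u w u0 w0.
  move: (bform _ gr1 gr1) (bform _ gr2 gr2) (bform _ gr1 gr2) (bform _ _ gr1) (bform _ _ gr2).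
  by move=> *; field; rewrite u0 w0.
- have -> : - (s1 + s2) = - s1 - s2 by ring.
  rewrite expRD !expRN.
  have -> : expR (2 * s1) = expR s1 * expR s1 by rewrite -expRD; congr expR; ring.
  have := expR_gt0 s1; have := expR_gt0 s2 => /lt0r_neq0 + /lt0r_neq0.
  move: (expR s1) (expR s2) => u w u0 w0.
  by apply/rowP => i; rewrite !mxE; field; rewrite u0 w0.
- by rewrite expRD; ring.
Qed.

Lemma gauge_pt_chart sx G (J : 'M[R]_n) gr t :
  chart_change J (gauge_pt sx (J *m G *m J^T) gr t) =
  gauge_pt sx G (gr *m J) (chart_change J t).
Proof.
apply: tractor_ext; rewrite !(talE, tvecE, tbeE) //.
  by rewrite /bform !trmx_mul !mulmxA.
by rewrite -scalemxAl mulmxDl -scalemxAl.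
Qed.

End TractorAlgebra.

(** * Changes of the splitting over a chart *)

Section Gauge.
Context {R : realType} {n : nat} {M : smoothManifold R n}.
Variables (a : chart_index M) (W : set M).
Hypotheses (oW : open W) (Wa : W `<=` cdom a).

Lemma gaugeE (g : tensor2 M) s x t : metric_in a W g -> smooth_in a W s -> W x ->
  gauge_change g a s x t = gauge_pt (s x) (g a x) (dgrad a g s x) t.
Proof. by move=> mg ss Wx; rewrite /gauge_change (dir_dgrad oW Wa mg ss _ Wx). Qed.

Lemma gauge_lin (g : tensor2 M) s x : metric_in a W g -> smooth_in a W s -> W x ->
  linear (gauge_change g a s x).
Proof.
move=> mg ss Wx c u v; rewrite !(gaugeE _ mg ss Wx); exact: gauge_pt_lin.
Qed.

Lemma smooth_gauge (g : tensor2 M) s (t : M -> 'rV[R]_(1 + n + 1)) :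
  metric_in a W g -> smooth_in a W s -> smooth_mx a W t ->
  smooth_mx a W (fun y => gauge_change g a s y (t y)).
Proof.
move=> mg ss st; apply: (eq_smooth_mx oW Wa (F := fun y => gauge_pt (s y) (g a y) (dgrad a g s y) (t y))).
  by move=> x Wx; rewrite (gaugeE _ mg ss Wx).
have sgr := smooth_dgrad oW Wa mg ss.
have sbf : forall Y Z : M -> 'rV[R]_n, smooth_mx a W Y -> smooth_mx a W Z ->
    smooth_in a W (fun y => bform (g a y) (Y y) (Z y)).
  move=> Y Z sY sZ; have sg : smooth_mx a W (g a) by case: mg.
  exact: (smooth_mxM oW Wa (smooth_mxM oW Wa sY sg) (smooth_mx_tr sZ) 0 0).
have scal1 (f : M -> R) : smooth_in a W f -> smooth_mx a W (fun y => (f y)%:M : 'M[R]_1).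
  move=> sf i j; apply: (eq_smooth_in oW Wa _ sf) => y _.
  by rewrite mxE !ord1 eqxx mulr1n.
have seN : smooth_in a W (fun y => expR (- s y)) by exact: smooth_in_exp (smooth_inN _ _ _).
have half : smooth_in a W (fun y => 2^-1 * tbe (t y)).
  by apply: smooth_inM => //; [exact: smooth_in_cst|exact: smooth_tbe st].
apply: smooth_mx_row; [apply: smooth_mx_row|].
- apply: scal1; apply: smooth_inM => //.
  apply: smooth_inB => //; [apply: smooth_inB => //|apply: smooth_inM => //].
  + exact: smooth_tal st.
  + by apply: sbf => //; exact: smooth_tvec st.
  + exact: sbf.
- apply: smooth_mx_scale => //; apply: smooth_mxD => //; first exact: smooth_tvec st.
  by apply: smooth_mx_scale => //; exact: smooth_tbe st.
- apply: scal1; apply: smooth_inM => //; last exact: smooth_tbe st.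
  exact: smooth_in_exp.
Qed.

Variables (g h : tensor2 M) (s1 s2 : M -> R).
Hypotheses (mg : metric_in a W g) (ss1 : smooth_in a W s1) (ss2 : smooth_in a W s2).
Hypothesis hg : forall x, W x -> h a x = expR (2 * s1 x) *: g a x.

Let gT x : W x -> (g a x)^T = g a x. Proof. by case: mg => _ + _; exact. Qed.
Let mh := conf_metric_in oW Wa mg ss1 hg.

Lemma gauge_iso x t1 t2 : W x ->
  tform (h a x) (gauge_change g a s1 x t1) (gauge_change g a s1 x t2) = tform (g a x) t1 t2.
Proof. by move=> Wx; rewrite !(gaugeE _ mg ss1 Wx) hg // gauge_pt_iso // gT. Qed.

Lemma dgradD x : W x -> dgrad a g (fun y => s1 y + s2 y) x = dgrad a g s1 x + dgrad a g s2 x.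
Proof.
move=> Wx; rewrite /dgrad /grad /sharp -mulmxDl; congr (_ *m _).
by apply/rowP => i; rewrite !mxE; exact: (dirD oW Wa _ Wx ss1 ss2).
Qed.

Lemma gauge_comp x t : W x -> gauge_change h a s2 x (gauge_change g a s1 x t) =
  gauge_change g a (fun y => s1 y + s2 y) x t.
Proof.
move=> Wx; rewrite (gaugeE _ mh ss2 Wx) (gaugeE _ mg ss1 Wx).
rewrite (gaugeE _ mg (smooth_inD oW Wa ss1 ss2) Wx) dgradD // -gauge_pt_comp ?gT //.
rewrite -hg //; congr (gauge_pt _ _ _ _).
by rewrite /dgrad /grad (sharp_conf oW Wa mg ss1 hg _ Wx).
Qed.

Lemma gauge_id x t : W x -> gauge_change g a (fun=> 0) x t = t.
Proof.
move=> Wx; have s0 : smooth_in a W (fun=> 0) by exact: smooth_in_cst.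
rewrite (gaugeE _ mg s0 Wx).
have -> : dgrad a g (fun=> 0) x = 0.
  rewrite /dgrad /grad /sharp (_ : \row_i _ = 0) ?mul0mx //.
  by apply/rowP => i; rewrite !mxE; exact: dir_cst.
exact: gauge_pt0.
Qed.

End Gauge.

Section GaugeInverse.
Context {R : realType} {n : nat} {M : smoothManifold R n}.
Variables (a : chart_index M) (W : set M).
Hypotheses (oW : open W) (Wa : W `<=` cdom a).
Variables (g h : tensor2 M) (s : M -> R).
Hypotheses (mg : metric_in a W g) (ss : smooth_in a W s).
Hypothesis hg : forall x, W x -> h a x = expR (2 * s x) *: g a x.

Lemma gaugeK x t : W x ->
  gauge_change h a (fun y => - s y) x (gauge_change g a s x t) = t.
Proof.
move=> Wx; rewrite (gauge_comp oW Wa mg ss (smooth_inN oW Wa ss) hg) //.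
have -> : (fun y => s y - s y) = (fun=> 0) by apply/funext => y; rewrite subrr.
exact: (gauge_id oW Wa mg t Wx).
Qed.

Lemma gauge_unit x : W x -> lin1_mx (gauge_change g a s x) \in unitmx.
Proof.
move=> Wx; have mh := conf_metric_in oW Wa mg ss hg.
have E : lin1_mx (gauge_change g a s x) *m lin1_mx (gauge_change h a (fun y => - s y) x) = 1%:M.
  apply: eq_mulmx => u; rewrite mulmx1 mulmxA !mul_lin1 ?gaugeK //.
    exact: (gauge_lin oW Wa mg ss Wx).
  exact: (gauge_lin oW Wa mh (smooth_inN oW Wa ss) Wx).
by have [] := mulmx1_unit E.
Qed.

End GaugeInverse.

(** * Compatibility with chart changes, and conformal factors *)

Section Global.
Context {R : realType} {n : nat} {M : smoothManifold R n}.
Implicit Types (a b : chart_index M) (x : M) (U W : set M) (g h : tensor2 M).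

Lemma metric_in_sub a W W' g : W' `<=` W -> metric_in a W g -> metric_in a W' g.
Proof.
move=> WW [sg gT gU]; split=> [|x /WW|x /WW]; [exact: smooth_mx_sub sg|exact: gT|exact: gU].
Qed.

(** Retains from [is_metric] the transformation law, smoothness, symmetry and, as the consequence of
    the signature, nondegeneracy; all four persist under conformal change. *)
Definition pmetric U g : Prop :=
  (forall a b x, U x -> cdom a x -> cdom b x ->
     g a x = jac a b x *m g b x *m (jac a b x)^T) /\
  forall a, metric_in a (U `&` cdom a) g.

Lemma is_metric_pmetric p q U g : is_metric p q U g -> pmetric U g.
Proof.
move=> [gJ sg gT sig]; split=> // a; split=> // x [Ux ax]; first exact: gT.
have [_ [P _ PG]] := sig a x Ux ax.
have : \det (P *m g a x *m P^T) != 0.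
  rewrite PG det_diag; apply/prodf_neq0 => i _; rewrite mxE.
  by case: ifP; rewrite ?oppr_eq0 oner_neq0.
by rewrite !det_mulmx unitmxE unitfE !mulf_eq0 => /norP[/norP[]].
Qed.

Lemma pmetric_in U W a g : pmetric U g -> W `<=` U -> W `<=` cdom a -> metric_in a W g.
Proof. by move=> [_ mg] WU Wa; apply: metric_in_sub (mg a) => x Wx; split; [exact: WU|exact: Wa]. Qed.

Lemma smooth_fun_in U W a s : smooth_fun U s -> W `<=` U -> W `<=` cdom a -> smooth_in a W s.
Proof. by move=> ss WU Wa; apply: smooth_in_sub (ss a) => x Wx; split; [exact: WU|exact: Wa]. Qed.

Lemma openIcdom U a : open U -> open (U `&` cdom a).
Proof. by move=> oU; apply: openI => //; exact: cdom_open. Qed.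

Section ChartChange.
Variables (U : set M) (g : tensor2 M) (s : M -> R) (a b : chart_index M) (x : M).
Hypotheses (oU : open U) (mg : pmetric U g) (ss : smooth_fun U s).
Hypotheses (Ux : U x) (ax : cdom a x) (bx : cdom b x).

Let W : set M := (U `&` cdom a) `&` cdom b.
Let oW : open W. Proof. by apply: openIcdom; exact: openIcdom. Qed.
Let Wa : W `<=` cdom a. Proof. by move=> y [[]]. Qed.
Let Wb : W `<=` cdom b. Proof. by move=> y []. Qed.
Let WU : W `<=` U. Proof. by move=> y [[]]. Qed.
Let Wx : W x. Proof. by []. Qed.

Lemma dgrad_chart : dgrad b g s x = dgrad a g s x *m jac a b x.
Proof.
have ma := pmetric_in mg WU Wa; have mb := pmetric_in mg WU Wb.
have sa := smooth_fun_in ss WU Wa; have sb := smooth_fun_in ss WU Wb.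
have JU := jac_unit ax bx.
have Ed : drow a s x = drow b s x *m (jac a b x)^T.
  apply: trmx_inj; rewrite trmx_mul trmxK; apply: eq_mulmx => v.
  have /(congr1 (fun z => const_mx z : 'M[R]_1)) := dir_jac oW Wa Wb v Wx sb.
  rewrite (dir_drow oW Wb sb _ Wx) (dir_drow oW Wa sa _ Wx) mulmxA.
  by move=> /rowP/(_ 0); rewrite [LHS]mxE [RHS]mxE => E; apply/rowP => i; rewrite !ord1.
have [_ _ /(_ x Wx) GU] := mb.
apply: (can_inj (mulmxK GU)); rewrite (dgradG s mb Wx).
apply: (@can_inj _ _ (mulmx^~ (jac a b x)^T) (mulmx^~ (invmx (jac a b x)^T))).
  by move=> A; rewrite mulmxK // unitmx_tr.
rewrite -Ed -(dgradG s ma Wx) (mg.1 a b x) //.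
by rewrite !mulmxA.
Qed.

Lemma gauge_chart t : chart_change (jac a b x) (gauge_change g a s x t) =
  gauge_change g b s x (chart_change (jac a b x) t).
Proof.
have ma := pmetric_in mg WU Wa; have mb := pmetric_in mg WU Wb.
have sa := smooth_fun_in ss WU Wa; have sb := smooth_fun_in ss WU Wb.
rewrite (gaugeE oW Wa _ ma sa Wx) (gaugeE oW Wb _ mb sb Wx) (mg.1 a b x) //.
by rewrite gauge_pt_chart dgrad_chart.
Qed.

End ChartChange.

Lemma conf_pmetric U g h s : open U -> pmetric U g -> smooth_fun U s ->
  (forall a x, U x -> cdom a x -> h a x = expR (2 * s x) *: g a x) -> pmetric U h.
Proof.
move=> oU mg ss hg; split=> [a b x Ux ax bx|a].
  by rewrite !hg // (mg.1 a b x) // -scalemxAr -scalemxAl.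
have oW := openIcdom a oU; have Wa : U `&` cdom a `<=` cdom a by move=> x [].
apply: (conf_metric_in oW Wa (mg.2 a) (ss a)) => x [Ux ax].
exact: hg.
Qed.

Lemma conf_ratio U g0 g h : open U -> conf_class U g0 g -> conf_class U g0 h ->
  exists2 s, smooth_fun U s & forall a x, U x -> cdom a x -> h a x = expR (2 * s x) *: g a x.
Proof.
move=> oU [f [sf f0 fg]] [f' [sf' f0' fh]].
exists (fun x => 2^-1 * (ln (f' x) - ln (f x))) => [a|a x Ux ax].
  have oW := openIcdom a oU; have Wa : U `&` cdom a `<=` cdom a by move=> x [].
  apply: smooth_inM => //; first exact: smooth_in_cst.
  by apply: smooth_inB => //; apply: smooth_in_ln => // x [Ux _]; [exact: f0'|exact: f0].
rewrite fh // fg // mulrA mulfV ?pnatr_eq0 // mul1r expRD expRN !lnK ?posrE ?f0 ?f0' //.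
by rewrite scalerA divfK // gt_eqF // f0.
Qed.

Lemma conf_class_refl U g : conf_class U g g.
Proof.
exists (fun=> 1); split=> [a|//|a x _ _]; first exact: smooth_in_cst.
by rewrite scale1r.
Qed.

Lemma conf_uniq g h s1 s2 : (0 < n)%N -> pmetric setT g ->
  (forall a x, cdom a x -> h a x = expR (2 * s1 x) *: g a x) ->
  (forall a x, cdom a x -> h a x = expR (2 * s2 x) *: g a x) -> s1 = s2.
Proof.
move=> n0 mg h1 h2; apply/funext => x.
have [a ax] := atlas_cover x.
have : (expR (2 * s1 x) - expR (2 * s2 x)) *: g a x = 0 by rewrite scalerBl -h1 // -h2 // subrr.
have [_ _ /(_ x (conj I ax)) GU] := mg.2 a.
move/eqP; rewrite scaler_eq0 => /orP[|/eqP G0]; last first.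
  have := mulVmx GU; rewrite G0 mulmx0 => /matrixP/(_ (Ordinal n0) (Ordinal n0)).
  by rewrite !mxE eqxx => /esym/eqP; rewrite oner_eq0.
rewrite subr_eq0 => /eqP/expR_inj/mulfI; apply.
by rewrite pnatr_eq0.
Qed.

Lemma nabla_nc_eq g a W v (t t' : M -> 'rV[R]_(1 + n + 1)) x : open W -> W `<=` cdom a -> W x ->
  (forall y, W y -> t y = t' y) -> nabla_nc g a v t x = nabla_nc g a v t' x.
Proof.
move=> oW Wa Wx tt'; rewrite /nabla_nc !nablaE (tt' x Wx).
have -> : dir a v (tal \o t) x = dir a v (tal \o t') x.
  by apply: (dir_eq oW Wa v Wx) => y Wy /=; rewrite tt'.
have -> : dir a v (tbe \o t) x = dir a v (tbe \o t') x.
  by apply: (dir_eq oW Wa v Wx) => y Wy /=; rewrite tt'.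
have -> : mder a v (tvec \o t) x = mder a v (tvec \o t') x.
  by apply: (mder_eq oW Wa v Wx) => y Wy /=; rewrite tt'.
by rewrite /= tt'.
Qed.

End Global.

Lemma row_free_kernel (F : fieldType) m n (A : 'M[F]_(m, n)) :
  (forall u : 'rV_m, u *m A = 0 -> u = 0) -> row_free A.
Proof.
move=> A0; rewrite -kermx_eq0; apply/rowV0P => u /sub_kermxP; exact: A0.
Qed.

(** * From a parallel distribution to a parallel tractor subbundle *)

Section ParallelFromMetric.
Context {R : realType} {n : nat} {M : smoothManifold R n}.
Hypothesis n3 : (3 <= n)%N.
Variables (g L : tensor2 M) (r : nat).
Hypotheses (mg : pmetric setT g) (dL : tangent_distribution setT r L).
Hypothesis llL : forall a x, cdom a x -> lightlike (g a x) (L a x).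
Hypothesis ricL : forall a x, cdom a x -> (ricci_endo g a x <= L a x)%MS.
Hypothesis parL : forall a, parallel_in a setT (L a) (nabla g a).

Local Notation tr := 'rV[R]_(1 + n + 1).

Definition split_subspace a x : 'M[R]_(1 + n + 1) :=
  (L a x *m lin1_mx (fun Y => tractor 0 Y 0 : tr) + (tractor 0 0 1 : tr))%MS.

Local Notation H0 := split_subspace.

Lemma split_subspaceP a x (t : tr) :
  reflect (tal t = 0 /\ (tvec t <= L a x)%MS) (t <= H0 a x)%MS.
Proof.
apply: (iffP sub_addsmxP) => [[[u1 u2] ->]|[al0 /submxP[D YL]]] /=.
  rewrite mulmxA (mul_lin1 (@vec_tractor_lin R n)) [u2]mx11_scalar mul_scalar_mx.
  rewrite talD tvecD talZ tvecZ !talE !tvecE mulr0 addr0 scaler0 addr0; split=> //.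
  exact: submxMl.
exists (D, (tbe t)%:M) => /=; rewrite mulmxA (mul_lin1 (@vec_tractor_lin R n)) -YL mul_scalar_mx.
apply: tractor_ext; rewrite ?talD ?tvecD ?tbeD ?talZ ?tvecZ ?tbeZ !(talE, tvecE, tbeE) ?al0.
- by rewrite mulr0 addr0.
- by rewrite scaler0 addr0.
- by rewrite mulr1 add0r.
Qed.

Let gT a x : cdom a x -> (g a x)^T = g a x.
Proof. by move=> ax; have [_ /(_ x) + _] := mg.2 a; apply. Qed.
Let gU a x : cdom a x -> g a x \in unitmx.
Proof. by move=> ax; have [_ _ /(_ x)] := mg.2 a; apply. Qed.
Let mga a : metric_in a (cdom a) g.
Proof. by apply: metric_in_sub (mg.2 a) => x ax; split. Qed.

(** Being self-adjoint with image in the lightlike L, the Ricci endomorphism has trace zero and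
    kills L; the symmetry of the Ricci tensor transfers the latter to its second argument. *)
Lemma ricci_lightlike a x : cdom a x -> scal g a x = 0 /\
  forall v Y : 'rV[R]_n, (Y <= L a x)%MS -> bform (ricci g a x) v Y = 0.
Proof.
move=> ax; have rT := ricci_sym (cdom_open a) (@subset_refl _ _) (mga a) ax.
have EG : ricci_endo g a x *m g a x = ricci g a x by rewrite /ricci_endo mulmxKV // gU.
have [|LE tr0] := selfadjoint_lightlike (llL ax) (ricL ax) (gT ax) _ (gU ax).
  by rewrite EG.
split=> [|v Y YL]; first by rewrite /scal mxtrace_mulC.
rewrite (bformC _ _ rT) /bform -EG mulmxA LE //.
by rewrite !mul0mx mxE.
Qed.

Lemma split_subspace_parallel a : parallel_in a setT (H0 a) (nabla_nc g a).
Proof.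
move=> W t oW Wa st tH x v Wx.
have Wc : W `<=` cdom a by move=> y /Wa[].
have ax := Wc x Wx; have [sc0 ricY] := ricci_lightlike ax.
have YL y : W y -> (tvec (t y) <= L a y)%MS by move=> /tH/split_subspaceP[].
have KE : schouten g a x = - ((n%:R - 2)^-1 *: ricci g a x).
  by rewrite /schouten sc0 mul0r scale0r sub0r scalerN.
apply/split_subspaceP; rewrite /nabla_nc talE tvecE; split.
  rewrite (dir_eq oW Wc v Wx (g := fun=> 0)); last by move=> y /tH/split_subspaceP[].
  rewrite dir_cst add0r KE /bform mulmxN -scalemxAr mulNmx -scalemxAl.
  rewrite [LHS]mxE [X in - X]mxE -/(bform _ _ _) ricY ?mulr0 ?oppr0 //.
  exact: YL.
have /split_subspaceP[-> _] := tH x Wx.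
rewrite scale0r addr0; apply: addmx_sub.
  exact: (parL oW Wa (smooth_tvec st) YL).
rewrite eqmx_opp scalemx_sub // /sharp KE mulmxN mulNmx eqmx_opp -scalemxAr -scalemxAl.
rewrite scalemx_sub // -mulmxA.
exact: submx_trans (submxMl _ _) (ricL ax).
Qed.

Variables (c : set (tensor2 M)) (g0 : tensor2 M).
Hypotheses (cE : c = conf_class setT g0) (cg : c g).

(* 0 when h is not in the conformal class of g. *)
Definition conf_log h : M -> R := xget (fun=> 0)
  [set s | smooth_fun setT s /\ forall a x, cdom a x -> h a x = expR (2 * s x) *: g a x].

Lemma conf_logP h : c h -> smooth_fun setT (conf_log h) /\
  forall a x, cdom a x -> h a x = expR (2 * conf_log h x) *: g a x.
Proof.
rewrite cE => ch; have [|s ss hs] := conf_ratio openT _ ch (g := g); first by rewrite -cE.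
have /(@xgetPex _ (fun=> 0)) : exists s, smooth_fun setT s /\
    forall a x, cdom a x -> h a x = expR (2 * s x) *: g a x.
  by exists s; split=> // a x; exact: hs.
by [].
Qed.

Lemma conf_log_refl : conf_log g = fun=> 0.
Proof.
have [_ hg] := conf_logP cg.
apply: (conf_uniq (ltnW (ltnW n3)) mg hg) => a x ax.
by rewrite mulr0 expR0 scale1r.
Qed.

(** A tractor field has a value in the splitting of every metric h of the class: the subspace given
    in the splitting of g is carried there by the transition with factor [conf_log h]. *)
Definition gauged_subspace : tractor_field M :=
  fun h a x => H0 a x *m lin1_mx (gauge_change g a (conf_log h) x).

Local Notation H := gauged_subspace.

Let slog h a : c h -> smooth_in a (cdom a) (conf_log h).
Proof. by move=> /conf_logP[ss _]; exact: (smooth_fun_in ss). Qed.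

Lemma gauged_subspaceP h a x (t : tr) : c h -> cdom a x ->
  reflect (exists2 u : tr, (u <= H0 a x)%MS & t = gauge_change g a (conf_log h) x u)
    (t <= H h a x)%MS.
Proof.
move=> ch ax.
have lin := gauge_lin (cdom_open a) (@subset_refl _ _) (mga a) (slog a ch) ax.
apply: (iffP submxP) => [[D ->]|[u /submxP[D ->] ->]].
  by exists (D *m H0 a x); rewrite ?submxMl // mulmxA mul_lin1.
by exists D; rewrite mulmxA mul_lin1.
Qed.

Lemma gauged_subspace_refl a x : cdom a x -> (H g a x :=: H0 a x)%MS.
Proof.
move=> ax; apply/eqmxP/andP; split; apply/rV_subP => t.
  move=> /(gauged_subspaceP _ cg ax)[u uH ->].
  by rewrite conf_log_refl (gauge_id (cdom_open a) (@subset_refl _ _) (mga a)).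
move=> tH; apply/(gauged_subspaceP _ cg ax); exists t => //.
by rewrite conf_log_refl (gauge_id (cdom_open a) (@subset_refl _ _) (mga a)).
Qed.

Lemma split_subspace_chart a b x u : cdom a x -> cdom b x ->
  (u <= H0 a x)%MS -> (chart_change (jac a b x) u <= H0 b x)%MS.
Proof.
move=> ax bx /split_subspaceP[u0 uL]; apply/split_subspaceP; rewrite talE tvecE; split=> //.
by rewrite (dL.1 a b x I ax bx) submxMr.
Qed.

Lemma chart_changeK (a b : chart_index M) (x : M) u : cdom a x -> cdom b x ->
  chart_change (jac a b x) (chart_change (jac b a x) u) = u :> tr.
Proof.
move=> ax bx; apply: tractor_ext; rewrite !(talE, tvecE, tbeE) //.
by rewrite -mulmxA jac_mul // jac_id // mulmx1.
Qed.

Lemma gauged_subspaces : tractor_subspaces c H.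
Proof.
split=> [h a b x ch ax bx|h h' s ch ch' ss hs a x ax].
  have [sl hl] := conf_logP ch.
  have gc t := gauge_chart openT mg sl (I : setT x) ax bx t.
  have lC := @chart_change_lin R n (jac a b x).
  apply/eqmxP/andP; split; apply/rV_subP => t.
    move=> /(gauged_subspaceP _ ch bx)[u uH ->].
    rewrite -[u](chart_changeK u ax bx) -gc -(mul_lin1 lC) submxMr //.
    apply/(gauged_subspaceP _ ch ax); exists (chart_change (jac b a x) u) => //.
    exact: split_subspace_chart.
  move=> /submxP[D]; rewrite mulmxA (mul_lin1 lC) => ->.
  have /(gauged_subspaceP _ ch ax)[u uH ->] := submxMl D (H h a x).
  rewrite gc; apply/(gauged_subspaceP _ ch bx); exists (chart_change (jac a b x) u) => //.
  exact: split_subspace_chart.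
have [sl hl] := conf_logP ch; have [sl' hl'] := conf_logP ch'.
have oA := cdom_open a; have subA := @subset_refl _ (cdom a).
(* The conformal exponent is unique, so the chosen logarithms add up and the cocycle property of the
   transitions applies. *)
have E : conf_log h' = fun y => conf_log h y + s y.
  apply: (conf_uniq (ltnW (ltnW n3)) mg hl') => b y bY.
  by rewrite hs // hl // scalerA -expRD; congr (expR _ *: _); ring.
have sa : smooth_in a (cdom a) s by exact: (smooth_fun_in ss).
have gc t := gauge_comp oA subA (mga a) (slog a ch) sa (fun y => hl a y) t ax.
have mh := conf_metric_in oA subA (mga a) (slog a ch) (fun y => hl a y).
have lh := gauge_lin oA subA mh sa ax.
apply/eqmxP/andP; split; apply/rV_subP => t.
  move=> /(gauged_subspaceP _ ch' ax)[u uH ->].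
  rewrite E -gc -(mul_lin1 lh) submxMr //.
  by apply/(gauged_subspaceP _ ch ax); exists u.
move=> /submxP[D]; rewrite mulmxA (mul_lin1 lh) => ->.
have /(gauged_subspaceP _ ch ax)[u uH ->] := submxMl D (H h a x).
by rewrite gc -E; apply/(gauged_subspaceP _ ch' ax); exists u.
Qed.

Lemma gauged_lightlike : tractor_lightlike c H.
Proof.
move=> h a x ch ax t1 t2 /(gauged_subspaceP _ ch ax)[u1 /split_subspaceP[a1 l1] ->].
move=> /(gauged_subspaceP _ ch ax)[u2 /split_subspaceP[a2 l2] ->].
have [_ hl] := conf_logP ch.
rewrite (gauge_iso (cdom_open a) (@subset_refl _ _) (mga a) (slog a ch) (fun y => hl a y)) //.
by rewrite /tform a1 a2 !mul0r !add0r llL.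
Qed.

(** A section is carried back to the splitting of g, where parallelity is [split_subspace_parallel],
    and [gauge_covariant] carries its derivative forward again. *)
Lemma gauged_parallel : tractor_parallel c H.
Proof.
move=> h a ch W t oW Wa st tH x v Wx.
have Wc : W `<=` cdom a by move=> y /Wa[].
have [_ hl] := conf_logP ch.
have mgW : metric_in a W g by exact: (pmetric_in mg).
have slW : smooth_in a W (conf_log h) by exact: smooth_in_sub (slog a ch).
have hlW y : W y -> h a y = expR (2 * conf_log h y) *: g a y by move=> /Wc; exact: hl.
have mhW := conf_metric_in oW Wc mgW slW hlW.
pose u y := gauge_change h a (fun y => - conf_log h y) y (t y).
have su : smooth_mx a W u by exact: (smooth_gauge oW Wc mhW (smooth_inN oW Wc slW) st).
have uP y : W y -> (u y <= H0 a y)%MS /\ t y = gauge_change g a (conf_log h) y (u y).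
  move=> Wy; have /(gauged_subspaceP _ ch (Wc _ Wy))[w wH E] := tH y Wy.
  by rewrite /u E (gaugeK oW Wc mgW slW hlW).
rewrite (nabla_nc_eq _ _ oW Wc Wx (fun y Wy => (uP y Wy).2)).
rewrite (gauge_covariant oW Wc mgW slW hlW n3 su v Wx).
apply/(gauged_subspaceP _ ch (Wc _ Wx)); eexists; last by [].
by apply: (split_subspace_parallel oW Wa su) => // y /uP[].
Qed.

Lemma gauged_subbundle : tractor_subbundle c r.+1 H.
Proof.
split=> [|h a ch x [_ ax]]; first exact: gauged_subspaces.
have [W [F [oW Wx Wa sF FL]]] := dL.2 a x (conj I ax).
have Wc : W `<=` cdom a by move=> y /Wa[].
have [_ hl] := conf_logP ch.
have mgW : metric_in a W g by exact: (pmetric_in mg).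
have slW : smooth_in a W (conf_log h) by exact: smooth_in_sub (slog a ch).
have hlW y : W y -> h a y = expR (2 * conf_log h y) *: g a y by move=> /Wc; exact: hl.
rewrite -addn1.
(* A frame of L together with (0, 0, 1) is a frame in the splitting of g; [F2] is its transport to
   the splitting of h, row by row. *)
pose F1 y := col_mx (F y *m lin1_mx (fun Y => tractor 0 Y 0 : tr)) (tractor 0 0 1 : tr).
pose F2 y := \matrix_i gauge_change g a (conf_log h) y (row i (F1 y)).
have sF1 : smooth_mx a W F1.
  have sc := smooth_mxM oW Wc sF (smooth_mx_cst a W (lin1_mx (fun Y => tractor 0 Y 0 : tr))).
  move=> i j; rewrite /F1 -(splitK i); case: (fintype.split i) => k /=.
    by apply: eq_smooth_in (sc k j) => // y _; rewrite col_mxEu.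
  apply: eq_smooth_in (smooth_in_cst a W ((tractor 0 0 1 : tr) k j)) => // y _.
  by rewrite col_mxEd.
have F2E y : W y -> F2 y = F1 y *m lin1_mx (gauge_change g a (conf_log h) y).
  move=> Wy; apply/row_matrixP => i; rewrite rowK row_mul mul_lin1 //.
  exact: (gauge_lin oW Wc mgW slW Wy).
exists W, F2; split=> // [i j|y Wy].
  have sr : smooth_mx a W (fun y => row i (F1 y)).
    by move=> k l; apply: eq_smooth_in (sF1 i l) => // y _; rewrite [RHS]mxE.
  apply: eq_smooth_in (smooth_gauge oW Wc mgW slW sr 0 j) => // y _.
  by rewrite [RHS]mxE.
have [Ff FE] := FL y Wy.
have gu := gauge_unit oW Wc mgW slW hlW Wy.
have fF1 : row_free (F1 y).
  apply: row_free_kernel => u; rewrite -(hsubmxK u) mul_row_col mulmxA.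
  rewrite (mul_lin1 (@vec_tractor_lin R n)) [rsubmx u]mx11_scalar mul_scalar_mx => E.
  have := congr1 tvec E; have := congr1 tbe E.
  rewrite tbeD tvecD tbeZ tvecZ !tbeE !tvecE mulr1 add0r scaler0 addr0.
  rewrite [tbe 0](_ : _ = 0); last by rewrite /tbe !mxE.
  rewrite [tvec 0](_ : _ = 0); last by apply/rowP => i; rewrite /tvec !mxE.
  move=> e1 e2; have /(row_free_inj Ff) -> : lsubmx u *m F y = 0 *m F y by rewrite e2 mul0mx.
  by rewrite (_ : (rsubmx u 0 0)%:M = 0) ?row_mx0 // e1 raddf0.
rewrite F2E //; split; first by rewrite /row_free mxrankMfree ?row_free_unit //.
apply: eqmxMr; apply: eqmx_trans (eqmx_sym (addsmxE _ _)) _.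
by apply: adds_eqmx => //; exact: eqmxMr.
Qed.

End ParallelFromMetric.

(** * From a parallel tractor subbundle to a parallel distribution *)

Transparent dir.

Lemma dmat_mder (R : realType) n (M : smoothManifold R n) (a : chart_index M) (W : set M) m k
    (F : M -> 'M[R]_(m, k)) y v : open W -> W `<=` cdom a -> smooth_mx a W F -> W y ->
  dmat (F \o cparam a) (ccoo a y) v = mder a v F y.
Proof.
by move=> oW Wa sF Wy; apply/matrixP => i j; rewrite !mxE (dirE oW Wa v Wy (sF i j)).
Qed.

Lemma dir_comp_coo (R : realType) n (M : smoothManifold R n) (a : chart_index M) (D : set 'rV[R]_n)
    (f : 'rV[R]_n -> R) y v : open D -> D (ccoo a y) ->
  (forall u, D u -> ccoo a (cparam a u) = u) -> dir a v (f \o ccoo a) y = 'D_v f (ccoo a y).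
Proof.
move=> oD Dy DK; apply: near_eq_derive; apply: (open_near oD Dy) => u Du /=.
by rewrite DK.
Qed.

Opaque dir.

Section ParallelTractors.
Context {R : realType} {n : nat} {M : smoothManifold R n}.
Hypothesis n3 : (3 <= n)%N.
Variables (c : set (tensor2 M)) (g0 : tensor2 M) (r : nat) (H : tractor_field M).
Hypotheses (cE : c = conf_class setT g0) (mg0 : pmetric setT g0).
Hypotheses (subH : tractor_subbundle c r.+1 H) (llH : tractor_lightlike c H).
Hypothesis parH : tractor_parallel c H.

Implicit Types (a b : chart_index M) (x y : M) (h : tensor2 M).
Local Notation tr := 'rV[R]_(1 + n + 1).

Lemma class_ratio g h : c g -> c h ->
  exists2 s, smooth_fun setT s & forall a x, cdom a x -> h a x = expR (2 * s x) *: g a x.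
Proof.
rewrite cE => cg ch; have [s ss hs] := conf_ratio openT cg ch.
by exists s => // a x; exact: hs.
Qed.

Lemma class_pmetric h : c h -> pmetric setT h.
Proof.
move=> ch; have [|s ss hs] := class_ratio _ ch (g := g0).
  by rewrite cE; exact: conf_class_refl.
by apply: (conf_pmetric openT mg0 ss) => a x _; exact: hs.
Qed.

(* The points where H is not contained in the orthogonal complement of I_-. *)
Definition beta_locus : set M := [set x | exists h a (t : tr),
  [/\ c h, cdom a x, (t <= H h a x)%MS & tbe t != 0]].

Lemma subspace_chart h a b x (t : tr) : c h -> cdom a x -> cdom b x ->
  (t <= H h a x)%MS -> (chart_change (jac a b x) t <= H h b x)%MS.
Proof.
move=> ch ax bx tH; rewrite (subH.1.1 h a b x ch ax bx).
by rewrite -(mul_lin1 (@chart_change_lin R n _)) submxMr.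
Qed.

(** A gauge change multiplies the third component by a positive factor and a chart change leaves it
    alone, so the locus is visible in every splitting and every chart. *)
Lemma beta_locusP x h a : beta_locus x -> c h -> cdom a x ->
  exists2 t : tr, (t <= H h a x)%MS & tbe t != 0.
Proof.
move=> [h' [b [t [ch' bx tH t0]]]] ch ax.
have [s ss hs] := class_ratio ch' ch.
exists (chart_change (jac b a x) (gauge_change h' b s x t)); last first.
  by rewrite !tbeE mulf_neq0 // gt_eqF // expR_gt0.
apply: subspace_chart => //; rewrite (subH.1.2 h' h s ch' ch ss hs b x bx).
have mh' : metric_in b (cdom b) h' by exact: (pmetric_in (class_pmetric ch')).
have sb : smooth_in b (cdom b) s by exact: (smooth_fun_in ss).
by rewrite -(mul_lin1 (gauge_lin (cdom_open b) (@subset_refl _ _) mh' sb bx)) submxMr.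
Qed.

Lemma smooth_in_ne a (W : set M) f x : open W -> W `<=` cdom a -> smooth_in a W f -> W x ->
  f x != 0 -> exists W' : set M, [/\ open W', W' x, W' `<=` W & forall y, W' y -> f y != 0].
Proof.
move=> oW Wa sf Wx fx.
have oV := img_open_sub oW Wa.
pose D : set 'rV[R]_n := (ccoo a @` W) `&` [set u | f (cparam a u) != 0].
have oD : open D.
  rewrite openE => u [Vu /= fu]; apply: filterI; first exact: open_nbhs_nbhs.
  have [cf _] := sf 0%N; have := cf u Vu.
  rewrite -[[set _ | _]]/((f \o cparam a) @^-1` [set z : R | z != 0]).
  apply; apply: open_nbhs_nbhs; split; last by [].
  exact: open_neq.
exists (cdom a `&` ccoo a @^-1` D); split=> [||y [ay [Vy _]]|y [ay [_ /=]]].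
- exact: preimage_open.
- split; first exact: Wa.
  by split; [exact: img_coo|rewrite /= paramK //; exact: Wa].
- by have := (img_param Wa Vy).1; rewrite paramK.
- by rewrite paramK.
Qed.

Lemma frame_at h a x : c h -> cdom a x -> exists (W : set M) (F : M -> 'M[R]_(r.+1, 1 + n + 1)),
  [/\ open W, W x, W `<=` cdom a, smooth_mx a W F &
      forall y, W y -> row_free (F y) /\ (F y :=: H h a y)%MS].
Proof.
move=> ch ax; have [W [F [oW Wx Wa sF FH]]] := subH.2 h a ch x (conj I ax).
by exists W, F; split=> // y /Wa[].
Qed.

Lemma smooth_row a (W : set M) m k (F : M -> 'M[R]_(m, k)) i : open W -> W `<=` cdom a ->
  smooth_mx a W F -> smooth_mx a W (fun y => row i (F y)).
Proof.
by move=> oW Wa sF i' j; apply: (eq_smooth_in oW Wa _ (sF i j)) => y _; rewrite [RHS]mxE.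
Qed.

Lemma tbe_row m (F : 'M[R]_(m, 1 + n + 1)) u : tbe (u *m F) != 0 -> exists i, tbe (row i F) != 0.
Proof.
move=> uF; apply/existsP; apply: contraNT uF; rewrite negb_exists => /forallP F0.
have -> : tbe (u *m F) = \sum_i u 0 i * tbe (row i F).
  by rewrite /tbe !mxE; apply: eq_bigr => i _; rewrite !mxE.
by rewrite big1 // => i _; have := F0 i; rewrite negbK => /eqP ->; rewrite mulr0.
Qed.

Lemma beta_pivot h a x : beta_locus x -> c h -> cdom a x ->
  exists (W : set M) (F : M -> 'M[R]_(r.+1, 1 + n + 1)) i,
  [/\ open W, W x, W `<=` cdom a, smooth_mx a W F &
      forall y, W y -> [/\ row_free (F y), (F y :=: H h a y)%MS & tbe (row i (F y)) != 0]].
Proof.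
move=> bx ch ax; have [t tH t0] := beta_locusP bx ch ax.
have [W [F [oW Wx Wa sF FH]]] := frame_at ch ax.
have [D E] : exists D, t = D *m F x by apply/submxP; rewrite (FH x Wx).2.
have [i Fi] : exists i, tbe (row i (F x)) != 0 by apply: (@tbe_row _ _ D); rewrite -E.
have sFi : smooth_in a W (fun y => tbe (row i (F y))).
  exact: (smooth_tbe (smooth_row i oW Wa sF)).
have [W' [oW' W'x W'W W'0]] := smooth_in_ne oW Wa sFi Wx Fi.
exists W', F, i; split=> // [y /W'W/Wa//||y W'y]; first exact: smooth_mx_sub sF.
by have [] := FH y (W'W y W'y); split=> //; exact: W'0.
Qed.

Lemma beta_locus_open : open beta_locus.
Proof.
rewrite openE => x bx.
have [a ax] := atlas_cover x.
have cg0 : c g0 by rewrite cE; exact: conf_class_refl.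
have [W [F [i [oW Wx Wa sF FH]]]] := beta_pivot bx cg0 ax.
have : nbhs x W by apply: open_nbhs_nbhs.
apply: filterS => y Wy; have [_ E Fi] := FH y Wy.
by exists g0, a, (row i (F y)); split=> //; [exact: Wa|rewrite -E row_sub].
Qed.

Lemma beta_locus_dense : dense beta_locus.
Proof.
have cg0 : c g0 by rewrite cE; exact: conf_class_refl.
move=> O [x Ox] oO; apply: contrapT => nO.
have b0 y : O y -> ~ beta_locus y by move=> Oy By; apply: nO; exists y.
have [a ax] := atlas_cover x.
have [W1 [F [oW1 W1x W1a sF1 FH]]] := frame_at cg0 ax.
pose W := W1 `&` O.
have oW : open W by exact: openI.
have Wx : W x by [].
have Wa : W `<=` cdom a by move=> y [/W1a].
have sF : smooth_mx a W F by apply: smooth_mx_sub sF1 => y [].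
have mgW : metric_in a W g0 by exact: (pmetric_in mg0).
have be0 y (t : tr) : W y -> (t <= H g0 a y)%MS -> tbe t = 0.
  move=> [W1y Oy] tH; apply/eqP/negPn/negP => t0.
  by apply: (b0 y Oy); exists g0, a, t; split=> //; exact: W1a.
have Ws : W `<=` setT `&` cdom a by move=> y Wy; split=> //; exact: Wa.
have par t v y : smooth_mx a W t -> (forall y, W y -> (t y <= H g0 a y)%MS) -> W y ->
    (nabla_nc g0 a v t y <= H g0 a y)%MS.
  by move=> st tH Wy; exact: (parH cg0 oW Ws st tH).
have sec (D : 'rV_r.+1) : smooth_mx a W (fun y => D *m F y).
  exact: (smooth_mxM oW Wa (smooth_mx_cst a W D) sF).
have secH (D : 'rV_r.+1) y : W y -> (D *m F y <= H g0 a y)%MS.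
  by move=> [W1y _]; rewrite -(FH y W1y).2 submxMl.
(* For a section with vanishing third component, the third component of its derivative along X is -
   g(X, Y). It vanishes for every coordinate direction X, hence Y = 0. *)
have tv D y : W y -> tvec (D *m F y) = 0.
  move=> Wy; have [_ _ /(_ y Wy) GU] := mgW; have [_ /(_ y Wy) GT _] := mgW.
  apply: (can_inj (mulmxK GU)); rewrite mul0mx; apply/rowP => i; rewrite [RHS]mxE.
  have := be0 y _ Wy (par _ (basis_vec i) y (sec D) (secH D) Wy).
  rewrite /nabla_nc tbeE (dir_eq oW Wa _ Wy (g := fun=> 0)); last first.
    by move=> z Wz; apply: be0 (secH D z Wz).
  rewrite dir_cst sub0r => /eqP; rewrite oppr_eq0 (bformC _ _ GT) => /eqP.
  by rewrite /bform trmx_delta -colE mxE.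
have tvH y t : W y -> (t <= H g0 a y)%MS -> tvec t = 0.
  by move=> Wy; have [W1y _] := Wy; rewrite -(FH y W1y).2 => /submxP[D ->]; exact: tv.
pose D : 'rV[R]_r.+1 := delta_mx 0 0.
pose i0 : 'I_n := Ordinal (leq_trans (isT : (0 < 3)%N) n3).
(* With Y = 0 and beta = 0 the vector component of the derivative along the first basis vector is
   alpha times that vector, so alpha = 0. The first row of the frame would then vanish, although the
   frame is row free. *)
have := tvH x _ Wx (par _ (basis_vec i0) x (sec D) (secH D) Wx).
have be0x : tbe (D *m F x) = 0 by exact: be0 (secH D x Wx).
rewrite /nabla_nc tvecE nablaE /= (tv D x Wx) be0x mul0mx scale0r subr0 addr0.
rewrite (mder_eq oW Wa _ Wx (G := fun=> 0)); last by move=> z; exact: tv.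
rewrite mder_cst add0r => /rowP/(_ i0); rewrite !mxE eqxx mulr1 => al0.
have : D *m F x = 0 *m F x.
  rewrite mul0mx -[LHS]tractorK (tv D x Wx) be0x al0.
  by rewrite /tractor !raddf0 row_mx0 row_mx0.
have [W1x' _] := Wx; move/(row_free_inj (FH x W1x').1)/rowP/(_ 0).
by rewrite !mxE !eqxx => /eqP; rewrite oner_eq0.
Qed.

(** One elimination step on a local frame: the pivot row is normalised to third component 1 and its
    multiples are subtracted from the other r rows, which then span the part of H orthogonal to
    I_-. *)
Lemma beta_frame h a x : beta_locus x -> c h -> cdom a x ->
  exists (W : set M) (t : M -> tr) (B : M -> 'M[R]_(r, 1 + n + 1)),
  [/\ [/\ open W, W x, W `<=` cdom a & W `<=` beta_locus],
      smooth_mx a W t, smooth_mx a W B,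
      forall y, W y -> (t y <= H h a y)%MS /\ tbe (t y) = 1 &
      forall y, W y -> [/\ (B y <= H h a y)%MS, row_free (B y), forall u, tbe (u *m B y) = 0 &
        forall t', (t' <= H h a y)%MS -> tbe t' = 0 -> (t' <= B y)%MS]].
Proof.
move=> bx ch ax; have [W [F [i [oW Wx Wa sF FH]]]] := beta_pivot bx ch ax.
pose b j y := tbe (row j (F y)).
pose t y : tr := (b i y)^-1 *: row i (F y).
pose B y := \matrix_j (row (lift i j) (F y) - b (lift i j) y *: t y).
have sb j : smooth_in a W (b j) by exact: (smooth_tbe (smooth_row j oW Wa sF)).
have st : smooth_mx a W t.
  apply: (smooth_mx_scale oW Wa); last exact: smooth_row.
  by apply: (smooth_inV oW Wa) => // y /FH[].
exists W, t, B; split=> //.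
- split=> // y Wy; have [_ E Fi] := FH y Wy.
  by exists h, a, (row i (F y)); split=> //; [exact: Wa|rewrite -E row_sub].
- move=> j l.
  have sr : smooth_mx a W (fun y => row (lift i j) (F y) - b (lift i j) y *: t y).
    apply: (smooth_mxD oW Wa); first exact: smooth_row.
    by apply: (smooth_mxN oW Wa); apply: (smooth_mx_scale oW Wa).
  by apply: (eq_smooth_in oW Wa _ (sr 0 l)) => y _; rewrite [RHS]mxE.
- move=> y Wy; have [_ E Fi] := FH y Wy; split; first by rewrite scalemx_sub // -E row_sub.
  by rewrite tbeZ mulVf.
move=> y Wy; have [Ff E Fi] := FH y Wy.
have tb : tbe (t y) = 1 by rewrite tbeZ mulVf.
have tF : (t y <= F y)%MS by rewrite scalemx_sub // row_sub.
have BF : (B y <= F y)%MS.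
  apply/row_subP => j; rewrite rowK; apply: addmx_sub; first exact: row_sub.
  by rewrite eqmx_opp scalemx_sub.
have uB u : tbe (u *m B y) = 0.
  apply/eqP/negPn/negP => /tbe_row[j]; rewrite rowK tbeD -scaleNr tbeZ tb mulr1.
  by rewrite -[tbe (row _ _)]/(b (lift i j) y) subrr eqxx.
have FBt : (F y <= B y + t y)%MS.
  apply/row_subP => j; case: (unliftP i j) => [k ->|->].
    rewrite -[row _ _](subrK (b (lift i k) y *: t y)); apply: addmx_sub_adds.
      by rewrite -(rowK (fun k => row (lift i k) (F y) - b (lift i k) y *: t y)) row_sub.
    by rewrite scalemx_sub.
  apply: submx_trans (addsmxSr _ _).
  by rewrite /t -[X in (X <= _)%MS](scalerKV Fi) scalemx_sub.
split=> //; first by rewrite -E.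
  have := mxrankS FBt; rewrite (eqP Ff) => le1.
  have le2 := leq_trans le1 (mxrank_adds_leqif (B y) (t y)).1.
  have le3 : (\rank (B y) + \rank (t y) <= \rank (B y) + 1)%N by rewrite leq_add2l rank_leq_row.
  have := leq_trans le2 le3; rewrite addn1 ltnS => le4.
  by rewrite /row_free eqn_leq rank_leq_row.
move=> t' tH t0; have : (t' <= B y + t y)%MS by apply: submx_trans FBt; rewrite E.
case/sub_addsmxP => [[u1 u2]] /= Et.
move: t0; rewrite Et [u2]mx11_scalar mul_scalar_mx tbeD uB tbeZ tb mulr1 add0r => ->.
by rewrite scale0r addr0 submxMl.
Qed.

Lemma pr_TMP h a x (v : 'rV[R]_n) :
  reflect (exists t : tr, [/\ (t <= H h a x)%MS, tbe t = 0 & tvec t = v]) (v <= pr_TM H h a x)%MS.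
Proof.
rewrite genmxE; apply: (iffP submxP) => [[D ->]|[t [tH t0 <-]]].
  exists (D *m (H h a x :&: I_minus_perp (h a x))%MS); rewrite mulmxA (mul_lin1 (@tvec_lin R n)).
  have := submxMl D (H h a x :&: I_minus_perp (h a x))%MS.
  by rewrite sub_capmx => /andP[-> /I_minus_perpP].
have : (t <= H h a x :&: I_minus_perp (h a x))%MS by rewrite sub_capmx tH; apply/I_minus_perpP.
by case/submxP => D E; exists D; rewrite mulmxA -E (mul_lin1 (@tvec_lin R n)).
Qed.

Lemma pr_TM_lightlike h a x : c h -> cdom a x -> lightlike (h a x) (pr_TM H h a x).
Proof.
move=> ch ax v w /pr_TMP[t [tH t0 <-]] /pr_TMP[t' [tH' t0' <-]].
by have := llH ch ax tH tH'; rewrite /tform t0 t0' !mulr0 !add0r.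
Qed.

Lemma pr_TM_chart h a b x (v : 'rV[R]_n) : c h -> cdom a x -> cdom b x ->
  (v <= pr_TM H h a x)%MS -> (v *m jac a b x <= pr_TM H h b x)%MS.
Proof.
move=> ch ax bx /pr_TMP[t [tH t0 <-]]; apply/pr_TMP.
exists (chart_change (jac a b x) t); rewrite tbeE tvecE; split=> //.
exact: subspace_chart.
Qed.

Definition tvec_mx m (B : 'M[R]_(m, 1 + n + 1)) : 'M[R]_(m, n) := rsubmx (lsubmx B).

Lemma mul_tvec_mx m k (u : 'M[R]_(k, m)) (B : 'M[R]_(m, 1 + n + 1)) :
  u *m tvec_mx B = tvec_mx (u *m B).
Proof.
rewrite /tvec_mx -{2}(hsubmxK B) mul_mx_row row_mxKl.
by rewrite -{2}(hsubmxK (lsubmx B)) mul_mx_row row_mxKr.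
Qed.

(** The projection to TM is injective on the span of B: an element (alpha, 0, 0) of H pairs to alpha
    with t, and this pairing vanishes because H is lightlike. Hence L has rank r. *)
Lemma beta_frame_vec h a x : beta_locus x -> c h -> cdom a x ->
  exists (W : set M) (t : M -> tr) (B : M -> 'M[R]_(r, 1 + n + 1)),
  [/\ [/\ open W, W x, W `<=` cdom a & W `<=` beta_locus],
      smooth_mx a W t, smooth_mx a W B,
      forall y, W y -> (t y <= H h a y)%MS /\ tbe (t y) = 1 &
      forall y, W y -> [/\ (B y <= H h a y)%MS, forall u, tbe (u *m B y) = 0,
        row_free (tvec_mx (B y)) & (tvec_mx (B y) :=: pr_TM H h a y)%MS]].
Proof.
move=> bx ch ax; have [W [t [B [WW st sB tH BH]]]] := beta_frame bx ch ax.
exists W, t, B; split=> // y Wy; have [BHy Bf B0 BS] := BH y Wy; split=> //.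
  apply: row_free_kernel => u; rewrite mul_tvec_mx => uB.
  have tu : tvec (u *m B y) = 0 := uB.
  have Wa : cdom a y by case: WW => _ _ + _; apply.
  have [ty t1] := tH y Wy.
  have := llH ch Wa (submx_trans (submxMl u _) BHy) ty.
  rewrite /tform t1 B0 mulr1 mulr0 addr0 tu /bform !mul0mx mxE addr0 => al0.
  apply: (row_free_inj Bf); rewrite mul0mx -[LHS]tractorK tu B0 al0.
  by rewrite /tractor !raddf0 row_mx0 row_mx0.
apply/eqmxP/andP; split; apply/rV_subP => v.
  case/submxP => D ->; apply/pr_TMP; exists (D *m B y); split=> //.
    exact: submx_trans (submxMl D _) BHy.
  by rewrite mul_tvec_mx.
case/pr_TMP => t' [tH' t0 <-]; have /submxP[D E] := BS t' tH' t0.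
by rewrite -[tvec t']/(tvec_mx t') E -mul_tvec_mx submxMl.
Qed.

Lemma smooth_tvec_mx a (W : set M) m (B : M -> 'M[R]_(m, 1 + n + 1)) :
  smooth_mx a W B -> smooth_mx a W (fun y => tvec_mx (B y)).
Proof. by move=> sB; exact: (smooth_mx_rsub (smooth_mx_lsub sB)). Qed.

Lemma pr_TM_distribution h : c h -> tangent_distribution beta_locus r (pr_TM H h).
Proof.
move=> ch; split=> [a b x _ ax bx|a x [bx ax]].
  apply/eqmxP/andP; split; apply/rV_subP => v.
    move=> vL; have := pr_TM_chart ch bx ax vL => vL'.
    rewrite -[v]mulmx1 -(jac_id bx) -(jac_mul bx ax bx) mulmxA.
    exact: submxMr.
  by case/submxP => D ->; rewrite mulmxA; apply: pr_TM_chart => //; exact: submxMl.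
have [W [t [B [[oW Wx Wa Wb] st sB tH BH]]]] := beta_frame_vec bx ch ax.
exists W, (fun y => tvec_mx (B y)); split=> //.
- by move=> y Wy; split; [exact: Wb|exact: Wa].
- exact: smooth_tvec_mx.
by move=> y /BH[].
Qed.

Lemma smooth_in_unitmx a (W : set M) m (S : M -> 'M[R]_m) x : open W -> W `<=` cdom a ->
  smooth_mx a W S -> W x -> S x \in unitmx ->
  exists W' : set M, [/\ open W', W' x, W' `<=` W & forall y, W' y -> S y \in unitmx].
Proof.
move=> oW Wa sS Wx Sx.
have sd : smooth_in a W (fun y => \det (S y)) by exact: (smooth_det (img_open_sub oW Wa) sS).
have [|W' [oW' W'x W'W W'0]] := smooth_in_ne oW Wa sd Wx; first by rewrite -unitfE -unitmxE.
by exists W'; split=> // y /W'0; rewrite unitmxE unitfE.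
Qed.

Lemma pairing_nabla a (W : set M) g (Z : M -> 'rV[R]_n) X w y : open W -> W `<=` cdom a ->
  metric_in a W g -> smooth_mx a W Z -> W y ->
  w *m mder a X (fun z => g a z *m (Z z)^T) y =
  w *m conn a g X y *m g a y *m (Z y)^T + w *m g a y *m (nabla g a X Z y)^T :> 'M[R]_1.
Proof.
move=> oW Wa mg sZ Wy; have sg : smooth_mx a W (g a) by case: mg.
rewrite (mderM oW Wa Wy X sg (smooth_mx_tr sZ)) (mder_tr oW Wa Wy X sZ).
rewrite (conn_metric oW Wa mg X Wy) nablaE [(_ + _)^T]raddfD /= trmx_mul.
by rewrite !(mulmxDr, mulmxDl) !mulmxA -!addrA; congr (_ + _); rewrite addrC.
Qed.

(** D and E play the derivatives of a projection in two directions. Their difference lies in the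
    complement, the row space of P2, and by the closedness condition on Q also in the kernel of Q;
    these two subspaces meet only in 0. *)
Lemma projection_derivative_eq (P D E : 'M[R]_n) (DQ EQ Q Q0 : 'M[R]_(n, r)) (P2 : 'M[R]_(r, n))
    (v w : 'rV[R]_n) :
  D = D *m Q0 *m P2 -> E = E *m Q0 *m P2 -> D *m Q = - (P *m DQ) -> E *m Q = - (P *m EQ) ->
  w *m P = w -> v *m P = v -> w *m DQ = v *m EQ -> P2 *m Q \in unitmx -> w *m D = v *m E.
Proof.
move=> D0 E0 DQE EQE wP vP wv U; apply/eqP; rewrite -subr_eq0; apply/eqP.
have ZE : w *m D - v *m E = (w *m D - v *m E) *m Q0 *m P2.
  by rewrite {1}D0 {1}E0 !mulmxBl !mulmxA.
have ZQ : (w *m D - v *m E) *m Q = 0.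
  rewrite mulmxBl -!mulmxA DQE EQE !mulmxN !mulmxA wP vP wv.
  by rewrite subrr.
move: (w *m D - v *m E) ZE ZQ => Z ZE ZQ.
suff ZQ0 : Z *m Q0 = 0 by rewrite ZE ZQ0 mul0mx.
apply: (can_inj (mulmxK U)); rewrite mul0mx mulmxA.
by rewrite -ZE ZQ.
Qed.

(** * Involutivity of L^perp and a potential along it; [X *m Q y = 0] says that X lies in L^perp *)

Section LocalFrame.
Variables (g : tensor2 M) (a : chart_index M) (W : set M).
Variables (t : M -> tr) (B : M -> 'M[R]_(r, 1 + n + 1)).
Hypotheses (cg : c g) (oW : open W) (Wa : W `<=` cdom a).
Hypotheses (st : smooth_mx a W t) (sB : smooth_mx a W B).
Hypothesis tH : forall y, W y -> (t y <= H g a y)%MS /\ tbe (t y) = 1.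
Hypothesis BH : forall y, W y -> [/\ (B y <= H g a y)%MS, forall u, tbe (u *m B y) = 0,
  row_free (tvec_mx (B y)) & (tvec_mx (B y) :=: pr_TM H g a y)%MS].

Local Notation Y := (fun y => tvec (t y)).
Local Notation Ym := (fun y => tvec_mx (B y)).
Local Notation Q := (fun y => g a y *m (tvec_mx (B y))^T).

Let mg : metric_in a W g. Proof. by exact: (pmetric_in (class_pmetric cg)). Qed.
Let sg : smooth_mx a W (g a). Proof. by case: mg. Qed.
Let gT y : W y -> (g a y)^T = g a y. Proof. by case: mg => _ + _; exact. Qed.
Let gU y : W y -> g a y \in unitmx. Proof. by case: mg => _ _; exact. Qed.
Let sY : smooth_mx a W Y. Proof. exact: (smooth_tvec st). Qed.
Let sYm : smooth_mx a W Ym. Proof. exact: smooth_tvec_mx. Qed.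
Let Ws : W `<=` setT `&` cdom a. Proof. by move=> y Wy; split=> //; exact: Wa. Qed.

Lemma frame_perp y (X Z : 'rV[R]_n) : W y -> X *m Q y = 0 -> (Z <= pr_TM H g a y)%MS ->
  X *m g a y *m Z^T = 0.
Proof.
move=> Wy XQ; have [_ _ _ <-] := BH Wy => /submxP[D ->].
by rewrite trmx_mul mulmxA -[X *m _ *m _]mulmxA XQ mul0mx.
Qed.

(** For X orthogonal to L the third component of the derivative of a section (alpha, Z, 0) of H is -
    g(X, Z) = 0. The derivative therefore still lies in I_-^perp, and its vector component lies in
    L. *)
Lemma nabla_frame y (X : 'rV[R]_n) (D : 'rV[R]_r) : W y -> X *m Q y = 0 ->
  ((nabla g a X (fun z => D *m Ym z) y + tal (D *m B y) *: X)%R <= pr_TM H g a y)%MS.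
Proof.
move=> Wy XQ.
have sD : smooth_mx a W (fun z => D *m B z).
  exact: (smooth_mxM oW Wa (smooth_mx_cst a W D) sB).
have DH z : W z -> (D *m B z <= H g a z)%MS.
  by move=> /BH[BHz _ _ _]; exact: submx_trans (submxMl D _) BHz.
have D0 z : W z -> tbe (D *m B z) = 0 by move=> /BH[].
have tD z : tvec (D *m B z) = D *m Ym z by rewrite mul_tvec_mx.
have DL : (D *m Ym y <= pr_TM H g a y)%MS by have [_ _ _ <-] := BH Wy; exact: submxMl.
apply/pr_TMP; exists (nabla_nc g a X (fun z => D *m B z) y); split.
- exact: (parH cg oW Ws sD DH).
- rewrite /nabla_nc tbeE (dir_eq oW Wa X Wy (g := fun=> 0)); last exact: D0.
  by rewrite dir_cst sub0r tD /bform frame_perp // mxE oppr0.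
- rewrite /nabla_nc tvecE D0 // scale0r subr0.
  have -> // : tvec \o (fun z => D *m B z) = (fun z => D *m Ym z).
  by apply/funext => z /=; rewrite tD.
Qed.

(** The derivative of t has third component - g(X, Y); adding g(X, Y) t brings it into I_-^perp
    without leaving H. *)
Lemma nabla_frame_vec y (X : 'rV[R]_n) : W y ->
  ((nabla g a X Y y + tal (t y) *: X - sharp g a y (X *m schouten g a y)
   + bform (g a y) X (Y y) *: Y y)%R <= pr_TM H g a y)%MS.
Proof.
move=> Wy; have tH' z : W z -> (t z <= H g a z)%MS by move=> /tH[].
have t1 z : W z -> tbe (t z) = 1 by move=> /tH[].
apply/pr_TMP; exists (nabla_nc g a X t y + bform (g a y) X (Y y) *: t y); split.
- apply: addmx_sub; first exact: (parH cg oW Ws st tH').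
  by rewrite scalemx_sub // tH'.
- rewrite tbeD tbeZ t1 // mulr1 /nabla_nc tbeE (dir_eq oW Wa X Wy (g := fun=> 1)) //.
  by rewrite dir_cst sub0r addNr.
- by rewrite tvecD tvecZ /nabla_nc tvecE t1 // scale1r.
Qed.

(** This is the involutivity of L^perp. The Christoffel term is symmetric in v and w since the
    connection is torsion free, and by [nabla_frame] the pairing with the covariant derivative is -
    alpha g(v, w), symmetric as well. *)
Lemma conormal_closed y (v w : 'rV[R]_n) : W y -> v *m Q y = 0 -> w *m Q y = 0 ->
  w *m mder a v Q y = v *m mder a w Q y.
Proof.
move=> Wy vQ wQ.
have E (X u : 'rV[R]_n) (D : 'rV[R]_r) : X *m Q y = 0 -> u *m Q y = 0 -> u *m mder a X Q y *m D^T =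
    u *m conn a g X y *m g a y *m (D *m Ym y)^T - tal (D *m B y) *: (u *m g a y *m X^T).
  move=> XQ uQ.
  have sD : smooth_mx a W (fun z => D *m Ym z).
    exact: (smooth_mxM oW Wa (smooth_mx_cst a W D) sYm).
  have sQ : smooth_mx a W Q by exact: (smooth_mxM oW Wa sg (smooth_mx_tr sYm)).
  have -> : u *m mder a X Q y *m D^T = u *m mder a X (fun z => g a z *m (D *m Ym z)^T) y.
    rewrite -mulmxA; congr (_ *m _).
    rewrite (mder_eq oW Wa X Wy (G := fun z => Q z *m D^T)); last first.
      by move=> z _; rewrite trmx_mul mulmxA.
    by rewrite (mderM oW Wa Wy X sQ (smooth_mx_cst a W D^T)) mder_cst mulmx0 addr0.
  rewrite (pairing_nabla X u oW Wa mg sD Wy); congr (_ + _).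
  have := frame_perp Wy uQ (nabla_frame D Wy XQ).
  rewrite [(_ + _)^T]raddfD /= mulmxDr => /eqP; rewrite addr_eq0 => /eqP ->.
  by rewrite [(_ *: _)^T]linearZ /= -scalemxAr.
have bC : w *m g a y *m v^T = v *m g a y *m w^T.
  by apply/matrixP => i j; rewrite !ord1; exact: (bformC _ _ (gT Wy)).
have C (D : 'rV[R]_r) : w *m mder a v Q y *m D^T = v *m mder a w Q y *m D^T.
  apply: (etrans (E v w D vQ wQ)); apply: (etrans _ (esym (E w v D wQ vQ))).
  by rewrite bC (connC oW Wa mg v w Wy).
move: (w *m mder a v Q y) (v *m mder a w Q y) C => p q C.
by apply: trmx_inj; apply: eq_mulmx => D; rewrite -[D]trmxK -!trmx_mul C.
Qed.

(** By [nabla_frame_vec] the derivative of g(Y, .) on L^perp is a sum of terms each symmetric in v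
    and w: the Christoffel term, the Schouten tensor, a multiple of g, and g(v, Y) g(w, Y). *)
Lemma flow_form_closed y (v w : 'rV[R]_n) : W y -> v *m Q y = 0 -> w *m Q y = 0 ->
  v *m (mder a w (fun z => - (Y z *m g a z)) y)^T = w *m (mder a v (fun z => - (Y z *m g a z)) y)^T.
Proof.
move=> Wy vQ wQ.
have sgY : smooth_mx a W (fun z => g a z *m (Y z)^T).
  exact: (smooth_mxM oW Wa sg (smooth_mx_tr sY)).
have E (X u : 'rV[R]_n) : u *m Q y = 0 -> u *m (mder a X (fun z => - (Y z *m g a z)) y)^T =
    - (u *m conn a g X y *m g a y *m (Y y)^T
       + (u *m g a y *m (sharp g a y (X *m schouten g a y))^T - tal (t y) *: (u *m g a y *m X^T)
          - bform (g a y) X (Y y) *: (u *m g a y *m (Y y)^T))).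
  move=> uQ.
  have -> : (mder a X (fun z => - (Y z *m g a z)) y)^T = - mder a X (fun z => g a z *m (Y z)^T) y.
    rewrite (mder_eq oW Wa X Wy (G := fun z => - (g a z *m (Y z)^T)^T)); last first.
      by move=> z Wz; rewrite trmx_mul trmxK gT.
    rewrite (mderN oW Wa Wy X (smooth_mx_tr sgY)) (mder_tr oW Wa Wy X sgY).
    by rewrite [(- _)^T]raddfN /= trmxK.
  rewrite mulmxN (pairing_nabla X u oW Wa mg sY Wy); congr (- (_ + _)).
  have := frame_perp Wy uQ (nabla_frame_vec X Wy).
  have phiD (p q : 'rV[R]_n) : u *m g a y *m (p + q)^T = u *m g a y *m p^T + u *m g a y *m q^T.
    by rewrite raddfD /= mulmxDr.
  have phiN (p : 'rV[R]_n) : u *m g a y *m (- p)^T = - (u *m g a y *m p^T).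
    by rewrite raddfN /= mulmxN.
  have phiZ k (p : 'rV[R]_n) : u *m g a y *m (k *: p)^T = k *: (u *m g a y *m p^T).
    by rewrite linearZ /= -scalemxAr.
  rewrite !phiD phiN !phiZ.
  move: (_ *m (nabla _ _ _ _ _)^T) (_ *m (sharp _ _ _ _)^T) (_ *: _) (_ *: _) => p q k l E.
  apply/eqP; rewrite -subr_eq0 -E; apply/eqP.
  by apply/matrixP => i j; rewrite !mxE; ring.
have bC (p q : 'rV[R]_n) (A : 'M[R]_n) : A^T = A -> p *m A *m q^T = q *m A *m p^T.
  by move=> AT; apply/matrixP => i j; rewrite !ord1; exact: (bformC _ _ AT).
have KT := schouten_sym oW Wa mg Wy.
have Kp (X u : 'rV[R]_n) : u *m g a y *m (sharp g a y (X *m schouten g a y))^T =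
    u *m schouten g a y *m X^T.
  rewrite /sharp !trmx_mul KT trmx_inv gT // !mulmxA; congr (_ *m _ *m _).
  by rewrite -mulmxA mulmxV ?mulmx1 // gU.
rewrite (E w v vQ) (E v w wQ) !Kp (connC oW Wa mg v w Wy) (bC w v _ KT) (bC w v _ (gT Wy)).
congr (- (_ + (_ - _))).
apply/matrixP => i j; rewrite !ord1 [LHS]mxE [RHS]mxE.
by rewrite -!/(bform _ _ _) mulrC.
Qed.

Variable P2 : 'M[R]_(r, n).

(* The projection onto L^perp whose kernel, the row space of P2, is constant. *)
Definition perp_proj y : 'M[R]_n := 1%:M - Q y *m invmx (P2 *m Q y) *m P2.

Hypothesis QU : forall y, W y -> P2 *m Q y \in unitmx.
Local Notation Pi := perp_proj.

Lemma smooth_conormal : smooth_mx a W Q.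
Proof. exact: (smooth_mxM oW Wa sg (smooth_mx_tr sYm)). Qed.

Lemma smooth_perp_proj : smooth_mx a W Pi.
Proof.
have sQ := smooth_conormal.
have sPQ := smooth_mxM oW Wa (smooth_mx_cst a W P2) sQ.
apply: (smooth_mxD oW Wa (smooth_mx_cst a W 1%:M)); apply: (smooth_mxN oW Wa).
apply: (smooth_mxM oW Wa _ (smooth_mx_cst a W P2)).
by apply: (smooth_mxM oW Wa sQ); exact: (smooth_mx_inv oW Wa QU sPQ).
Qed.

Lemma perp_projQ y : W y -> Pi y *m Q y = 0.
Proof. by move=> Wy; rewrite mulmxBl mul1mx -!mulmxA mulVmx ?QU // mulmx1 subrr. Qed.

Lemma perp_proj_id y (X : 'rV[R]_n) : X *m Q y = 0 -> X *m Pi y = X.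
Proof. by move=> XQ; rewrite mulmxBr mulmx1 !mulmxA -[X *m g a y *m _]mulmxA XQ !mul0mx subr0. Qed.

Lemma P2_perp_proj y : W y -> P2 *m Pi y = 0.
Proof. by move=> Wy; rewrite mulmxBr mulmx1 !mulmxA mulmxV ?mul1mx ?subrr // -mulmxA QU. Qed.

(** Derivatives of [perp_proj] take values in the constant complement, while [conormal_closed] puts
    the bracket of the two fields into L^perp; so the bracket vanishes. *)
Lemma perp_proj_comm y0 y (v w : 'rV[R]_n) : P2 *m Q y0 = 1%:M -> W y ->
  w *m mder a (v *m Pi y) Pi y = v *m mder a (w *m Pi y) Pi y.
Proof.
move=> Q01 Wy; have sPi := smooth_perp_proj; have sQ := smooth_conormal.
pose D X := mder a X Pi y.
have PD X : P2 *m D X = 0.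
  have := mderM oW Wa Wy X (smooth_mx_cst a W P2) sPi.
  rewrite mder_cst mul0mx add0r => <-.
  rewrite (mder_eq oW Wa X Wy (G := fun=> 0)); last by move=> z; exact: P2_perp_proj.
  exact: mder_cst.
have DE X : D X = D X *m Q y0 *m P2.
  (* By the normalisation at y0, [Q y0 *m P2] is a constant projection onto the row space of P2.
     Modulo that row space [Pi] is the identity, so its derivative falls into it. *)
  have PiE z : W z -> Pi z *m (1%:M - Q y0 *m P2) = 1%:M - Q y0 *m P2.
    move=> Wz; rewrite /perp_proj; move: (Q z *m invmx _) (Q y0) Q01 => A Q0 Q01'.
    rewrite mulmxBr mulmx1 mulmxA mulmxBl mul1mx -(mulmxA A) Q01' mulmx1 mulmxBl.
    by rewrite opprB addrA subrK.
  have := mderM oW Wa Wy X sPi (smooth_mx_cst a W (1%:M - Q y0 *m P2)).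
  rewrite mder_cst mulmx0 addr0 (mder_eq oW Wa X Wy PiE) mder_cst => /esym/eqP.
  rewrite -/(D X); move: (D X) (Q y0) => A q.
  by rewrite mulmxBr mulmx1 subr_eq0 mulmxA => /eqP.
have DQ X : D X *m Q y = - (Pi y *m mder a X Q y).
  have := mderM oW Wa Wy X sPi sQ.
  rewrite (mder_eq oW Wa X Wy (G := fun=> 0)); last by move=> z; exact: perp_projQ.
  by rewrite mder_cst => /esym/eqP; rewrite addr_eq0 => /eqP.
have vPi (u : 'rV[R]_n) X : u *m D X = u *m Pi y *m D X.
  rewrite /perp_proj; move: (Q y *m invmx _) (D X) (PD X) => A E PE.
  by rewrite mulmxBr mulmx1 mulmxBl -mulmxA -(mulmxA A) PE !mulmx0 subr0.
have PiQ (u : 'rV[R]_n) : u *m Pi y *m Q y = 0 by rewrite -mulmxA perp_projQ // mulmx0.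
have PiPi (u : 'rV[R]_n) : u *m Pi y *m Pi y = u *m Pi y by rewrite perp_proj_id.
rewrite -!/(D _) vPi [RHS]vPi; move: (v *m Pi y) (w *m Pi y) (PiQ v) (PiQ w) (PiPi v) (PiPi w).
move=> v' w' vQ wQ vP wP.
exact: (projection_derivative_eq (DE v') (DE w') (DQ v') (DQ w') wP vP (conormal_closed Wy vQ wQ) (QU Wy)).
Qed.

Lemma potential_at y0 : W y0 -> P2 *m Q y0 = 1%:M ->
  exists (W' : set M) (s : M -> R), [/\ open W', W' y0, W' `<=` W, smooth_in a W' s &
    forall y, W' y -> ((Y y + dgrad a g s y)%R <= pr_TM H g a y)%MS].
Proof.
move=> Wy0 Q01.
pose om z := - (Y z *m g a z).
have oV := img_open_sub oW Wa.
have som : smooth_mx a W om by apply: (smooth_mxN oW Wa); exact: (smooth_mxM oW Wa sY sg).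
have PiQ y (u : 'rV[R]_n) : W y -> u *m Pi y *m Q y = 0.
  by move=> Wy; rewrite -mulmxA perp_projQ // mulmx0.
have comm y : W y -> forall v w : 'rV[R]_n,
    w *m dmat (Pi \o cparam a) (ccoo a y) (v *m Pi y) =
    v *m dmat (Pi \o cparam a) (ccoo a y) (w *m Pi y).
  move=> Wy v w; have dE u := dmat_mder u oW Wa smooth_perp_proj Wy.
  by rewrite (dE (v *m Pi y)) (dE (w *m Pi y)); exact: (perp_proj_comm _ _ Q01).
have closed y : W y -> forall v w : 'rV[R]_n,
    v *m Pi y *m (dmat (om \o cparam a) (ccoo a y) (w *m Pi y))^T =
    w *m Pi y *m (dmat (om \o cparam a) (ccoo a y) (v *m Pi y))^T.
  move=> Wy v w; have dE u := dmat_mder u oW Wa som Wy.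
  by rewrite (dE (v *m Pi y)) (dE (w *m Pi y)); apply: flow_form_closed => //; exact: PiQ.
have [u Vu v w|u Vu v w|D [sig [oD Du0 DV ssig Dsig]]] :=
    frobenius_potential oV smooth_perp_proj som _ _ (img_coo a Wy0).
- by have [Wu Eu] := img_param Wa Vu; have := comm _ Wu v w; rewrite Eu.
- by have [Wu Eu] := img_param Wa Vu; have := closed _ Wu v w; rewrite Eu.
pose W' : set M := cdom a `&` ccoo a @^-1` D.
have W'W : W' `<=` W.
  by move=> y [ay Dy]; have := (img_param Wa (DV _ Dy)).1; rewrite paramK.
have oW' : open W' by exact: preimage_open.
have W'a : W' `<=` cdom a by move=> y [].
have sE u : D u -> sig (ccoo a (cparam a u)) = sig u by move=> /DV/(img_param Wa)[_ ->].
have ss : smooth_in a W' (sig \o ccoo a).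
  move=> k; apply: (Ck_on_eq (img_open_sub oW' W'a) (f := sig)).
    by move=> u [y [_ Dy] <-] /=; rewrite sE.
  by apply: Ck_on_sub (ssig k) => u [y [_ Dy] <-].
exists W', (sig \o ccoo a); split=> //; first by split; [exact: Wa|].
move=> y W'y; have Wy := W'W y W'y; have mg' := metric_in_sub W'W mg.
pose z := Y y + dgrad a g (sig \o ccoo a) y.
have perp (X : 'rV[R]_n) : X *m Q y = 0 -> X *m g a y *m z^T = 0.
  move=> XQ; have Dy : D (ccoo a y) by case: W'y.
  have := Dsig _ Dy X; rewrite /= paramK; last exact: Wa.
  move=> /(_ (perp_proj_id XQ)) E.
  have Ed : dir a X (sig \o ccoo a) y = (X *m (om y)^T) 0 0.
    have DK u : D u -> ccoo a (cparam a u) = u by move=> Du; exact: (img_param Wa (DV _ Du)).2.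
    exact: etrans (@dir_comp_coo R n M a D sig y X oD Dy DK) E.
  move: Ed; rewrite (dir_dgrad oW' W'a mg' ss X W'y) /om raddfN /= mulmxN trmx_mul gT // mulmxA => Ed.
  rewrite /z raddfD /= mulmxDr; move: Ed; rewrite /bform.
  move: (X *m g a y *m (dgrad _ _ _ _)^T) (X *m g a y *m (Y y)^T) => p q Ed.
  by apply/matrixP => i j; rewrite !ord1 mxE Ed !mxE subrr.
(* z = Y + grad s is orthogonal to all of L^perp. Expanding [Pi] in this equation exhibits z as a
   combination of the rows spanning L, an explicit form of (L^perp)^perp = L. *)
have Pz : Pi y *m (g a y *m z^T) = 0.
  apply: eq_mulmx => u; rewrite mulmxA mulmx0 mulmxA perp //; exact: PiQ.
move: Pz; rewrite /perp_proj mulmxBl mul1mx => /eqP; rewrite subr_eq0 => /eqP Pz.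
have [_ _ _ <-] := BH Wy.
have Ez : z^T = (Ym y)^T *m (invmx (P2 *m Q y) *m P2 *m (g a y *m z^T)).
  by apply: (can_inj (mulKmx (gU Wy))); rewrite [LHS]Pz !mulmxA.
by rewrite -[X in (X <= _)%MS]trmxK -/z Ez trmx_mul trmxK submxMl.
Qed.

End LocalFrame.

(** The relation found for one section with third component 1 extends to every element of H by
    subtracting a multiple of that section, and to every chart because both sides transform as
    vectors. *)
Lemma gauge_potential g x : c g -> beta_locus x ->
  exists (U : set M) (s : M -> R), [/\ open U, U x, U `<=` beta_locus, smooth_fun U s &
    forall b y, U y -> cdom b y -> forall t : tr, (t <= H g b y)%MS ->
      ((tvec t + tbe t *: dgrad b g s y)%R <= pr_TM H g b y)%MS].
Proof.
move=> cg bx; have [a ax] := atlas_cover x.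
have [W1 [t [B [[oW1 W1x W1a W1b] st1 sB1 tH1 BH1]]]] := beta_frame_vec bx cg ax.
have mg1 : metric_in a W1 g by exact: (pmetric_in (class_pmetric cg)).
pose Q y := g a y *m (tvec_mx (B y))^T.
have sQ : smooth_mx a W1 Q.
  case: mg1 => sg _ _; exact: (smooth_mxM oW1 W1a sg (smooth_mx_tr (smooth_tvec_mx sB1))).
(* The rows of P span the constant complement of L^perp; P exists because the frame of L is row free
   and the metric is nondegenerate. *)
have [P Q1] : exists P : 'M[R]_(r, n), P *m Q x = 1%:M.
  have [_ _ Ff _] := BH1 x W1x; have [_ /(_ x W1x) GT /(_ x W1x) GU] := mg1.
  have /row_freeP[P PE] : row_free ((Q x)^T).
    rewrite trmx_mul trmxK GT /row_free mxrankMfree ?row_free_unit //.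
  by exists P^T; apply: trmx_inj; rewrite trmx_mul trmxK trmx1.
have [|W [oW Wx WW1 WU]] := smooth_in_unitmx oW1 W1a (smooth_mxM oW1 W1a (smooth_mx_cst a W1 P) sQ) W1x.
  by rewrite Q1 unitmx1.
have Wa : W `<=` cdom a by move=> y /WW1/W1a.
have tH y : W y -> (t y <= H g a y)%MS /\ tbe (t y) = 1 by move=> /WW1; exact: tH1.
have BH y : W y -> [/\ (B y <= H g a y)%MS, forall u, tbe (u *m B y) = 0,
  row_free (tvec_mx (B y)) & (tvec_mx (B y) :=: pr_TM H g a y)%MS] by move=> /WW1; exact: BH1.
have [U [s [oU Ux UW ss sL]]] := potential_at cg oW Wa (smooth_mx_sub WW1 st1)
  (smooth_mx_sub WW1 sB1) tH BH WU Wx Q1.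
have Ua : U `<=` cdom a by move=> y /UW/Wa.
have sU : smooth_fun U s.
  move=> b; apply: (smooth_in_chart (a := a)); first exact: openIcdom.
  - by move=> y [/Ua].
  - by move=> y [].
  - by apply: smooth_in_sub ss => y [].
have HLa y (t' : tr) : U y -> (t' <= H g a y)%MS ->
    ((tvec t' + tbe t' *: dgrad a g s y)%R <= pr_TM H g a y)%MS.
  move=> Uy tH'; have [ty t1] := tH y (UW y Uy).
  have -> : tvec t' + tbe t' *: dgrad a g s y = tvec (t' - tbe t' *: t y)
      + tbe t' *: (tvec (t y) + dgrad a g s y).
    by rewrite -scaleNr tvecD tvecZ scalerDr scaleNr addrA subrK.
  apply: addmx_sub; last by rewrite scalemx_sub // sL.
  apply/pr_TMP; exists (t' - tbe t' *: t y); split=> //.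
    by apply: addmx_sub => //; rewrite eqmx_opp scalemx_sub.
  by rewrite -scaleNr tbeD tbeZ t1 mulr1 subrr.
exists U, s; split=> // [y /UW/WW1/W1b//|b y Uy yb t' tH'].
have ya := Ua y Uy.
have mgU : pmetric U g.
  have [mJ mI] := class_pmetric cg; split=> [b1 b2 z _|b1]; first exact: mJ.
  by apply: metric_in_sub (mI b1) => z [].
rewrite -[t'](chart_changeK t' ya yb) tvecE tbeE (dgrad_chart oU mgU sU Uy ya yb).
rewrite scalemxAl -mulmxDl; apply: pr_TM_chart => //.
apply: HLa => //; exact: subspace_chart.
Qed.

(** The counterpart of [projection_derivative_eq] for L. The connection terms cancel by torsion
    freeness, so the bracket lies in the row space of A; the derivatives of the projection lie in
    the kernel of B, and the two meet only in 0. *)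
Lemma involutive_derivative_eq (D E C C' : 'M[R]_n) (A : 'M[R]_(r, n)) (B : 'M[R]_(n, r))
    (v w v' w' : 'rV[R]_n) : D *m B = 0 -> E *m B = 0 -> w' *m C = v' *m C' ->
  ((w *m D + w' *m C)%R <= A)%MS -> ((v *m E + v' *m C')%R <= A)%MS -> A *m B \in unitmx ->
  w *m D = v *m E.
Proof.
move=> DB EB CC wA vA U; apply/eqP; rewrite -subr_eq0; apply/eqP.
have : ((w *m D + w' *m C - (v *m E + v' *m C'))%R <= A)%MS.
  by apply: addmx_sub => //; rewrite eqmx_opp.
rewrite CC opprD addrACA subrr addr0 => /submxP[Z ZE]; rewrite ZE.
suff -> : Z = 0 by rewrite mul0mx.
apply: (can_inj (mulmxK U)); rewrite mul0mx mulmxA -ZE mulmxBl -!mulmxA DB EB.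
by rewrite !mulmx0 subrr.
Qed.

(** * The Ricci tensor of e^(2 s) g, and L as a parallel and integrable distribution *)

Section GaugedMetric.
Variables (g : tensor2 M) (U : set M) (s : M -> R).
Hypotheses (cg : c g) (oU : open U) (Ub : U `<=` beta_locus) (ss : smooth_fun U s).
Hypothesis HL : forall b y, U y -> cdom b y -> forall t : tr, (t <= H g b y)%MS ->
  ((tvec t + tbe t *: dgrad b g s y)%R <= pr_TM H g b y)%MS.

Definition gauged_metric : tensor2 M := fun b y => expR (2 * s y) *: g b y.

Local Notation h := gauged_metric.
Local Notation L := (pr_TM H g).
Local Notation gr b := (dgrad b g s).

Variable b : chart_index M.
Let W := U `&` cdom b.
Let oW : open W. Proof. exact: openIcdom. Qed.
Let Wb : W `<=` cdom b. Proof. by move=> y []. Qed.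
Let mg : metric_in b W g. Proof. exact: (pmetric_in (class_pmetric cg)). Qed.
Let sW : smooth_in b W s. Proof. exact: ss. Qed.
Let sg : smooth_mx b W (g b). Proof. by case: mg. Qed.
Let gT y : W y -> (g b y)^T = g b y. Proof. by case: mg => _ + _; exact. Qed.
Let gU y : W y -> g b y \in unitmx. Proof. by case: mg => _ _; exact. Qed.
Let hg y : W y -> h b y = expR (2 * s y) *: g b y. Proof. by []. Qed.
Let mh : metric_in b W h. Proof. exact: (conf_metric_in oW Wb mg sW hg). Qed.
Let sgr : smooth_mx b W (gr b). Proof. exact: (smooth_dgrad oW Wb mg sW). Qed.

Lemma gauge_tvec y (t : tr) : W y -> (t <= H g b y)%MS ->
  (tvec (gauge_change g b s y t) <= L b y)%MS.
Proof.
by move=> [Uy yb] tH; rewrite tvecE scalemx_sub // (HL Uy yb tH).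
Qed.

(* The section of H which becomes a multiple of (0, 0, 1) in the splitting given
   by e^(2 s) g. *)
Definition flat_section y : tr :=
  tractor (- (2^-1 * bform (g b y) (gr b y) (gr b y))) (- gr b y) 1.

(** From an element (alpha, Y, 1) of H one subtracts an element of H in I_-^perp lying over Y + grad
    s, which exists by the choice of s. The result has vector component - grad s, and its first
    component is forced because it is a null vector. *)
Lemma flat_section_in y : W y -> (flat_section y <= H g b y)%MS.
Proof.
move=> Wy; have [Uy yb] := Wy.
have [t0 t0H t00] := beta_locusP (Ub Uy) cg yb.
have [t tH t1] : exists2 t : tr, (t <= H g b y)%MS & tbe t = 1.
  by exists ((tbe t0)^-1 *: t0); rewrite ?scalemx_sub // tbeZ mulVf.
have /pr_TMP[t' [tH' t'0 t'v]] := HL Uy yb tH.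
have dH : ((t - t')%R <= H g b y)%MS by apply: addmx_sub => //; rewrite eqmx_opp.
have dv : tvec (t - t') = - gr b y.
  have -> : t - t' = t + (-1) *: t' by rewrite scaleN1r.
  by rewrite tvecD tvecZ t'v t1 scale1r scaleN1r opprD addrA subrr sub0r.
have d1 : tbe (t - t') = 1 by rewrite -scaleN1r tbeD tbeZ t1 t'0 mulr0 addr0.
have := llH cg yb dH dH; rewrite /tform d1 dv !mulr1.
rewrite bformNl bformNr opprK => E.
have -> // : flat_section y = t - t'.
apply: tractor_ext; rewrite !(talE, tvecE, tbeE) //.
by move: E; move: (tal _) (bform _ _ _) => p q E; lra.
Qed.

Lemma bform_smooth (Y Z : M -> 'rV[R]_n) : smooth_mx b W Y -> smooth_mx b W Z ->
  smooth_in b W (fun y => bform (g b y) (Y y) (Z y)).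
Proof.
by move=> sY sZ; exact: (smooth_mxM oW Wb (smooth_mxM oW Wb sY sg) (smooth_mx_tr sZ) 0 0).
Qed.

Lemma smooth_tractor (W' : set M) al (Y : M -> 'rV[R]_n) be : open W' -> W' `<=` cdom b ->
  smooth_in b W' al -> smooth_mx b W' Y ->
  smooth_in b W' be -> smooth_mx b W' (fun y => tractor (al y) (Y y) (be y)).
Proof.
move=> oW' Wb' sal sY sbe.
have scal1 (f : M -> R) : smooth_in b W' f -> smooth_mx b W' (fun y => (f y)%:M : 'M[R]_1).
  move=> sf i j; apply: (eq_smooth_in oW' Wb' _ sf) => y _.
  by rewrite mxE !ord1 eqxx mulr1n.
apply: smooth_mx_row; last exact: scal1.
by apply: smooth_mx_row => //; exact: scal1.
Qed.

Lemma smooth_flat_section : smooth_mx b W flat_section.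
Proof.
apply: smooth_tractor => //; last exact: smooth_in_cst.
  apply: (smooth_inN oW Wb); apply: (smooth_inM oW Wb); first exact: smooth_in_cst.
  exact: bform_smooth.
exact: (smooth_mxN oW Wb).
Qed.

Lemma gauge_flat_section y : W y -> gauge_change g b s y (flat_section y) = tractor 0 0 (expR (s y)).
Proof.
move=> Wy; rewrite (gaugeE oW Wb _ mg sW Wy) /gauge_pt !(talE, tvecE, tbeE) mulr1.
have -> : bform (g b y) (- gr b y) (gr b y) = - bform (g b y) (gr b y) (gr b y).
  exact: bformNl.
rewrite scale1r addNr scaler0.
have -> : - (2^-1 * bform (g b y) (gr b y) (gr b y)) - - bform (g b y) (gr b y) (gr b y) -
   2^-1 * 1 * bform (g b y) (gr b y) (gr b y) = 0.
  by move: (bform _ _ _) => p; field.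
by rewrite mulr0.
Qed.

(** In the splitting of the new metric the flat section is (0, 0, e^s), and the vector component of
    its derivative is - e^s times the sharp of the Schouten tensor. *)
Lemma sharp_schouten_gauged y v : W y -> (sharp h b y (v *m schouten h b y) <= L b y)%MS.
Proof.
move=> Wy.
have Ws : W `<=` setT `&` cdom b by move=> z Wz; split=> //; exact: Wb.
have nH := parH cg oW Ws smooth_flat_section flat_section_in v Wy.
have := gauge_tvec Wy nH.
rewrite -(gauge_covariant oW Wb mg sW hg n3 smooth_flat_section v Wy).
rewrite (nabla_nc_eq _ _ oW Wb Wy gauge_flat_section) /nabla_nc !(tvecE, talE, tbeE) scale0r addr0.
have -> : tvec \o (fun z => tractor 0 0 (expR (s z)) : tr) = (fun=> 0).
  by apply/funext => z /=; rewrite tvecE.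
rewrite nablaE mder_cst mul0mx addr0 sub0r eqmx_opp => sL.
by rewrite -[X in (X <= _)%MS](scalerK (lt0r_neq0 (expR_gt0 (s y)))) scalemx_sub.
Qed.

Lemma ricci_gauged y : W y -> (ricci_endo h b y <= L b y)%MS.
Proof.
move=> Wy; have [Uy yb] := Wy.
have n2 : (n%:R - 2 : R) != 0 by rewrite subr_eq0 eqr_nat; case: n n3 => [|[|[]]].
have n1 : (n%:R - 1 : R) != 0 by rewrite subr_eq0 -[1]/(1%:R) eqr_nat; case: n n3 => [|[]].
have [_ /(_ y Wy) hT /(_ y Wy) hU] := mh.
pose S := schouten h b y *m invmx (h b y).
have SL : (S <= L b y)%MS.
  apply/row_subP => i; rewrite rowE /S mulmxA; exact: sharp_schouten_gauged.
have llh : lightlike (h b y) (L b y).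
  by move=> v w vL wL; rewrite /h bformZ (pr_TM_lightlike cg yb vL wL) mulr0.
have Sh : S *m h b y = schouten h b y by rewrite mulmxKV.
have [|_ tr0] := selfadjoint_lightlike llh SL hT _ hU.
  by rewrite Sh (schouten_sym oW Wb mh Wy).
have SE : S = (n%:R - 2)^-1 *: ((scal h b y / (2 * (n%:R - 1)))%:M - ricci_endo h b y).
  rewrite /S /schouten -scalemxAl mulmxBl -scalemxAl mulmxV // -/(ricci_endo h b y).
  by rewrite scalemx1.
(* The trace of the Schouten endomorphism is - scal / (2 (n - 1)), and it vanishes by
   [selfadjoint_lightlike]. *)
have sc0 : scal h b y = 0.
  move: tr0; rewrite SE mxtraceZ linearB /= mxtrace_scalar /ricci_endo mxtrace_mulC -/(scal h b y).
  move=> /eqP; rewrite mulf_eq0 invr_eq0 (negbTE n2) /= -[_ *+ n]mulr_natr => /eqP E.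
  move: (scal h b y) E => k E.
  have : k * (n%:R - 2) = 0.
    have -> : k * (n%:R - 2) = - (2 * (n%:R - 1)) * (k / (2 * (n%:R - 1)) * n%:R - k) by field.
    by rewrite E mulr0.
  by move/eqP; rewrite mulf_eq0 (negbTE n2) orbF => /eqP.
have -> : ricci_endo h b y = - (n%:R - 2) *: S.
  by rewrite SE sc0 mul0r raddf0 sub0r !scalerN scaleNr opprK scalerA mulfV // scale1r.
by rewrite scalemx_sub.
Qed.

Lemma gauged_metric_parallel : parallel_in b U (L b) (nabla h b).
Proof.
move=> W' Z oW' W'W sZ ZL y v W'y.
have W'b : W' `<=` cdom b by move=> z /W'W[].
have mgW := metric_in_sub W'W mg; have sWW := smooth_in_sub W'W sW.
have sgrW := smooth_mx_sub W'W sgr; have sgW := smooth_mx_sub W'W sg.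
(* The lift of Z to H: its first component is forced by orthogonality to the flat section, and in
   the splitting of the new metric it becomes e^(- s) (0, Z, 0). *)
pose t z : tr := tractor (bform (g b z) (Z z) (gr b z)) (Z z) 0.
have st : smooth_mx b W' t.
  apply: smooth_tractor => //; last exact: smooth_in_cst.
  exact: (smooth_mxM oW' W'b (smooth_mxM oW' W'b sZ sgW) (smooth_mx_tr sgrW) 0 0).
have tH z : W' z -> (t z <= H g b z)%MS.
  move=> W'z; have [Uz zb] := W'W z W'z.
  have /pr_TMP[t' [tH' t'0 t'v]] := ZL z W'z.
  have := llH cg zb tH' (flat_section_in (W'W z W'z)).
  rewrite /tform /flat_section !(talE, tvecE, tbeE) t'0 mulr0 mulr1 t'v addr0.
  rewrite bformNr => /eqP; rewrite subr_eq0 => /eqP E.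
  by rewrite /t -E -t'v -t'0 tractorK.
have gt z : W' z -> gauge_change g b s z (t z) = tractor 0 (expR (- s z) *: Z z) 0.
  move=> W'z; rewrite (gaugeE oW Wb _ mg sW (W'W z W'z)) /gauge_pt !(talE, tvecE, tbeE).
  by rewrite subrr !mulr0 mul0r subr0 mulr0 scale0r addr0.
have Ws : W' `<=` setT `&` cdom b by move=> z W'z; split=> //; exact: W'b.
have nH := parH cg oW' Ws st tH v W'y.
have := gauge_tvec (W'W y W'y) nH.
rewrite -(gauge_covariant oW' W'b mgW sWW (fun z W'z => hg (W'W z W'z)) n3 st v W'y).
rewrite (nabla_nc_eq _ _ oW' W'b W'y gt) /nabla_nc !(tvecE, talE, tbeE) !scale0r addr0 subr0.
have -> : tvec \o (fun z => tractor 0 (expR (- s z) *: Z z) 0 : tr) = (fun z => expR (- s z) *: Z z).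
  by apply/funext => z /=; rewrite tvecE.
rewrite !nablaE (mderZ oW' W'b W'y v (smooth_expN oW' W'b sWW) sZ) (dir_expN oW' W'b sWW v W'y).
rewrite -scalemxAl -addrA -scalerDr => nL.
rewrite -[X in (X <= _)%MS](scalerK (lt0r_neq0 (expR_gt0 (- s y)))) scalemx_sub //.
move: nL; set k := _ *: Z y; set N := _ *: _ => nL.
by rewrite -[N](addKr k); apply: addmx_sub => //; rewrite eqmx_opp scalemx_sub // ZL.
Qed.

Lemma integral_leaf x : U x -> cdom b x -> exists (D : set 'rV[R]_r) (f : 'rV[R]_r -> M),
  [/\ open D, D 0, f 0 = x, forall u, D u -> U (f u) /\ cdom b (f u) &
      (forall j, smooth_on D (fun u => ccoo b (f u) 0 j)) /\
      forall u, D u -> (\matrix_(i < r, j < n)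
        'D_(basis_vec i) (fun w => ccoo b (f w) 0 j : R) u :=: L b (f u))%MS].
Proof.
move=> Ux bx.
have [W1 [t [B [[oW1 W1x W1a W1b] _ sB _ BH1]]]] := beta_frame_vec (Ub Ux) cg bx.
pose W2 := W1 `&` W.
have oW2 : open W2 by exact: openI.
have W2b : W2 `<=` cdom b by move=> y [_ []].
have W2W : W2 `<=` W by move=> y [].
have W2x : W2 x by [].
pose Ym y := tvec_mx (B y).
have sY2 : smooth_mx b W2 Ym by apply: smooth_mx_sub (smooth_tvec_mx sB) => y [].
have [_ _ Ff _] := BH1 x W1x; have /row_freeP[R0 R01] := Ff.
have [|W3 [oW3 W3x W32 RU]] := smooth_in_unitmx oW2 W2b
    (smooth_mxM oW2 W2b sY2 (smooth_mx_cst b W2 R0)) W2x.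
  by rewrite R01 unitmx1.
have W3b : W3 `<=` cdom b by move=> y /W32/W2b.
have sY : smooth_mx b W3 Ym by exact: smooth_mx_sub sY2.
have mh3 : metric_in b W3 h by apply: metric_in_sub mh => y /W32/W2W.
have YL y : W3 y -> (Ym y :=: L b y)%MS by move=> /W32[/BH1[]].
(* The projection onto L whose kernel, the vectors X with [X *m R0 = 0], does not depend on the
   point. *)
pose P y := R0 *m invmx (Ym y *m R0) *m Ym y.
have sP : smooth_mx b W3 P.
  have sYR := smooth_mxM oW3 W3b sY (smooth_mx_cst b W3 R0).
  apply: (smooth_mxM oW3 W3b _ sY); apply: (smooth_mxM oW3 W3b (smooth_mx_cst b W3 R0)).
  exact: (smooth_mx_inv oW3 W3b RU sYR).
have PR y : W3 y -> P y *m R0 = R0 by move=> W3y; rewrite -!mulmxA mulVmx ?mulmx1 // RU.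
have comm y : W3 y -> forall v w : 'rV[R]_n,
    w *m dmat (P \o cparam b) (ccoo b y) (v *m P y) =
    v *m dmat (P \o cparam b) (ccoo b y) (w *m P y).
  move=> W3y v w; have dE u := dmat_mder u oW3 W3b sP W3y.
  rewrite (dE (v *m P y)) (dE (w *m P y)).
  have nL (u X : 'rV[R]_n) : ((u *m mder b X P y + u *m P y *m conn b h X y)%R <= L b y)%MS.
    have su : smooth_mx b W3 (fun z => u *m P z).
      exact: (smooth_mxM oW3 W3b (smooth_mx_cst b W3 u) sP).
    have W3s : W3 `<=` U `&` cdom b by move=> z /W32/W2W.
    have uL z : W3 z -> (u *m P z <= L b z)%MS.
      by move=> /YL <-; rewrite mulmxA submxMl.
    have := gauged_metric_parallel oW3 W3s su uL X W3y.
    rewrite nablaE (mderM oW3 W3b W3y X (smooth_mx_cst b W3 u) sP) mder_cst mul0mx add0r.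
    by [].
  have DR X : mder b X P y *m R0 = 0.
    have := mderM oW3 W3b W3y X sP (smooth_mx_cst b W3 R0).
    rewrite mder_cst mulmx0 addr0 => <-.
    by rewrite (mder_eq oW3 W3b X W3y PR) mder_cst.
  have nw := nL w (v *m P y); have nv := nL v (w *m P y).
  rewrite -(YL y W3y) in nw; rewrite -(YL y W3y) in nv.
  exact: (involutive_derivative_eq (DR _) (DR _)
    (connC oW3 W3b mh3 (v *m P y) (w *m P y) W3y) nw nv (RU y W3y)).
have oV := img_open_sub oW3 W3b.
(* Only the leaf is wanted here, so the form carried along by the flow is taken to be zero. *)
pose om (u : 'rV[R]_n) : 'rV[R]_n := 0.
have som : smooth_mxon (ccoo b @` W3) om by move=> i j k; exact: Ck_on_cst.
have [u Vu v w|u Vu v w|D [f [oD D0 f0 sf Df]]] :=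
    frobenius_leaf oV sP som _ _ (Ym x) (img_coo b W3x).
- by have [Wu Eu] := img_param W3b Vu; have := comm _ Wu v w; rewrite Eu.
- have dz X : dmat om u X = 0.
    apply/matrixP => i j; rewrite [LHS]mxE [RHS]mxE big1 // => l _.
    by rewrite (_ : (fun y : 'rV[R]_n => om y i j) = (fun=> 0)) ?derive_cst ?mulr0 //; apply/funext => z; rewrite mxE.
  by rewrite !dz !trmx0 !mulmx0.
have fW u : D u -> W3 (cparam b (f u)) /\ ccoo b (cparam b (f u)) = f u.
  by move=> /Df[Vf _]; exact: (img_param W3b).
exists D, (fun u => cparam b (f u)); split=> //.
- by rewrite f0 paramK.
- by move=> u /fW[/W32/W2W].
split=> [j k|u Du].
  apply: (Ck_on_eq oD _ (sf 0 j k)) => u /fW[_ ->].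
  by [].
have [_ dfu] := Df u Du; have [Wf Ef] := fW u Du.
have -> : \matrix_(i < r, j < n) 'D_(basis_vec i) (fun w => ccoo b (cparam b (f w)) 0 j : R) u =
    Ym x *m P (cparam b (f u)).
  apply/row_matrixP => i; rewrite row_mul; apply/rowP => j; rewrite [LHS]mxE [LHS]mxE.
  have [_ <-] := dfu i 0 j.
  apply: near_eq_derive; apply: (open_near oD Du) => w /fW[_ ->].
  by [].
(* Since [Ym x *m R0] is the identity, the matrix of partial derivatives is an invertible matrix
   times the frame of L at the point reached. *)
rewrite /P !mulmxA R01 mul1mx; apply: eqmx_trans (YL _ Wf).
apply: eqmxMfull; rewrite row_full_unit unitmx_inv.
exact: RU.
Qed.

End GaugedMetric.

End ParallelTractors.

Theorem theorem1 (R : realType) (p q k : nat)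
    (n_ge3 : (3 <= p + q)%N) (k_ge1 : (1 <= k)%N) :
  (forall (M : smoothManifold R (p + q)) (c : set (tensor2 M))
          (H : tractor_field M),
     conformal_structure p q c ->
     tractor_subbundle c k H ->
     tractor_lightlike c H ->
     tractor_parallel c H ->
     exists Mt : set M,
       [/\ open Mt, dense Mt &
       forall g0 : tensor2 M, c g0 ->
       let L := pr_TM H g0 in
       [/\ tangent_distribution Mt (k - 1)%N L,
           forall a x, Mt x -> cdom a x -> lightlike (g0 a x) (L a x),
           integrable_dist Mt (k - 1)%N L &
       forall x, Mt x ->
       exists (U : set M) (g : tensor2 M),
         [/\ open U, U x, U `<=` Mt, restrict_class c U g &
           (forall a y, U y -> cdom a y ->
              (ricci_endo g a y <= L a y)%MS) /\
           (forall a, parallel_in a U (L a) (nabla g a))]]])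
  /\
  (forall (U : smoothManifold R (p + q)) (c : set (tensor2 U))
          (g L : tensor2 U),
     conformal_structure p q c ->
     c g ->
     tangent_distribution setT (k - 1)%N L ->
     (forall a x, cdom a x -> lightlike (g a x) (L a x)) ->
     (forall a x, cdom a x -> (ricci_endo g a x <= L a x)%MS) ->
     (forall a, parallel_in a setT (L a) (nabla g a)) ->
     exists H : tractor_field U,
       [/\ (forall a x, cdom a x ->
              (H g a x :=: L a x *m lin1_mx (fun Y => tractor 0 Y 0)
                           + tractor 0 0 1)%MS),
           tractor_subbundle c k H,
           tractor_lightlike c H &
           tractor_parallel c H]).
Proof.
case: k k_ge1 => // r _; rewrite subn1 /=; split.
  move=> M c H [g0 /is_metric_pmetric mg0 cE] subH llH parH.
  (* The locus is defined by the existence of some metric and chart, so the same set serves every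
     metric of the class. *)
  exists (beta_locus c H); split.
  - exact: (beta_locus_open cE mg0 subH).
  - exact: (beta_locus_dense n_ge3 cE mg0 subH parH).
  move=> g cg; rewrite /=.
  have pot x bx := gauge_potential cE mg0 subH llH parH cg (x := x) bx.
  split.
  - exact: (pr_TM_distribution cE mg0 subH llH cg).
  - by move=> a x _ ax; exact: (pr_TM_lightlike llH cg ax).
  - move=> x bx; have [U [s [oU Ux Ub ss HL]]] := pot x bx.
    have [a ax] := atlas_cover x.
    have [D [f [oD D0 f0 fU fL]]] :=
      integral_leaf n_ge3 cE mg0 subH llH parH cg oU Ub ss HL Ux ax.
    by exists a, D, f; split=> // u /fU[/Ub].
  move=> x bx; have [U [s [oU Ux Ub ss HL]]] := pot x bx.
  exists U, (gauged_metric g s); split=> //.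
    exists g => //; exists (fun y => expR (2 * s y)); split=> // [b|y _]; last exact: expR_gt0.
    exact: (smooth_in_exp2 (openIcdom b oU) (fun y => @proj2 _ _) (ss b)).
  split=> [a y Uy ya|a].
    by apply: (ricci_gauged n_ge3 cE mg0 subH llH parH cg oU Ub ss HL).
  exact: (gauged_metric_parallel n_ge3 cE mg0 subH llH parH cg oU Ub ss HL).
move=> U c g L [g0 /is_metric_pmetric mg0 cE] cg dL llL ricL parL.
have mg := class_pmetric cE mg0 cg.
exists (gauged_subspace g L); split.
- exact: (gauged_subspace_refl n_ge3 L mg cE cg).
- exact: (gauged_subbundle n_ge3 mg dL cE cg).
- exact: (gauged_lightlike mg llL cE cg).
- exact: (gauged_parallel n_ge3 mg llL ricL parL cE cg).
Qed.
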